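(* Let $u$ be a smooth axisymmetric finite-energy Navier–Stokes solution on $\mathbb R^3\times[0,T)$, with circulation $\Gamma=ru^\theta$ satisfying $\|\Gamma(t)\|_{L^\infty}\le\Gamma_*$, $0<\Gamma_*<\infty$, where $T$ is a hypothetical first singular time. Assume the swirl $u^\theta$ is nontrivial. Fix $0<t_0<T$ and a point $x_*=(0,0,z_* )$ on the symmetry axis, and let $$R_j\downarrow0,\qquad t_j\uparrow T,\qquad A_j:=A_{R_j}(t_j)\to\infty .$$ Then for all sufficiently large $j$ at least one of the following holds: $$\frac1{R_j}\int_{B_{R_j}(x_* )}|u^{\rm mer}(x,t_j)|^2\,dx>\frac{A_j^2}{4},$$ or $$\mathcal A_2(t_0,t_j)\ge\frac{A_j^2}{24\pi\Gamma_*^2}+\frac23\log A_j-\frac13\log Z_2(t_0)-\log2 .$$ In particular, failure of the first (meridional) alternative along an infinite subsequence forces $\mathcal A_2(t_0,t_j)\to\infty$ along that subsequence.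
   Context: $u=u^re_r+u^\theta e_\theta+u^ze_z$ in cylindrical coordinates, $u^{\rm mer}=u^re_r+u^ze_z$, $U=u^r/r$, and $A_R(t)^2=\frac1R\int_{B_R(x_* )}|u(x,t)|^2dx$ with $A_R\ge 0$. Define $$Y_2=r^{-1/2}u^\theta,\qquad Z_2(t)=\int_{\mathbb R^3}|Y_2(x,t)|^2\,dx,$$ $$U_2(t)=\frac{\int_{\mathbb R^3}U|Y_2|^2\,dx}{Z_2(t)}\ \text{ if }Z_2(t)>0,\qquad U_2(t)=0\ \text{ otherwise},$$ $$\mathcal A_2(t_0,t)=\int_{t_0}^t-U_2(s)\,ds .$$ For nontrivial swirl and fixed $t_0>0$ one has $0<Z_2(t_0)<\infty$. *)

(* Defs.v *)
From HB Require Import structures.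
From mathcomp Require Import all_boot all_order all_algebra.
From mathcomp Require Import all_classical all_reals all_analysis.

Set Implicit Arguments.
Unset Strict Implicit.
Unset Printing Implicit Defensive.

Import Order.TTheory GRing.Theory Num.Theory.
Import numFieldNormedType.Exports.

Local Open Scope classical_set_scope.
Local Open Scope ring_scope.

(* The norm of the product type R * R * R is the sup norm: it is used only for
   the topology (continuity, differentiation); [sqnorm] and [enorm] are the
   Euclidean ones. *)
Notation R3 R := (R * R * R)%type.

Definition leb3 (R : realType) :=
  (@lebesgue_measure R \x @lebesgue_measure R \x @lebesgue_measure R)%E.

Section Space.
Context {R : realType}.
Implicit Types (x v w : R3 R).

Definition vec (a b c : R) : R3 R := ((a, b), c).

Definition pcoord (i : 'I_3) x : R := nth 0 [:: x.1.1; x.1.2; x.2] i.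

Definition bvec (i : 'I_3) : R3 R :=
  vec (i == 0 :> nat)%N%:R (i == 1 :> nat)%N%:R (i == 2 :> nat)%N%:R.

Definition dot v w : R := \sum_(i < 3) pcoord i v * pcoord i w.
Definition sqnorm v : R := dot v v.
Definition enorm v : R := Num.sqrt (sqnorm v).

Definition eball x (rho : R) : set (R3 R) := [set y | enorm (y - x) < rho].

Definition partial (i : 'I_3) (f : R3 R -> R) x : R := 'D_(bvec i) f x.

Definition laplacian (f : R3 R -> R) x : R :=
  \sum_(i < 3) partial i (partial i f) x.

(* Cylindrical coordinates about the third axis. On the axis, where the frame
   is undefined, the convention 0^-1 = 0 gives e_r = e_theta = 0; the axis is
   Lebesgue negligible. *)
Definition cyl_r x : R := Num.sqrt (x.1.1 ^+ 2 + x.1.2 ^+ 2).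
Definition cyl_z x : R := x.2.
Definition e_r x : R3 R := vec (x.1.1 / cyl_r x) (x.1.2 / cyl_r x) 0.
Definition e_theta x : R3 R := vec (- x.1.2 / cyl_r x) (x.1.1 / cyl_r x) 0.
Definition e_z : R3 R := vec 0 0 1.

End Space.

(* [CkOn n T f]: f is of class C^n on R^3 x [0, T), in the sense that all
   directional space-time derivatives of order <= n exist on R^3 x (0, T) and
   extend continuously to t = 0. *)
Fixpoint CkOn (R : realType) (n : nat) (T : R) (f : R3 R * R -> R) : Prop :=
  {within [set y : R3 R * R | 0 <= y.2 < T], continuous f} /\
  if n is m.+1 then
    forall v : R3 R * R, exists2 g : R3 R * R -> R, CkOn m T g &
      forall y, 0 < y.2 < T -> is_derive y v f (g y)
  else True.

Definition smooth_on (R : realType) (T : R) (f : R3 R -> R -> R) : Prop :=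
  forall n, CkOn n T (fun y => f y.1 y.2).

Section Fields.
Context {R : realType}.
Implicit Types (u : R3 R -> R -> R3 R) (p : R3 R -> R -> R).
Implicit Types (T t nu : R) (x : R3 R).

Definition ucomp u (i : 'I_3) x t : R := pcoord i (u x t).

Definition u_r u x t : R := dot (u x t) (e_r x).
Definition u_theta u x t : R := dot (u x t) (e_theta x).
Definition u_z u x t : R := dot (u x t) e_z.
Definition u_mer u x t : R3 R := u_r u x t *: e_r x + u_z u x t *: e_z.

Definition circulation u x t : R := cyl_r x * u_theta u x t.

Definition navier_stokes nu T u p : Prop :=
  [/\ forall i, smooth_on T (ucomp u i),
      smooth_on T p,
      forall x t, 0 < t < T -> \sum_(i < 3) partial i (ucomp u i ^~ t) x = 0 &
      forall x t, 0 < t < T -> forall i,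
        derive1 (ucomp u i x) t
        + \sum_(j < 3) ucomp u j x t * partial j (ucomp u i ^~ t) x
        + partial i (p ^~ t) x
        = nu * laplacian (ucomp u i ^~ t) x].

Definition axisymmetric T u : Prop :=
  forall t x y, 0 <= t < T -> 0 < cyl_r x -> cyl_r x = cyl_r y ->
    cyl_z x = cyl_z y ->
    [/\ u_r u x t = u_r u y t, u_theta u x t = u_theta u y t &
        u_z u x t = u_z u y t].

(* u belongs to L^oo(0, T; L^2) and grad u to L^2(0, T; L^2); the integrals
   are extended-real valued, so that finiteness is part of the condition. *)
Definition finite_energy T u : Prop :=
  exists E : R,
    (forall t, 0 <= t < T ->
      (\int[@leb3 R]_x (sqnorm (u x t))%:E <= E%:E)%E) /\
    (\int[@lebesgue_measure R]_(t in `[0%R, T[) \int[@leb3 R]_x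
      (\sum_(i < 3) \sum_(j < 3) (partial j (ucomp u i ^~ t) x) ^+ 2)%R%:E
      <= E%:E)%E.

(* Regular and singular times in the sense of Leray: t is regular when u is
   bounded on R^3 x I for some neighbourhood I of t in [0, T). T is the first
   singular time when it is singular and no time in (0, T) is. *)
Definition regular_time T u t : Prop :=
  exists2 d : R, 0 < d & exists M : R,
    forall x s, 0 <= s < T -> `|s - t| < d -> enorm (u x s) <= M.

Definition first_singular_time T u : Prop :=
  (forall t, 0 < t < T -> regular_time T u t) /\ ~ regular_time T u T.

Definition nontrivial_swirl T u : Prop :=
  exists x t, 0 <= t < T /\ u_theta u x t != 0.

Definition scaled_energy u (xs : R3 R) (rho t : R) : R :=
  rho^-1 * \int[@leb3 R]_(x in eball xs rho) sqnorm (u x t).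

Definition A_ u (xs : R3 R) (rho t : R) : R :=
  Num.sqrt (scaled_energy u xs rho t).

Definition U u x t : R := u_r u x t / cyl_r x.

Definition Y2 u x t : R := (Num.sqrt (cyl_r x))^-1 * u_theta u x t.

(* [\int] is the real-valued integral, 0 when the integral is infinite; this
   does not occur for 0 < t < T in the class of solutions considered. *)
Definition Z2 u t : R := \int[@leb3 R]_x (Y2 u x t ^+ 2).

Definition U2 u t : R :=
  if 0 < Z2 u t then (\int[@leb3 R]_x (U u x t * Y2 u x t ^+ 2)) / Z2 u t
  else 0.

(* Only meant for t0 <= t: the interval is empty otherwise. *)
Definition calA2 u (t0 t : R) : R :=
  \int[@lebesgue_measure R]_(s in `[t0, t]) (- U2 u s).

End Fields.

(* Main.v *)
(* With G = r u^theta one has |Y_2|^2 = G^2 / r^3. Multiply the equation of G by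
   2 G r^-3 q^3, where q is the positive part of 1 - |x|^2 / N^2. Axisymmetry forces
   G = O(r^2), so nothing is lost on the axis when integrating by parts; completing a square,
   the viscous term has a sign up to an error O(1/N), and
     d/dt int |Y_2|^2 q^3 <= -3 int U |Y_2|^2 q^3 + O(1/N) int |Y_2|^2 q.
   The pointwise bounds |Y_2|^2 <= (|u|^2 + |grad u|^2) / 2 and |U| |Y_2|^2 <= |u| |grad u|^2
   allow N to tend to infinity after division by the truncated energy, which Gronwall's
   lemma bounds from below as long as Z_2 > 0 at the final time. Hence
     log Z_2(t) - log Z_2(t0) <= 3 A_2(t0, t).

   Conversely, if the meridional part has at most a quarter of the energy A^2 R of the ball
   B_R, the swirl has at least three quarters of it. Since |G| <= Gs, the swirl energy at
   distance at least rho from the axis is at most 4 pi R Gs^2 (log(R / rho) + log(2) / 2),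
   which is A^2 R / 2 up to a bounded multiple of R for rho = R exp(- A^2 / (8 pi Gs^2)).
   At least A^2 R / 8 then lies within distance rho, where |Y_2|^2 >= |u^theta|^2 / rho, and
     Z_2 >= A^2 / 8 * exp(A^2 / (8 pi Gs^2)). *)
Require Import Defs.
From HB Require Import structures.
From mathcomp Require Import all_boot all_order all_algebra.
From mathcomp Require Import all_classical all_reals all_analysis.
From mathcomp Require Import measurable_realfun ess_sup_inf ring lra.

Set Implicit Arguments.
Unset Strict Implicit.
Unset Printing Implicit Defensive.

Import Order.TTheory GRing.Theory Num.Theory.
Import numFieldNormedType.Exports.

Local Open Scope classical_set_scope.
Local Open Scope ring_scope.

(** Neither finiteness nor positivity of [Z2] between [t0] and the final time is given. Both come
    from a crude form of the truncated balance: the viscous remainder - (3/2) nu |Y_2|^2 / r^2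
    absorbs - 3 U |Y_2|^2 at the price of a Gronwall constant depending on sup |u|. Started at an
    earlier time of finite dissipation, it bounds the energy from above; read backwards from the
    final time, from below. The exact form, which only drops the remainder, is then divided and
    integrated, so sup |u| does not enter the result. The error carries q and not q^3, so the
    truncated energy does not control it; it is bounded uniformly in N after integration in time.
    The pressure enters through the angular derivative of p. It is moved onto G, whose angular
    derivative vanishes, while r^-3 q^3 is radially symmetric about the axis. No tube around the
    axis is excised in the integrations by parts. Almost every line parallel to a coordinate axis
    misses it, and on such a line the flux is C^1 with compact support; integrability of the
    derivative, which is O(1/r), is then enough. *)

(** * Measurability of continuous functions *)

Lemma measurable_floor (R : realType) d (T : measurableType d) (f : T -> R) (z : int) :
  measurable_fun setT f -> measurable [set x | Num.floor (f x) = z].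
Proof.
move=> mf.
have -> : [set x | Num.floor (f x) = z] = f @^-1` `[z%:~R, (z + 1)%:~R[.
  apply/seteqP; split => x /=; rewrite in_itv/=.
    by move=> <-; rewrite floor_le_tmp floorD1_gt.
  by move=> /andP[? ?]; apply: floor_def; apply/andP.
by rewrite -[X in measurable X]setTI; exact: mf.
Qed.

(* Sampling the second variable on the grid (n+1)^-1 Z gives jointly measurable
   functions that converge pointwise. *)
Lemma caratheodory_measurable (R : realType) d (T : measurableType d)
    (f : T -> R -> R) :
  (forall y, measurable_fun setT (f ^~ y)) -> (forall x, continuous (f x)) ->
  measurable_fun setT (fun p : T * R => f p.1 p.2).
Proof.
move=> mf cf.
pose g (n : nat) (y : R) : R := (Num.floor (y * n.+1%:R))%:~R / n.+1%:R.
apply: (@measurable_fun_cvg _ _ _ _ (fun n (p : T * R) => f p.1 (g n p.2))).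
  move=> n _ Y mY; rewrite setTI.
  have -> : (fun p : T * R => f p.1 (g n p.2)) @^-1` Y =
      \bigcup_(z in [set: int]) ((f ^~ (z%:~R / n.+1%:R)) @^-1` Y `*`
        [set y : R | Num.floor (y * n.+1%:R) = z]).
    apply/seteqP; split => [[x y] /= xyY|[x y] [z _ [/= fY yz]]].
      by exists (Num.floor (y * n.+1%:R)).
    by rewrite /= /g yz.
  apply: countable_bigcupT_measurable => [|z].
    exact: countableP.
  apply: measurableX; first by rewrite -[X in measurable X]setTI; exact: mf.
  by apply: measurable_floor; apply: measurable_funM.
move=> -[x y] _ /=; apply: (cvg_comp (g ^~ y) (f x)); last exact: cf.
apply/cvgrPdist_lt => e e0; near=> n.
have n0 : 0 < n.+1%:R :> R by rewrite ltr0n.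
have -> : y - g n y = (y * n.+1%:R - (Num.floor (y * n.+1%:R))%:~R) / n.+1%:R.
  by rewrite /g mulrBl mulfK// gt_eqF.
rewrite normrM (ger0_norm (x := n.+1%:R^-1)) ?invr_ge0 ?ltW//.
rewrite ltr_pdivrMr// ger0_norm ?subr_ge0 ?floor_le_tmp//.
apply: (@le_lt_trans _ _ 1).
  by rewrite lerBlDl ltW// -[X in _ + X](mulr1z 1) -intrD floorD1_gt.
rewrite -ltr_pdivrMl// mulr1.
near: n.
exists (Num.bound e^-1) => // n /= bn.
have e1 : 0 <= e^-1 by rewrite invr_ge0 ltW.
rewrite (lt_le_trans (archi_boundP e1))// ler_nat.
exact: leqW.
Unshelve. all: end_near. Qed.

Lemma continuous_pairl (T U V : topologicalType) (f : T * U -> V) (y : U) :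
  continuous f -> continuous (fun a => f (a, y)).
Proof.
move=> cf a; apply: (cvg_comp (fun a => (a, y)) f); last exact: cf.
apply: (@cvg_pair _ _ _ _ (nbhs a) (nbhs y)); first exact: cvg_id.
exact: cvg_cst.
Qed.

Lemma continuous_pairr (T U V : topologicalType) (f : T * U -> V) (x : T) :
  continuous f -> continuous (fun b => f (x, b)).
Proof.
move=> cf b; apply: (cvg_comp (fun b => (x, b)) f); last exact: cf.
apply: (@cvg_pair _ _ _ _ (nbhs x) (nbhs b)); last exact: cvg_id.
exact: cvg_cst.
Qed.

Lemma continuous_measurable_prod (R : realType) (f : R * R -> R) :
  continuous f -> measurable_fun setT f.
Proof.
move=> cf.
have -> : f = (fun p => f (p.1, p.2)) by apply/funext; case.
apply: (@caratheodory_measurable R _ (measurableTypeR R) (fun a b => f (a, b))) => [y|x].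
- by apply: continuous_measurable_fun; exact: continuous_pairl.
- exact: continuous_pairr.
Qed.

Lemma continuous_measurable_R3 (R : realType) (f : R3 R -> R) :
  continuous f -> measurable_fun setT f.
Proof.
move=> cf.
have -> : f = (fun p => f (p.1, p.2)) by apply/funext; case.
apply: (@caratheodory_measurable R _ (measurableTypeR R * measurableTypeR R)%type (fun a b => f (a, b))) => [y|x].
- by apply: continuous_measurable_prod; exact: continuous_pairl.
- exact: continuous_pairr.
Qed.

Lemma measurable_inv (R : realType) d (T : measurableType d) (D : set T) (f : T -> R) :
  measurable_fun D f -> (forall x, 0 <= f x) -> measurable_fun D (fun x => (f x)^-1).
Proof.
move=> mf f0.
(* Both sides are 0 where [f] vanishes. *)
have -> : (fun x => (f x)^-1) = (fun x => f x `^ (-1)).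
  by apply/funext => x; rewrite powR_inv1.
exact: (measurableT_comp (measurable_powR _)).
Qed.

(** * The distance to the axis and its inverse *)

(** Its value on the axis is 0, so every integrand with a factor [rinv] vanishes there and pointwise
    estimates need a proof only off the axis. *)
Definition rinv (R : realType) (x : R3 R) : R := (cyl_r x)^-1.

Lemma coord1_continuous (R : realType) : continuous (fun x : R3 R => x.1.1).
Proof. by move=> x; apply: (@cvg_comp _ _ _ fst fst _ (nbhs x.1)); exact: cvg_fst. Qed.

Lemma coord2_continuous (R : realType) : continuous (fun x : R3 R => x.1.2).
Proof.
by move=> x; apply: (@cvg_comp _ _ _ fst snd _ (nbhs x.1)); [exact: cvg_fst|exact: cvg_snd].
Qed.

Lemma coord3_continuous (R : realType) : continuous (fun x : R3 R => x.2).
Proof. by move=> x; exact: cvg_snd. Qed.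

Lemma cyl_r_continuous (R : realType) : continuous (@cyl_r R).
Proof.
move=> x.
have c1 : x0.1.1 @[x0 --> x] --> x.1.1 by exact: (@coord1_continuous R).
have c2 : x0.1.2 @[x0 --> x] --> x.1.2 by exact: (@coord2_continuous R).
have h : (x0.1.1 * x0.1.1 + x0.1.2 * x0.1.2) @[x0 --> x] --> x.1.1 * x.1.1 + x.1.2 * x.1.2.
  by apply: cvgD; apply: cvgM.
exact: (cvg_comp _ _ h (@sqrt_continuous R _)).
Qed.

Lemma measurable_rinv (R : realType) : measurable_fun setT (@rinv R).
Proof.
apply: measurable_inv => [|x]; last exact: sqrtr_ge0.
exact: continuous_measurable_R3 (@cyl_r_continuous R).
Qed.

Lemma cyl_rE (R : realType) (x : R3 R) : cyl_r x ^+ 2 = x.1.1 ^+ 2 + x.1.2 ^+ 2.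
Proof. by rewrite sqr_sqrtr// addr_ge0// sqr_ge0. Qed.

Lemma cyl_r_ge0 (R : realType) (x : R3 R) : 0 <= cyl_r x.
Proof. exact: sqrtr_ge0. Qed.

Lemma rinv_ge0 (R : realType) (x : R3 R) : 0 <= rinv x.
Proof. by rewrite invr_ge0 cyl_r_ge0. Qed.

Lemma rinvE (R : realType) (x : R3 R) : 0 < cyl_r x ->
  rinv x ^+ 2 * (x.1.1 ^+ 2 + x.1.2 ^+ 2) = 1.
Proof. by move=> r0; rewrite -cyl_rE exprVn mulVf// expf_neq0// gt_eqF. Qed.

Lemma cyl_r_eq0 (R : realType) (x : R3 R) : (cyl_r x == 0) = (x.1.1 == 0) && (x.1.2 == 0).
Proof.
by rewrite -(sqrf_eq0 (cyl_r x)) cyl_rE paddr_eq0 ?sqr_ge0// !sqrf_eq0.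
Qed.

Lemma cyl_r_gt0 (R : realType) (x : R3 R) : (0 < cyl_r x) = (x.1.1 != 0) || (x.1.2 != 0).
Proof. by rewrite lt_neqAle cyl_r_ge0 andbT eq_sym cyl_r_eq0 negb_and. Qed.

Lemma cyl_r_cases (R : realType) (x : R3 R) : cyl_r x = 0 \/ 0 < cyl_r x.
Proof. by rewrite lt_neqAle cyl_r_ge0 andbT eq_sym; have [|] := eqVneq (cyl_r x) 0; [left|right]. Qed.

Lemma rinv_axis (R : realType) (x : R3 R) : cyl_r x = 0 -> rinv x = 0.
Proof. by rewrite /rinv => ->; rewrite invr0. Qed.

(* AM-GM: r^2 >= 2 |x1| |x2| >= |x1| |x2| *)
Lemma rinv_le (R : realType) (x : R3 R) :
  x.1.1 != 0 -> x.1.2 != 0 ->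
  rinv x <= (Num.sqrt `|x.1.1|)^-1 * (Num.sqrt `|x.1.2|)^-1.
Proof.
move=> a0 b0; rewrite -invfM lef_pV2 ?posrE.
- rewrite -sqrtrM// /cyl_r ler_sqrt ?addr_ge0 ?sqr_ge0// -normrM.
  rewrite -(real_normK (num_real x.1.1)) -(real_normK (num_real x.1.2)) normrM.
  have := sqr_ge0 (`|x.1.1| - `|x.1.2|).
  have := mulr_ge0 (normr_ge0 x.1.1) (normr_ge0 x.1.2).
  rewrite !expr2; lra.
- by rewrite -/(cyl_r x) cyl_r_gt0 a0.
- by rewrite mulr_gt0// sqrtr_gt0 normr_gt0.
Qed.

(** * Integrability of 1/r and integration by parts *)

Section oneD.
Context {R : realType}.
Local Notation mu := (@lebesgue_measure R).

Lemma continuous_itv_integrable (h : R -> R) (s t : R) :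
  (forall x, x \in `[s, t] -> {for x, continuous h}) -> mu.-integrable `[s, t] (EFin \o h).
Proof.
move=> ch; apply: continuous_compact_integrable; first exact: segment_compact.
by apply: continuous_in_subspaceT => x; rewrite inE; exact: ch.
Qed.

Lemma integral_antiderivative (h h' : R -> R) (s t : R) : s <= t ->
  (forall x, x \in `[s, t] -> is_derive x 1 h (h' x)) ->
  (forall x, x \in `[s, t] -> {for x, continuous h'}) ->
  (\int[mu]_(x in `[s, t]) (h' x)%:E = (h t - h s)%:E)%E.
Proof.
rewrite le_eqVlt => /predU1P[-> _ _|st dh ch]; first by rewrite set_itv1 integral_set1 subrr.
have sI : s \in `[s, t] by rewrite in_itv/= lexx ltW.
have tI : t \in `[s, t] by rewrite in_itv/= lexx ltW.
rewrite (@continuous_FTC2 _ h' h)//.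
- by apply: continuous_in_subspaceT => x; rewrite inE; exact: ch.
- split.
  + by move=> x /subset_itv_oo_cc xI; have [] := dh x xI.
  + apply: cvg_at_right_filter; apply: differentiable_continuous.
    by apply/derivable1_diffP; have [] := dh s sI.
  + apply: cvg_at_left_filter; apply: differentiable_continuous.
    by apply/derivable1_diffP; have [] := dh t tI.
- by move=> x /subset_itv_oo_cc xI; rewrite derive1E; have [_] := dh x xI.
Qed.

Lemma integral_invsqrt (e N : R) : 0 < e -> e < N ->
  (\int[mu]_(s in `[e, N]) ((Num.sqrt s)^-1)%:E <= (2 * Num.sqrt N)%:E)%E.
Proof.
move=> e0 eN.
pose F (s : R) := 2 * s `^ 2^-1.
have dF (s : R) : s \in `[e, N] -> is_derive s 1 F (Num.sqrt s)^-1.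
  rewrite in_itv/= => /andP[/(lt_le_trans e0) s0 _].
  have H := @is_derive1_powR R 2^-1 s s0.
  have -> : (Num.sqrt s)^-1 = 2 *: (2^-1 * s `^ (2^-1 - 1)) :> R.
    rewrite /GRing.scale/= mulrA divff// mul1r.
    have -> : 2^-1 - 1 = - (2^-1) :> R by lra.
    by rewrite powRN powR12_sqrt// ltW.
  exact: is_deriveZ.
have cF (s : R) : s \in `[e, N] -> {for s, continuous (fun s => (Num.sqrt s)^-1)}.
  rewrite in_itv/= => /andP[es _]; apply: cvgV; last exact: sqrt_continuous.
  by rewrite gt_eqF// sqrtr_gt0 (lt_le_trans e0).
rewrite (integral_antiderivative (ltW eN) dF cF) lee_fin /F powR12_sqrt ?(ltW (lt_trans e0 eN))//.
by rewrite gerBl mulr_ge0// powR_ge0.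
Qed.

(** One-variable factor of the majorant of 1/r on a box: by [rinv_le], 1/r is at most |x_1|^(-1/2)
    |x_2|^(-1/2), and each factor is integrable near 0. *)
Definition invsqrt_cut (N s : R) : R := (Num.sqrt `|s|)^-1 * (`|s| <= N)%R%:R.

Lemma measurable_invsqrt_cut N : measurable_fun setT (invsqrt_cut N).
Proof.
apply: measurable_funM.
- apply: measurable_inv => [|x]; last exact: sqrtr_ge0.
  exact: (measurableT_comp (continuous_measurable_fun (@sqrt_continuous R)) (@normr_measurable R setT)).
- have mb : measurable_fun setT (fun s : R => `|s| <= N)%R.
    by apply: measurable_fun_ler => //; exact: normr_measurable.
  exact: (measurableT_comp (f := fun b : bool => b%:R : R) _ mb).
Qed.

Lemma invsqrt_cut_ge0 N s : 0 <= invsqrt_cut N s.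
Proof. by rewrite mulr_ge0// invr_ge0 sqrtr_ge0. Qed.

Lemma integral_invsqrt_neg (e N : R) : 0 < e -> e < N ->
  (\int[mu]_(s in `[(- N)%R, (- e)%R]) (Num.sqrt `|s|)^-1%R%:E <= (2 * Num.sqrt N)%:E)%E.
Proof.
move=> e0 eN; rewrite (integration_by_substitution_oppr (ltW eN)); last first.
  apply: continuous_in_subspaceT => s; rewrite inE/= in_itv/= => /andP[_ es].
  apply: cvgV; last first.
    apply: (cvg_comp (fun s : R => `|s|) Num.sqrt); last exact: sqrt_continuous.
    exact: norm_continuous.
  by rewrite gt_eqF// sqrtr_gt0 normr_gt0 lt_eqF// (le_lt_trans es)// oppr_lt0.
apply: le_trans _ (integral_invsqrt e0 eN).
rewrite le_eqVlt; apply/orP; left; apply/eqP; apply: eq_integral => s; rewrite inE/= in_itv/= => /andP[es _].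
by rewrite normrN gtr0_norm// (lt_le_trans e0).
Qed.

Lemma integral_invsqrt_cut N : (\int[mu]_s (invsqrt_cut N s)%:E < +oo)%E.
Proof.
have [N0|N0] := lerP N 0.
  rewrite integral0_eq// => s _; rewrite /invsqrt_cut.
  have [->|s0] := eqVneq s 0; first by rewrite normr0 sqrtr0 invr0 mul0r.
  by rewrite leNgt (le_lt_trans N0) ?normr_gt0// mulr0.
pose f (s : R) : R := (Num.sqrt `|s|)^-1.
have f0 s : 0 <= f s by rewrite invr_ge0 sqrtr_ge0.
have mf : measurable_fun setT f.
  apply: measurable_inv => [|x]; last exact: sqrtr_ge0.
  exact: (measurableT_comp (continuous_measurable_fun (@sqrt_continuous R)) (@normr_measurable R setT)).
(* The punctured interval is exhausted by compact sets avoiding 0, on which the antiderivative of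
   the inverse square root is available; the value at 0 is 0 by the convention on inverses. *)
pose S (n : nat) : set R := `[- N, - n.+1%:R^-1] `|` `[n.+1%:R^-1, N].
have mS n : measurable (S n) by apply: measurableU; exact: measurable_itv.
have -> : (\int[mu]_s (invsqrt_cut N s)%:E = \int[mu]_(s in \bigcup_n S n) (f s)%:E)%E.
  rewrite [RHS]integral_mkcond; apply: eq_integral => s _; rewrite patchE.
  have [->|s0] := eqVneq s 0.
    by rewrite /f /invsqrt_cut normr0 sqrtr0 invr0 mul0r; case: ifP.
  case: (lerP `|s| N) => sN; last first.
    rewrite /invsqrt_cut leNgt sN mulr0 ifF//; apply/negbTE; rewrite notin_setE => -[n _].
    have n0 : 0 < n.+1%:R^-1 :> R by rewrite invr_gt0.
    rewrite /S/= !in_itv/= => -[] /andP[sa sb].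
      have s1 : s < 0 by apply: le_lt_trans sb _; rewrite oppr_lt0.
      by move: sN; rewrite ltr0_norm// ltNge lerNl sa.
    by move: sN; rewrite gtr0_norm ?(lt_le_trans n0 sa)// ltNge sb.
  rewrite /invsqrt_cut sN mulr1 ifT// inE.
  exists (Num.bound `|s|^-1) => //.
  have := @archi_boundP _ `|s|^-1; rewrite invr_ge0 normr_ge0 => /(_ isT) /ltW h.
  have {}h : (Num.bound `|s|^-1).+1%:R^-1 <= `|s|.
    by rewrite invf_ple ?posrE ?normr_gt0//; rewrite (le_trans h)// ler_nat.
  move: h sN; case: (ger0P s) => s1 h1 h2; rewrite /S/= !in_itv/=; [right|left].
    by rewrite h1 h2.
  by rewrite lerNl h2 lerNr h1.
have Sn : {homo S : n m / (n <= m)%N >-> (n <= m)%O}.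
  move=> n m nm; apply/subsetPset => s; rewrite /S/= !in_itv/=.
  have h : m.+1%:R^-1 <= n.+1%:R^-1 :> R by rewrite lef_pV2 ?posrE// ler_nat ltnS.
  by move=> [/andP[-> h2]|/andP[h1 ->]]; [left|right]; rewrite ?andbT/= ?(le_trans h)// (le_trans h2)// lerN2.
have mfS i : measurable_fun (S i) (EFin \o f).
  by apply/measurable_EFinP; exact: measurable_funS mf.
have f0S i (x : R) : S i x -> (0 <= (EFin \o f) x)%E by move=> _; rewrite lee_fin f0.
have /cvg_lim <- // := @ge0_nondecreasing_set_cvg_integral _ (measurableTypeR R) R S (EFin \o f) mu Sn mS mfS f0S.
apply: (@le_lt_trans _ _ (2 * Num.sqrt N + 2 * Num.sqrt N)%:E); last exact: ltry.
apply: lime_le.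
  apply: ereal_nondecreasing_is_cvgn => n m nm; apply: ge0_subset_integral => //.
  - exact: mS.
  - exact: mS.
  - exact: mfS.
  - by move=> x _; rewrite /= lee_fin f0.
  - by apply/subsetPset; exact: Sn.
near=> n.
have nN : n.+1%:R^-1 < N.
  near: n.
  exists (Num.bound N^-1) => // n /= bn.
  rewrite invf_plt ?posrE//.
  have := @archi_boundP _ N^-1; rewrite invr_ge0 (ltW N0) => /(_ isT) h.
  by rewrite (lt_le_trans h)// ler_nat leqW.
have n0 : 0 < n.+1%:R^-1 :> R by rewrite invr_gt0.
rewrite ge0_integral_setU//=; first last.
- apply/disj_setPS => s; rewrite /= !in_itv/= => -[/andP[_ h1] /andP[h2 _]].
  by move: (le_trans h2 h1); rewrite leNgt (lt_trans _ n0)// oppr_lt0.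
- by move=> x _; rewrite lee_fin f0.
- exact: mfS.
rewrite EFinD; apply: leeD; first exact: integral_invsqrt_neg.
apply: le_trans _ (integral_invsqrt n0 nN).
rewrite le_eqVlt; apply/orP; left; apply/eqP; apply: eq_integral => s; rewrite inE/= in_itv/= => /andP[es _].
by rewrite /f gtr0_norm// (lt_le_trans n0).
Unshelve. all: end_near. Qed.

Lemma integral_derive_compact (phi psi : R -> R) (N : R) : 0 < N ->
  (forall s : R, is_derive s 1 phi (psi s)) -> continuous psi ->
  (forall s, N <= `|s| -> phi s = 0) -> (\int[mu]_s (psi s)%:E = 0)%E.
Proof.
move=> N0 dphi cpsi phi0.
have psi0 (s : R) : N < `|s| -> psi s = 0.
  move=> Ns.
  have h : \forall y \near s, phi y = cst 0 y.
    near=> y; apply: phi0; apply: ltW.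
    near: y.
    have : continuous (fun y : R => `|y|) by move=> y; exact: norm_continuous.
    by move=> /(_ s) /cvgr_gt; exact.
  have [_ <-] := dphi s.
  by rewrite (near_eq_derive _ h) derive_cst.
have NN : - N < N by rewrite gtrN.
transitivity (\int[mu]_(s in `[(- N)%R, N]) (psi s)%:E)%E.
  rewrite [RHS]integral_mkcond; apply: eq_integral => s _.
  rewrite patchE; case: ifPn => //; rewrite notin_setE/= in_itv/= -ler_norml => /negP.
  by rewrite -ltNge => /psi0 ->.
rewrite (integral_antiderivative (ltW NN) (fun s _ => dphi s) (fun s _ => cpsi s)).
by rewrite (phi0 N) ?ger0_norm ?(ltW N0)// (phi0 (- N)) ?normrN ?ger0_norm ?(ltW N0)// subrr.
Unshelve. all: end_near. Qed.

End oneD.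

Section leb2.
Context {R : realType}.
Local Notation mu := (@lebesgue_measure R).
Local Notation MR := (measurableTypeR R).
(* The product measure carries no canonical sigma-finite structure; Fubini's theorem
   on R^3 needs one on the first factor. *)
Definition leb2 : set (MR * MR)%type -> \bar R := (mu \x mu)%E.
HB.instance Definition _ := Measure.on leb2.

Lemma leb2_sigma_finite : sigma_finite setT leb2.
Proof.
exists (fun n => `[- n%:R, n%:R]%classic `*` `[- n%:R, n%:R]%classic).
  apply/esym/seteqP; split => // -[x y] _.
  exists (maxn (Num.bound `|x|) (Num.bound `|y|)) => //.
  have hx := archi_boundP (normr_ge0 x); have hy := archi_boundP (normr_ge0 y).
  split => /=; rewrite in_itv/= -ler_norml ltW//.
    by rewrite (lt_le_trans hx)// ler_nat leq_maxl.
  by rewrite (lt_le_trans hy)// ler_nat leq_maxr.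
move=> n; split; first by apply: measurableX; exact: measurable_itv.
rewrite /leb2 product_measure1E//= lebesgue_measure_itv/=.
by case: ifP => _; rewrite ?mule0 ?ltry// -EFinB -EFinM ltry.
Qed.
HB.instance Definition _ := Measure_isSigmaFinite.Build _ _ _ leb2 leb2_sigma_finite.

Lemma leb3E (H : R3 R -> \bar R) : (\int[@leb3 R]_x H x = \int[leb2 \x mu]_x H x)%E.
Proof. exact: eq_measure_integral. Qed.

Lemma leb2E (H : R*R -> \bar R) : (\int[leb2]_x H x = \int[mu \x mu]_x H x)%E.
Proof. exact: eq_measure_integral. Qed.

Lemma leb3_tonelli1 (H : R3 R -> \bar R) : measurable_fun setT H -> (forall x, 0 <= H x)%E ->
  (\int[@leb3 R]_x H x = \int[leb2]_ab \int[mu]_c H (ab, c))%E.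
Proof.
move=> mH H0; rewrite leb3E; exact: (@fubini_tonelli1 _ _ _ _ R leb2 mu H mH H0).
Qed.

Lemma leb3_integrable (H : R3 R -> \bar R) : (@leb3 R).-integrable setT H ->
  (leb2 \x mu)%E.-integrable setT H.
Proof. by move=> /integrableP[mH iH]; apply/integrableP. Qed.

End leb2.

Section threeD.
Context {R : realType}.
Local Notation mu := (@lebesgue_measure R).
Local Notation leb3 := (@leb3 R).

#[global] Instance leb3_ae_filter : Filter (almost_everywhere leb3).
Proof. exact: (ae_filter_ringOfSetsType [the measure _ _ of leb3]). Qed.

Lemma coord1_ae : {ae leb3, forall x : R3 R, x.1.1 != 0}.
Proof.
exists (([set (0 : R)] `*` setT) `*` setT); split.
- by apply: measurableX => //; apply: measurableX.
- rewrite /Defs.leb3 product_measure1E//; last exact: measurableX.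
  have h : (mu \x mu)%E ([set (0 : R)] `*` [set: R]) = 0%E.
    by rewrite product_measure1E//= lebesgue_measure_set1 mul0e.
  by move: h => /= ->; rewrite mul0e.
- by move=> -[[a b] c] /= /negP; rewrite negbK => /eqP ->.
Qed.

Lemma coord2_ae : {ae leb3, forall x : R3 R, x.1.2 != 0}.
Proof.
exists ((setT `*` [set (0 : R)]) `*` setT); split.
- by apply: measurableX => //; apply: measurableX.
- rewrite /Defs.leb3 product_measure1E//; last exact: measurableX.
  have h : (mu \x mu)%E ([set: R] `*` [set (0 : R)]) = 0%E.
    by rewrite product_measure1E//= lebesgue_measure_set1 mule0.
  by move: h => /= ->; rewrite mul0e.
- by move=> -[[a b] c] /= /negP; rewrite negbK => /eqP ->.
Qed.

Definition inbox (N : R) (x : R3 R) : bool :=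
  [&& `|x.1.1| <= N, `|x.1.2| <= N & `|x.2| <= N].

Definition slab (z e s : R) : R := (`|s - z| <= e)%R%:R.

Lemma slab0 N s : slab 0 N s = (`|s| <= N)%R%:R.
Proof. by rewrite /slab subr0. Qed.

Lemma integral_slab (z e : R) : (\int[mu]_s (slab z e s)%:E = (2 * Num.max 0 e)%:E)%E.
Proof.
have -> : (\int[mu]_s (slab z e s)%:E = \int[mu]_(s in `[(z - e)%R, (z + e)%R]) 1)%E.
  rewrite [RHS]integral_mkcond; apply: eq_integral => s _; rewrite patchE /slab ler_distl.
  by case: ifPn; [rewrite inE/= in_itv/= => ->|rewrite notin_setE/= in_itv/= => /negP/negbTE ->].
rewrite integral_cst//= mul1e lebesgue_measure_itv/= lte_fin.
have -> : (z - e < z + e) = (0 < e) by apply/idP/idP => h; lra.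
by case: ltP => e0; rewrite ?mulr0// -EFinB; congr EFin; lra.
Qed.

Lemma measurable_slab z e : measurable_fun setT (slab z e).
Proof.
apply: (measurableT_comp (f := fun b : bool => b%:R : R)) => //.
apply: measurable_fun_ler => //.
apply: measurableT_comp; first exact: normr_measurable.
exact: measurable_funB.
Qed.

Lemma integral_slab_prod (w : R * R -> R) (z e : R) : measurable_fun setT w ->
  (forall s, 0 <= w s) ->
  (\int[leb3]_x (w x.1 * slab z e x.2)%:E
    = \int[@leb2 R]_s (w s)%:E * (2 * Num.max 0 e)%:E)%E.
Proof.
move=> mw w0.
rewrite (@leb3_tonelli1 R (fun x => (w x.1 * slab z e x.2)%:E)); last 2 first.
- apply/measurable_EFinP; apply: measurable_funM; first exact: (measurableT_comp mw measurable_fst).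
  exact: (measurableT_comp (measurable_slab z e) measurable_snd).
- by move=> x; rewrite lee_fin mulr_ge0.
under eq_integral => s _.
  rewrite /=; under eq_integral do rewrite EFinM.
  rewrite ge0_integralZl_EFin//; last 2 first.
  + by move=> x _; rewrite lee_fin.
  + by apply/measurable_EFinP; exact: measurable_slab.
  rewrite integral_slab; over.
have k0 : (0 <= (2 * Num.max 0 e)%:E)%E by rewrite lee_fin mulr_ge0// le_max lexx.
by rewrite ge0_integralZr//; [exact/measurable_EFinP|move=> s _; rewrite lee_fin].
Qed.

(** A product of functions of one coordinate each, so that its integral factors by Tonelli without
    polar coordinates. *)
Definition box_bound (N : R) (x : R3 R) : R :=
  invsqrt_cut N x.1.1 * invsqrt_cut N x.1.2 * slab 0 N x.2.

Lemma measurable_box_bound N : measurable_fun setT (box_bound N).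
Proof.
have mg := measurable_invsqrt_cut N.
apply: measurable_funM; first apply: measurable_funM.
- exact: (measurableT_comp mg (measurableT_comp measurable_fst measurable_fst)).
- exact: (measurableT_comp mg (measurableT_comp measurable_snd measurable_fst)).
- exact: (measurableT_comp (measurable_slab 0 N) measurable_snd).
Qed.

Lemma integral_box_bound (N : R) : (\int[leb3]_x (box_bound N x)%:E < +oo)%E.
Proof.
have mg := measurable_invsqrt_cut N; have g0 := invsqrt_cut_ge0 N.
pose p (x : R * R) := invsqrt_cut N x.1 * invsqrt_cut N x.2.
have mp : measurable_fun setT p.
  apply: measurable_funM; first exact: (measurableT_comp mg measurable_fst).
  exact: (measurableT_comp mg measurable_snd).
have p0 x : 0 <= p x by rewrite mulr_ge0.
have ip0 : (0 <= \int[@leb2 R]_x (p x)%:E)%E by apply: integral_ge0 => *; rewrite lee_fin.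
have ip : (\int[@leb2 R]_x (p x)%:E < +oo)%E.
  rewrite leb2E fubini_tonelli1/=; last 2 first.
  - exact/measurable_EFinP.
  - by move=> x; rewrite lee_fin.
  have -> : (\int[mu]_x fubini_F mu (fun x => (p x)%:E) x =
      \int[mu]_x ((invsqrt_cut N x)%:E * \int[mu]_y (invsqrt_cut N y)%:E))%E.
    apply: eq_integral => a _; rewrite /fubini_F /p/=.
    under eq_integral do rewrite EFinM.
    by rewrite ge0_integralZl_EFin// => *; rewrite ?lee_fin//; exact/measurable_EFinP.
  have fin := integral_invsqrt_cut N.
  have i0 : (0 <= \int[mu]_y (invsqrt_cut N y)%:E)%E by apply: integral_ge0 => *; rewrite lee_fin.
  rewrite ge0_integralZr//; [|exact/measurable_EFinP|by move=> x _; rewrite lee_fin].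
  by rewrite lte_mul_pinfty// ge0_fin_numE.
by rewrite (integral_slab_prod 0 N mp p0) lte_mul_pinfty ?ltry// ge0_fin_numE.
Qed.

Lemma integrable_bounded_rinv (f : R3 R -> R) (C N : R) :
  measurable_fun setT f -> (forall x, `|f x| <= C * rinv x) ->
  (forall x, ~~ inbox N x -> f x = 0) ->
  leb3.-integrable setT (EFin \o f).
Proof.
move=> mf fC f0; apply/integrableP; split; first exact/measurable_EFinP.
have mG := measurable_box_bound N.
have G0 x : 0 <= box_bound N x by rewrite !mulr_ge0// invsqrt_cut_ge0.
apply: (@le_lt_trans _ _ (\int[leb3]_x (`|C| * box_bound N x)%:E)%E); last first.
  under eq_integral do rewrite EFinM.
  rewrite ge0_integralZl_EFin//; [|by move=> x _; rewrite lee_fin|exact/measurable_EFinP].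
  by rewrite lte_mul_pinfty//; exact: integral_box_bound.
apply: ae_ge0_le_integral => //.
- by apply/measurable_EFinP; exact: measurableT_comp.
- by move=> x _; rewrite lee_fin mulr_ge0.
- by apply/measurable_EFinP; exact: measurable_funM.
(* On the planes x_1 = 0 and x_2 = 0 the majorant is 0 by the convention on inverses while [rinv]
   need not be, so the comparison holds only almost everywhere. *)
- apply: filterS2 coord1_ae coord2_ae => x a0 b0 _; rewrite /= lee_fin.
  have [xN|xN] := boolP (inbox N x); last by rewrite f0// normr0 mulr_ge0.
  apply: le_trans (fC x) _; apply: (@le_trans _ _ (`|C| * rinv x)).
    by rewrite ler_wpM2r ?rinv_ge0 ?ler_norm.
  rewrite ler_wpM2l// /box_bound slab0 /invsqrt_cut; move/and3P: xN => [-> -> ->]; rewrite !mulr1.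
  exact: rinv_le.
Qed.

End threeD.

Section ibp.
Context {R : realType}.
Local Notation mu := (@lebesgue_measure R).
Local Notation leb3 := (@leb3 R).
Implicit Types (F g : R3 R -> R).

(** A directional derivative sees only the values along one line. Two functions, possibly on
    different spaces, that agree along corresponding lines have the same one; this moves derivatives
    between R^3, space-time and the real line. *)
Lemma eq_growth_is_derive (V W : normedModType R) (f : V -> R) (h : W -> R) x v y w l :
  (forall e : R, f (e *: v + x) = h (e *: w + y)) ->
  is_derive x v f l -> is_derive y w h l.
Proof.
move=> fh [df <-].
have f0 : f x = h y by have := fh 0; rewrite !scale0r !add0r.
have E : (fun e : R => e^-1 *: (f (e *: v + x) - f x)) =
  (fun e : R => e^-1 *: (h (e *: w + y) - h y)) by apply/funext => e; rewrite fh f0.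
split; first by move: df; rewrite /derivable /= E.
by rewrite /derive /= E.
Qed.

Lemma is_derive_line1 F a b c l :
  is_derive ((a, b), c) (vec 1 0 0) F l -> is_derive a 1 (fun s : R => F ((s, b), c)) l.
Proof.
apply: eq_growth_is_derive => e; congr F.
transitivity (((e *: 1 + a, e *: 0 + b), e *: 0 + c) : R3 R); first by [].
by rewrite !scaler0 !add0r.
Qed.

Lemma is_derive_line2 F a b c l :
  is_derive ((a, b), c) (vec 0 1 0) F l -> is_derive b 1 (fun s : R => F ((a, s), c)) l.
Proof.
apply: eq_growth_is_derive => e; congr F.
transitivity (((e *: 0 + a, e *: 1 + b), e *: 0 + c) : R3 R); first by [].
by rewrite !scaler0 !add0r.
Qed.

Lemma is_derive_line3 F a b c l :
  is_derive ((a, b), c) (vec 0 0 1) F l -> is_derive c 1 (fun s : R => F ((a, b), s)) l.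
Proof.
apply: eq_growth_is_derive => e; congr F.
transitivity (((e *: 0 + a, e *: 0 + b), e *: 1 + c) : R3 R); first by [].
by rewrite !scaler0 !add0r.
Qed.

#[global] Instance lebesgue_ae_filter : Filter (almost_everywhere mu).
Proof. exact: (ae_filter_ringOfSetsType [the measure _ _ of mu]). Qed.

#[global] Instance leb2_ae_filter : Filter (almost_everywhere (@leb2 R)).
Proof. exact: (ae_filter_ringOfSetsType [the measure _ _ of @leb2 R]). Qed.

Lemma neq0_ae : {ae mu, forall s : R, s != 0}.
Proof.
exists [set 0]; split => //; first exact: lebesgue_measure_set1.
by move=> s /= /negP; rewrite negbK => /eqP ->.
Qed.

Lemma ae_integral0 d (T : measurableType d) (m : {measure set T -> \bar R}) (f : T -> \bar R) :
  measurable_fun setT f -> {ae m, forall x, f x = 0%E} -> (\int[m]_x f x = 0)%E.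
Proof.
move=> mf f0; transitivity (\int[m]_x (cst 0 x))%E; last exact: integral0.
by apply: ae_eq_integral => //; apply: filterS f0 => x ->.
Qed.

Lemma continuous_line1 b c : continuous (fun a : R => ((a, b), c) : R3 R).
Proof.
move=> a; apply: (@cvg_pair _ _ _ _ (nbhs (a, b)) (nbhs c)); last exact: cvg_cst.
by apply: (@cvg_pair _ _ _ _ (nbhs a) (nbhs b)); [exact: cvg_id|exact: cvg_cst].
Qed.

Lemma continuous_line2 a c : continuous (fun b : R => ((a, b), c) : R3 R).
Proof.
move=> b; apply: (@cvg_pair _ _ _ _ (nbhs (a, b)) (nbhs c)); last exact: cvg_cst.
by apply: (@cvg_pair _ _ _ _ (nbhs a) (nbhs b)); [exact: cvg_cst|exact: cvg_id].
Qed.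

Lemma continuous_line3 a b : continuous (fun c : R => ((a, b), c) : R3 R).
Proof.
move=> c; apply: (@cvg_pair _ _ _ _ (nbhs (a, b)) (nbhs c)); first exact: cvg_cst.
exact: cvg_id.
Qed.

(** A line in the first direction with b != 0 misses the symmetry axis, and the remaining lines are
    negligible, so nothing has to be known about the lines through the singularity. *)
Lemma integral_lines1 g : leb3.-integrable setT (EFin \o g) ->
  (forall b c, b != 0 -> (\int[mu]_a (g ((a, b), c))%:E = 0)%E) ->
  (\int[leb3]_x (g x)%:E = 0)%E.
Proof.
move=> /leb3_integrable ig g0; rewrite leb3E -(@integral21_prod_meas1 _ _ _ _ R leb2 mu (EFin \o g))//.
apply: ae_integral0; first exact: (@measurable_fubini_G _ _ _ _ R leb2 mu _ ig).
have := @ae_integrable2 _ _ _ _ R leb2 mu (EFin \o g) ig.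
apply: filterS => c igc; rewrite /fubini_G.
rewrite leb2E -(@integral21_prod_meas1 _ _ _ _ R mu mu (fun ab => (g (ab, c))%:E))//.
apply: ae_integral0; first exact: (@measurable_fubini_G _ _ _ _ R mu mu _ igc).
by apply: filterS neq0_ae => b b0; exact: g0.
Qed.

Lemma integral_lines2 g : leb3.-integrable setT (EFin \o g) ->
  (forall a c, a != 0 -> (\int[mu]_b (g ((a, b), c))%:E = 0)%E) ->
  (\int[leb3]_x (g x)%:E = 0)%E.
Proof.
move=> /leb3_integrable ig g0; rewrite leb3E -(@integral21_prod_meas1 _ _ _ _ R leb2 mu (EFin \o g))//.
apply: ae_integral0; first exact: (@measurable_fubini_G _ _ _ _ R leb2 mu _ ig).
have := @ae_integrable2 _ _ _ _ R leb2 mu (EFin \o g) ig.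
apply: filterS => c igc; rewrite /fubini_G.
rewrite leb2E -(@integral12_prod_meas1 _ _ _ _ R mu mu (fun ab => (g (ab, c))%:E))//.
apply: ae_integral0; first exact: (@measurable_fubini_F _ _ _ _ R mu mu _ igc).
by apply: filterS neq0_ae => b b0; exact: g0.
Qed.

Lemma fst_ae : {ae (@leb2 R), forall x : R * R, x.1 != 0}.
Proof.
exists ([set (0 : R)] `*` setT); split.
- exact: measurableX.
- by rewrite /leb2 product_measure1E//= lebesgue_measure_set1 mul0e.
- by move=> -[a b] /= /negP; rewrite negbK => /eqP ->.
Qed.

Lemma integral_lines3 g : leb3.-integrable setT (EFin \o g) ->
  (forall a b, a != 0 -> (\int[mu]_c (g ((a, b), c))%:E = 0)%E) ->
  (\int[leb3]_x (g x)%:E = 0)%E.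
Proof.
move=> /leb3_integrable ig g0; rewrite leb3E -(@integral12_prod_meas1 _ _ _ _ R leb2 mu (EFin \o g))//.
apply: ae_integral0; first exact: (@measurable_fubini_F _ _ _ _ R leb2 mu _ ig).
by apply: filterS fst_ae => -[a b] a0; exact: g0.
Qed.

Variables (F g : R3 R -> R) (N : R).
Hypothesis N0 : 0 < N.
Hypothesis ig : leb3.-integrable setT (EFin \o g).
Hypothesis F0 : forall x, ~~ inbox N x -> F x = 0.
Hypothesis cg : forall x, 0 < cyl_r x -> {for x, continuous g}.

Lemma notinbox x : (N < `|x.1.1|) || (N < `|x.1.2|) || (N < `|x.2|) -> ~~ inbox N x.
Proof. by rewrite /inbox !negb_and -!ltNge orbA. Qed.

(** [F] may be discontinuous on the axis: the axis has codimension two, so almost every line of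
    integration avoids it, and integrability of [g] is all that Fubini requires. *)
Lemma integral_partial1 :
  (forall x, 0 < cyl_r x -> is_derive x (vec 1 0 0) F (g x)) ->
  (\int[leb3]_x (g x)%:E = 0)%E.
Proof.
move=> dF; apply: integral_lines1 => // b c b0.
(* [F] vanishes outside the closed box, hence only where |s| exceeds [N]; [N + 1] provides the
   non-strict condition. *)
apply: (@integral_derive_compact _ (fun a => F ((a, b), c)) (fun a => g ((a, b), c)) (N + 1)).
- by rewrite addr_gt0.
- by move=> a; apply: is_derive_line1; apply: dF; rewrite cyl_r_gt0 b0 orbT.
- move=> a; apply: (cvg_comp (fun a => ((a, b), c)) g); first exact: continuous_line1.
  by apply: cg; rewrite cyl_r_gt0 b0 orbT.
- by move=> s Ns; apply/F0/notinbox; rewrite /= (lt_le_trans _ Ns)// ltrDl.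
Qed.

Lemma integral_partial2 :
  (forall x, 0 < cyl_r x -> is_derive x (vec 0 1 0) F (g x)) ->
  (\int[leb3]_x (g x)%:E = 0)%E.
Proof.
move=> dF; apply: integral_lines2 => // a c a0.
apply: (@integral_derive_compact _ (fun b => F ((a, b), c)) (fun b => g ((a, b), c)) (N + 1)).
- by rewrite addr_gt0.
- by move=> b; apply: is_derive_line2; apply: dF; rewrite cyl_r_gt0 a0.
- move=> b; apply: (cvg_comp (fun b => ((a, b), c)) g); first exact: continuous_line2.
  by apply: cg; rewrite cyl_r_gt0 a0.
- by move=> s Ns; apply/F0/notinbox; rewrite /= (lt_le_trans _ Ns) ?orbT// ltrDl.
Qed.

Lemma integral_partial3 :
  (forall x, 0 < cyl_r x -> is_derive x (vec 0 0 1) F (g x)) ->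
  (\int[leb3]_x (g x)%:E = 0)%E.
Proof.
move=> dF; apply: integral_lines3 => // a b a0.
apply: (@integral_derive_compact _ (fun c => F ((a, b), c)) (fun c => g ((a, b), c)) (N + 1)).
- by rewrite addr_gt0.
- by move=> c; apply: is_derive_line3; apply: dF; rewrite cyl_r_gt0 a0.
- move=> c; apply: (cvg_comp (fun c => ((a, b), c)) g); first exact: continuous_line3.
  by apply: cg; rewrite cyl_r_gt0 a0.
- by move=> s Ns; apply/F0/notinbox; rewrite /= (lt_le_trans _ Ns) ?orbT// ltrDl.
Qed.

End ibp.

(** * Fields controlled near the axis *)

Section smooth.
Context {R : realType}.
Implicit Types (f g : R3 R -> R -> R) (T : R).

Definition jcont T f := forall x t, 0 < t < T ->
  {for (x, t), continuous (fun y : R3 R * R => f y.1 y.2)}.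

Definition dpart (j : 'I_3) f : R3 R -> R -> R := fun x t => partial j (f ^~ t) x.
Definition dtime f : R3 R -> R -> R := fun x t => derive1 (f x) t.

(* The part of [CkOn] that concerns the open strip, along the coordinate axes only. *)
Fixpoint smooth_in (n : nat) T f : Prop :=
  jcont T f /\
  if n is m.+1 then
    (forall j, smooth_in m T (dpart j f) /\
      forall x t, 0 < t < T -> is_derive x (bvec j) (f ^~ t) (dpart j f x t)) /\
    (smooth_in m T (dtime f) /\
      forall x t, 0 < t < T -> is_derive t 1 (f x) (dtime f x t))
  else True.

Lemma near_strip T (t : R) : 0 < t < T -> \forall s \near t, 0 < s < T.
Proof.
move=> tT; have := @near_in_itvoo _ 0 T t; rewrite in_itv /= => /(_ tT).
by apply: filterS => s; rewrite in_itv.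
Qed.

Lemma jcont_ext T f g : (forall x t, 0 < t < T -> f x t = g x t) ->
  jcont T f -> jcont T g.
Proof.
move=> fg cf x t tT.
have E : \forall y \near ((x, t) : R3 R * R), f y.1 y.2 = g y.1 y.2.
  have : \forall y \near ((x, t) : R3 R * R), 0 < y.2 < T.
    by apply: (cvg_snd (near_strip tT)).
  by apply: filterS => -[a b] /= bT; exact: fg.
have h := cf x t tT.
have h' : f y.1 y.2 @[y --> ((x, t) : R3 R * R)] --> g x t by rewrite -fg.
by apply: cvg_trans h'; apply: near_eq_cvg.
Qed.

Lemma smooth_in_ext n T f g : (forall x t, 0 < t < T -> f x t = g x t) ->
  smooth_in n T f -> smooth_in n T g.
Proof.
elim: n f g => [|n IH] f g fg /= [cf h].
  by split=> //; exact: jcont_ext cf.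
have [h1 [h2 h3]] := h.
split; last split.
- exact: jcont_ext cf.
- move=> j; have [h4 h5] := h1 j.
  have E t : 0 < t < T -> f ^~ t = g ^~ t by move=> tT; apply/funext => x; exact: fg.
  split; first by apply: IH h4 => x t tT; rewrite /dpart E.
  by move=> x t tT; rewrite /dpart -E//; exact: h5.
- have E x t : 0 < t < T -> \forall s \near t, f x s = g x s.
    by move=> tT; apply: filterS (near_strip tT) => s; exact: fg.
  have D x t : 0 < t < T -> dtime f x t = dtime g x t.
    by move=> tT; rewrite /dtime !derive1E; apply: near_eq_derive; exact: E.
  split; first exact: IH h2.
  by move=> x t tT; rewrite -D//; apply: near_eq_is_derive (E _ _ tT) (h3 _ _ tT).
Qed.

Lemma within_jcont T (F : R3 R * R -> R) :
  {within [set y : R3 R * R | 0 <= y.2 < T], continuous F} ->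
  jcont T (fun x t => F (x, t)).
Proof.
move=> cF x t tT; have /andP[t0 t1] := tT.
have := (subspace_continuousP _ _).1 cF (x, t).
move=> /(_ _)/=; rewrite (ltW t0) t1 => /(_ isT) h.
have -> : (fun y : R3 R * R => F (y.1, y.2)) = F by apply/funext; case.
move=> B /h hB.
have hS : \forall y \near ((x, t) : R3 R * R), 0 < y.2 < T.
  by apply: (cvg_snd (near_strip tT)).
have hB' : \forall y \near ((x, t) : R3 R * R), 0 <= y.2 < T -> B (F y) by exact: hB.
change (\forall y \near ((x, t) : R3 R * R), B (F y)).
apply: filterS (filterI hB' hS) => y [By /andP[y0 yT]].
by apply: By; rewrite (ltW y0) yT.
Qed.

(** The derivatives in [CkOn] are existentially quantified. Uniqueness identifies them with [dpart]
    and [dtime], but only for 0 < t < T, hence the appeal to [smooth_in_ext]. *)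
Lemma CkOn_smooth_in n T (F : R3 R * R -> R) : CkOn n T F -> smooth_in n T (fun x t => F (x, t)).
Proof.
elim: n F => [|n IH] F /= [cF h]; first by split=> //; exact: within_jcont.
split; first exact: within_jcont.
split.
- move=> j; have [g Cg dg] := h (bvec j, 0).
  have d x t : 0 < t < T -> is_derive x (bvec j) (fun x => F (x, t)) (g (x, t)).
    move=> tT; apply: eq_growth_is_derive (dg (x, t) tT) => e; congr F.
    transitivity ((e *: bvec j + x, e *: 0 + t) : R3 R * R); first by [].
    by rewrite scaler0 add0r.
  have E x t : 0 < t < T -> g (x, t) = dpart j (fun x t => F (x, t)) x t.
    by move=> tT; have [_ <-] := d x t tT.
  split; first by apply: smooth_in_ext E _; exact: IH.
  by move=> x t tT; rewrite -E//; exact: d.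
- have [g Cg dg] := h (0, 1).
  have d x t : 0 < t < T -> is_derive t 1 (fun t => F (x, t)) (g (x, t)).
    move=> tT; apply: eq_growth_is_derive (dg (x, t) tT) => e; congr F.
    transitivity ((e *: 0 + x, e *: 1 + t) : R3 R * R); first by [].
    by rewrite scaler0 add0r.
  have E x t : 0 < t < T -> g (x, t) = dtime (fun x t => F (x, t)) x t.
    by move=> tT; rewrite /dtime derive1E; have [_ <-] := d x t tT.
  split; first by apply: smooth_in_ext E _; exact: IH.
  by move=> x t tT; rewrite -E//; exact: d.
Qed.

Lemma smooth_on_in n T f : smooth_on T f -> smooth_in n T f.
Proof. by move=> /(_ n)/CkOn_smooth_in. Qed.

Lemma smooth_in_jcont n T f : smooth_in n T f -> jcont T f.
Proof. by case: n => [|n] []. Qed.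

Section bounds.
Variables (T ta tb : R).
Hypotheses (ta0 : 0 < ta) (tbT : tb < T).

Lemma in_strip t : ta <= t <= tb -> 0 < t < T.
Proof. by move=> /andP[h1 h2]; rewrite (lt_le_trans ta0 h1) (le_lt_trans h2 tbT). Qed.

Lemma jcont_xcont f t : jcont T f -> ta <= t <= tb -> continuous (f ^~ t).
Proof.
move=> cf tJ x; have h := cf x t (in_strip tJ).
apply: (cvg_comp (fun x => (x, t)) (fun y : R3 R * R => f y.1 y.2)); last exact: h.
by apply: (@cvg_pair _ _ _ _ (nbhs x) (nbhs t)); [exact: cvg_id|exact: cvg_cst].
Qed.

Lemma jcont_tcont f x t : jcont T f -> ta <= t <= tb -> {for t, continuous (f x)}.
Proof.
move=> cf tJ; have h := cf x t (in_strip tJ).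
apply: (cvg_comp (fun t => (x, t)) (fun y : R3 R * R => f y.1 y.2)); last exact: h.
by apply: (@cvg_pair _ _ _ _ (nbhs x) (nbhs t)); [exact: cvg_cst|exact: cvg_id].
Qed.

Lemma jcont_bounded f N : jcont T f -> exists2 C : R, 0 <= C & forall x t, inbox N x -> ta <= t <= tb -> `|f x t| <= C.
Proof.
move=> cf.
pose K : set (R3 R * R) := ((`[- N, N] `*` `[- N, N]) `*` `[- N, N]) `*` `[ta, tb].
have cK : compact K by apply: compact_setX; [apply: compact_setX; [apply: compact_setX|]|]; exact: segment_compact.
have cF : {within K, continuous (fun y : R3 R * R => f y.1 y.2)}.
  apply: continuous_in_subspaceT => -[x t]; rewrite inE => -[_ /=]; rewrite in_itv/= => tJ.
  exact: cf (in_strip tJ).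
have [C [_ hC]] := compact_bounded (continuous_compact cF cK).
exists (`|C| + 1); first by rewrite addr_ge0.
move=> x t /and3P[x1 x2 x3] tJ; apply: (hC (`|C| + 1)).
  by rewrite (le_lt_trans (ler_norm C))// ltrDl.
exists (x, t) => //; split => /=; last by rewrite in_itv.
by split; [split|]; rewrite /= in_itv/= -ler_norml.
Qed.
End bounds.

End smooth.

Section classes.
Context {R : realType}.
Variables (T ta tb : R).
Hypotheses (ta0 : 0 < ta) (tbT : tb < T).
Implicit Types (f g : R3 R -> R -> R) (d e : int).

(* Uniformly in [t], [f] is O(r^d) near the axis, locally in [x]. *)
Definition bigO_axis d f := forall N : R, exists2 C : R, 0 <= C &
  forall x t, inbox N x -> 0 < cyl_r x -> ta <= t <= tb -> `|f x t| <= C * cyl_r x ^ d.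

(** Closed under sums and products, with orders adding up, so singular integrands are treated by
    arithmetic on exponents. Order -1 together with support in a box gives an integrable majorant
    uniform in time; continuity in [t] at every [x] then yields continuity of the integrals. *)
Record axis_class d f : Prop := AxisClass {
  axis_bigO : bigO_axis d f;
  axis_xcont : forall x t, 0 < cyl_r x -> ta <= t <= tb -> {for x, continuous (f ^~ t)};
  axis_tcont : forall x t, ta <= t <= tb -> {for t, continuous (f x)};
  axis_meas : forall t, ta <= t <= tb -> measurable_fun setT (f ^~ t) }.

Lemma cyl_r_inbox (N : R) (x : R3 R) : inbox N x -> cyl_r x <= `|N| *+ 2 + 1.
Proof.
move=> /and3P[h1 h2 _].
rewrite -(ler_pXn2r (ltn0Sn 1)) ?nnegrE ?cyl_r_ge0 ?addr_ge0 ?mulrn_wge0// cyl_rE.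
rewrite -(real_normK (num_real x.1.1)) -(real_normK (num_real x.1.2)).
have hN := ler_norm N.
have := lerXn2r 2 (normr_ge0 _) (normr_ge0 N) (le_trans h1 hN).
have := lerXn2r 2 (normr_ge0 _) (normr_ge0 N) (le_trans h2 hN).
have := normr_ge0 N.
rewrite !expr2 mulr2n; nra.
Qed.

(** Inside a box r is bounded, so surplus powers of r go into the constant. *)
Lemma axis_classW d e f : (e <= d)%R -> axis_class d f -> axis_class e f.
Proof.
move=> ed [hO hx ht hm]; split => // N; have [C C0 hC] := hO N.
have M0 : 0 <= `|N| *+ 2 + 1 by rewrite addr_ge0 ?mulrn_wge0.
exists (C * (`|N| *+ 2 + 1) ^ (d - e)); first by rewrite mulr_ge0 ?exprz_ge0.
move=> x t xN r0 tJ; apply: le_trans (hC x t xN r0 tJ) _.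
rewrite -mulrA ler_wpM2l//.
have -> : cyl_r x ^ d = cyl_r x ^ (d - e) * cyl_r x ^ e.
  by rewrite -expfzDr ?subrK// gt_eqF.
rewrite ler_wpM2r ?exprz_ge0 ?cyl_r_ge0//.
have : 0 <= d - e by rewrite subr_ge0.
case: (d - e) => // n _; rewrite -!exprnP lerXn2r ?nnegrE ?cyl_r_ge0//.
exact: cyl_r_inbox.
Qed.

Lemma axis_classD d f g : axis_class d f -> axis_class d g ->
  axis_class d (fun x t => f x t + g x t).
Proof.
move=> [fO fx ft fm] [gO gx gt gm]; split.
- move=> N; have [C C0 hC] := fO N; have [C' C'0 hC'] := gO N.
  exists (C + C'); first exact: addr_ge0.
  move=> x t xN r0 tJ; rewrite mulrDl; apply: le_trans (ler_normD _ _) _.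
  by apply: lerD; [exact: hC|exact: hC'].
- by move=> x t r0 tJ; apply: continuousD; [exact: fx|exact: gx].
- by move=> x t tJ; apply: continuousD; [exact: ft|exact: gt].
- by move=> t tJ; apply: measurable_funD; [exact: fm|exact: gm].
Qed.

Lemma axis_classM d e f g : axis_class d f -> axis_class e g ->
  axis_class (d + e) (fun x t => f x t * g x t).
Proof.
move=> [fO fx ft fm] [gO gx gt gm]; split.
- move=> N; have [C C0 hC] := fO N; have [C' C'0 hC'] := gO N.
  exists (C * C'); first exact: mulr_ge0.
  move=> x t xN r0 tJ; rewrite normrM expfzDr ?gt_eqF// mulrACA.
  by apply: ler_pM => //; [exact: hC|exact: hC'].
- by move=> x t r0 tJ; apply: continuousM; [exact: fx|exact: gx].
- by move=> x t tJ; apply: continuousM; [exact: ft|exact: gt].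
- by move=> t tJ; apply: measurable_funM; [exact: fm|exact: gm].
Qed.

Lemma axis_class_jcont f : jcont T f -> axis_class 0 f.
Proof.
move=> cf; split.
- move=> N; have [C C0 hC] := jcont_bounded ta0 tbT N cf; exists C => // x t xN r0 tJ.
  by rewrite expr0z mulr1; exact: hC.
- by move=> x t r0 tJ; exact: (jcont_xcont ta0 tbT).
- by move=> x t tJ; exact: (jcont_tcont ta0 tbT).
- by move=> t tJ; apply: continuous_measurable_R3; exact: (jcont_xcont ta0 tbT).
Qed.

Lemma axis_class_cst (c : R) : axis_class 0 (fun _ _ => c).
Proof.
split.
- by move=> N; exists `|c| => // x t _ _ _; rewrite expr0z mulr1.
- by move=> x t _ _; exact: cvg_cst.
- by move=> x t _; exact: cvg_cst.
- by move=> t _; exact: measurable_cst.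
Qed.

Lemma axis_class_steady d (f : R3 R -> R) : bigO_axis d (fun x _ => f x) ->
  (forall x, 0 < cyl_r x -> {for x, continuous f}) -> measurable_fun setT f ->
  axis_class d (fun x _ => f x).
Proof. by move=> fO fc fm; split => // *; [exact: fc|exact: cvg_cst]. Qed.

Lemma norm_coord1 (x : R3 R) : `|x.1.1| <= cyl_r x.
Proof.
rewrite -(ler_pXn2r (ltn0Sn 1)) ?nnegrE ?cyl_r_ge0// cyl_rE.
by rewrite (real_normK (num_real x.1.1)) lerDl sqr_ge0.
Qed.

Lemma norm_coord2 (x : R3 R) : `|x.1.2| <= cyl_r x.
Proof.
rewrite -(ler_pXn2r (ltn0Sn 1)) ?nnegrE ?cyl_r_ge0// cyl_rE.
by rewrite (real_normK (num_real x.1.2)) lerDr sqr_ge0.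
Qed.

Lemma axis_class_coord1 : axis_class 1 (fun x _ => x.1.1).
Proof.
apply: axis_class_steady.
- by move=> N; exists 1 => // x t _ _ _; rewrite mul1r expr1z norm_coord1.
- by move=> x _; exact: coord1_continuous.
- by apply: continuous_measurable_R3; exact: coord1_continuous.
Qed.

Lemma axis_class_coord2 : axis_class 1 (fun x _ => x.1.2).
Proof.
apply: axis_class_steady.
- by move=> N; exists 1 => // x t _ _ _; rewrite mul1r expr1z norm_coord2.
- by move=> x _; exact: coord2_continuous.
- by apply: continuous_measurable_R3; exact: coord2_continuous.
Qed.

Lemma axis_class_continuous (f : R3 R -> R) : continuous f -> axis_class 0 (fun x _ => f x).
Proof.
move=> cf; apply: axis_class_jcont => x t _.
apply: (cvg_comp fst f); last exact: cf.
exact: cvg_fst.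
Qed.

Lemma axis_class_coord3 : axis_class 0 (fun x _ => x.2).
Proof. by apply: axis_class_continuous; exact: coord3_continuous. Qed.

Lemma axis_class_rinv : axis_class (-1) (fun x _ => rinv x).
Proof.
apply: axis_class_steady; last exact: measurable_rinv.
- by move=> N; exists 1 => // x t _ r0 _; rewrite mul1r ger0_norm ?rinv_ge0.
- by move=> x r0; apply: cvgV; [rewrite gt_eqF|exact: cyl_r_continuous].
Qed.

Lemma axis_class_rinvX n : axis_class (- n%:Z) (fun x _ => rinv x ^+ n).
Proof.
elim: n => [|n IH]; first exact: axis_class_cst.
have -> : - n.+1%:Z = -1 + - n%:Z by rewrite -addn1 PoszD opprD addrC.
have -> : (fun (x : R3 R) (_ : R) => rinv x ^+ n.+1) = (fun x _ => rinv x * rinv x ^+ n).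
  by apply/funext => x; apply/funext => t; rewrite exprS.
exact: (axis_classM axis_class_rinv IH).
Qed.

(** Differentiation costs one order. Keeping a function together with its derivative lets the
    product rule compute derivative and order at once; the closed formulas are restored by
    [axis_reg_ext]. *)
Definition axis_reg (v : R3 R) d f f' := [/\ axis_class d f, axis_class (d - 1) f' &
  forall x t, 0 < cyl_r x -> ta <= t <= tb -> is_derive x v (f ^~ t) (f' x t)].

Lemma axis_regW v d e f f' : (e <= d)%R -> axis_reg v d f f' -> axis_reg v e f f'.
Proof.
by move=> ed [h1 h2 h3]; split => //; [exact: axis_classW h1|apply: axis_classW h2; rewrite lerB].
Qed.

Lemma axis_regD v d f f' g g' : axis_reg v d f f' -> axis_reg v d g g' ->
  axis_reg v d (fun x t => f x t + g x t) (fun x t => f' x t + g' x t).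
Proof.
move=> [f1 f2 f3] [g1 g2 g3]; split; [exact: axis_classD|exact: axis_classD|].
by move=> x t r0 tJ; apply: is_deriveD; [exact: f3|exact: g3].
Qed.

Lemma axis_regM v d e f f' g g' : axis_reg v d f f' -> axis_reg v e g g' ->
  axis_reg v (d + e) (fun x t => f x t * g x t)
    (fun x t => f x t * g' x t + g x t * f' x t).
Proof.
move=> [f1 f2 f3] [g1 g2 g3]; split; first exact: axis_classM.
  apply: axis_classD; first by rewrite -addrA; exact: axis_classM.
  by rewrite [d + e]addrC -addrA; exact: axis_classM.
by move=> x t r0 tJ; apply: is_deriveM; [exact: f3|exact: g3].
Qed.

Lemma axis_regC v (c : R) : axis_reg v 0 (fun _ _ => c) (fun _ _ => 0).
Proof.
split; [exact: axis_class_cst| |].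
  by apply: axis_classW (axis_class_cst 0).
by move=> x t _ _; exact: is_derive_cst.
Qed.

Lemma axis_reg_ext v d f f' g g' : (forall x t, f x t = g x t) ->
  (forall x t, f' x t = g' x t) -> axis_reg v d f f' -> axis_reg v d g g'.
Proof.
move=> fg fg'.
have -> : g = f by apply/funext => x; apply/funext => t; rewrite fg.
by have -> : g' = f' by apply/funext => x; apply/funext => t; rewrite fg'.
Qed.

End classes.

(** * Directional derivatives *)

Section calculus.
Context {R : realType}.

Lemma is_derive_ray (V : normedModType R) (f : V -> R) (x v : V) (s l : R) :
  is_derive (s *: v + x) v f l -> is_derive s 1 (fun h : R => f (h *: v + x)) l.
Proof.
apply: eq_growth_is_derive => e; congr f.
by rewrite addrA -scalerDl /GRing.scale/= mulr1.
Qed.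

Lemma is_derive_of_ray (V : normedModType R) (f : V -> R) (x v : V) (l : R) :
  is_derive (0 : R) 1 (fun h : R => f (h *: v + x)) l -> is_derive x v f l.
Proof.
apply: eq_growth_is_derive => e; congr f.
by rewrite addr0 /GRing.scale/= mulr1.
Qed.

Lemma is_derive_comp1 (V : normedModType R) (f : V -> R) (phi : R -> R) (x v : V) (l l' : R) :
  is_derive x v f l -> is_derive (f x) 1 phi l' ->
  is_derive x v (fun y => phi (f y)) (l * l').
Proof.
move=> df dphi; apply: is_derive_of_ray.
have h : is_derive (0 : R) 1 (fun h : R => f (h *: v + x)) l.
  by apply: is_derive_ray; rewrite scale0r add0r.
have := @is_derive1_comp R phi (fun h : R => f (h *: v + x)) 0 l' l.
rewrite mulrC; apply => //.
by rewrite scale0r add0r.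
Qed.

Lemma is_deriveZdir (V : normedModType R) (f : V -> R) (x v : V) (c l : R) :
  is_derive x v f l -> is_derive x (c *: v) f (c * l).
Proof.
move=> df; apply: is_derive_of_ray.
have h : is_derive (0 : R) 1 (fun h : R => f (h *: v + x)) l.
  by apply: is_derive_ray; rewrite scale0r add0r.
have h2 : is_derive (0 : R) 1 (fun s : R => c * s) c.
  have := @is_deriveZ _ _ _ (@id R) c 0 1 1 (is_derive_id _ _).
  by rewrite /GRing.scale/= mulr1.
have := @is_derive_comp1 R (fun s : R => c * s) (fun h : R => f (h *: v + x)) 0 1 c l h2.
rewrite mulr0 => /(_ h).
by under eq_fun do rewrite mulrC -scalerA.
Qed.

(** Directional derivatives are not additive in the direction in general. Here the increment along
    [w] starts from the moving point x + h v; the mean value theorem rewrites it with [g] at a point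
    tending to [x], and continuity of [g] concludes. *)
Lemma is_deriveDdir (f g : R3 R -> R) (x v w : R3 R) (l : R) :
  is_derive x v f l -> (forall y, is_derive y w f (g y)) -> {for x, continuous g} ->
  is_derive x (v + w) f (l + g x).
Proof.
move=> [dv <-] dw cg.
have H : h^-1 *: (f (h *: (v + w) + x) - f x) @[h --> 0^'] --> 'D_v f x + g x.
  have E : (fun h : R => h^-1 *: (f (h *: (v + w) + x) - f x)) =
     (fun h => h^-1 *: (f (h *: v + x) - f x) +
        h^-1 *: (f (h *: w + (h *: v + x)) - f (h *: v + x))).
    apply/funext => h; rewrite -scalerDr; congr (_ *: _).
    have -> : h *: (v + w) + x = h *: w + (h *: v + x).
      by rewrite scalerDr addrA [X in X + x = _]addrC.
    by rewrite [RHS]addrC subrKA.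
  rewrite E; apply: cvgD; first exact: dv.
  apply/cvgrPdist_lt => e e0.
  have /cvgrPdist_lt/(_ e e0)/nbhs_ballP[d /= d0 hd] := cg.
  pose M := `|v| + `|w| + 1.
  have M0 : 0 < M by rewrite ltr_wpDl// addr_ge0.
  near=> h.
  have h0 : h != 0 by near: h; exact: nbhs_dnbhs_neq.
  have hM : `|h| < d / M.
    near: h; apply: dnbhs0_lt; exact: divr_gt0.
  pose y := h *: v + x.
  pose phi s := f (s *: w + y).
  have dphi (s : R) : is_derive s 1 phi (g (s *: w + y)) by exact: is_derive_ray.
  (* The mean value theorem is stated on ordered segments, so the sign of [h] decides its
     orientation; only |xi| <= |h| is kept. *)
  have [xi xih phiE] : exists2 xi, `|xi| <= `|h| & phi h - phi 0 = g (xi *: w + y) * h.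
    have cphi : continuous phi.
      by move=> s; apply: differentiable_continuous; apply/derivable1_diffP; have [] := dphi s.
    have [h1|h1] := lerP 0 h.
      have [xi] := @MVT_segment R phi (fun s => g (s *: w + y)) 0 h h1
        (fun s _ => dphi s) (continuous_subspaceT cphi).
      rewrite in_itv/= => /andP[xi0 xih] ->; exists xi; last by rewrite subr0.
      by rewrite !ger0_norm.
    have [xi] := @MVT_segment R phi (fun s => g (s *: w + y)) h 0 (ltW h1)
        (fun s _ => dphi s) (continuous_subspaceT cphi).
    rewrite in_itv/= => /andP[xi0 xih] E'; exists xi.
      by rewrite !ler0_norm ?lerN2// ltW.
    by rewrite -opprB E' sub0r mulrN opprK.
  have -> : f (h *: w + (h *: v + x)) - f (h *: v + x) = g (xi *: w + y) * h.
    by rewrite -phiE /phi scale0r add0r.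
  rewrite /GRing.scale/= mulrC mulfK//.
  apply: hd; rewrite -ball_normE/=.
  have -> : x - (xi *: w + y) = - (xi *: w + h *: v) by rewrite /y addrA opprD addrCA subrr addr0.
  rewrite normrN; apply: le_lt_trans (ler_normD _ _) _.
  rewrite !normrZ; apply: (@le_lt_trans _ _ (`|h| * M)).
    by rewrite /M 2!mulrDr mulr1 addrC ler_wpDr// lerD2l ler_wpM2r.
  by rewrite -ltr_pdivlMr.
split; first by apply/cvg_ex; exists ('D_v f x + g x).
exact: cvg_lim.
Unshelve. all: end_near. Qed.

Lemma is_derive_sqrt (x : R) : 0 < x -> is_derive x 1 Num.sqrt ((2 * Num.sqrt x)^-1).
Proof.
move=> x0.
have H := @is_derive1_powR R 2^-1 x x0.
have E : 2^-1 * x `^ (2^-1 - 1) = (2 * Num.sqrt x)^-1.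
  have -> : 2^-1 - 1 = - (2^-1) :> R by lra.
  by rewrite powRN powR12_sqrt ?invfM// ltW.
rewrite E in H; apply: near_eq_is_derive H.
near=> y; rewrite powR12_sqrt// ltW//.
by near: y; exact: lt_nbhsr.
Unshelve. all: end_near. Qed.

Lemma is_derive_coord1 (x v : R3 R) : is_derive x v (fun y => y.1.1) v.1.1.
Proof. by apply: eq_growth_is_derive (is_derive_id (x.1.1 : R) v.1.1). Qed.

Lemma is_derive_coord2 (x v : R3 R) : is_derive x v (fun y => y.1.2) v.1.2.
Proof. by apply: eq_growth_is_derive (is_derive_id (x.1.2 : R) v.1.2). Qed.

Lemma is_derive_coord3 (x v : R3 R) : is_derive x v (fun y => y.2) v.2.
Proof. by apply: eq_growth_is_derive (is_derive_id (x.2 : R) v.2). Qed.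

Lemma is_derive_rinv (x v : R3 R) : 0 < cyl_r x ->
  is_derive x v (@rinv R) (- (x.1.1 * v.1.1 + x.1.2 * v.1.2) * rinv x ^+ 3).
Proof.
move=> r0.
have s0 : 0 < x.1.1 ^+ 2 + x.1.2 ^+ 2 by rewrite -cyl_rE exprn_gt0.
have d2 : is_derive x v (fun y : R3 R => y.1.1 ^+ 2 + y.1.2 ^+ 2)
    (2 * (x.1.1 * v.1.1 + x.1.2 * v.1.2)).
  have h : is_derive x v (fun y : R3 R => y.1.1 ^+ 2 + y.1.2 ^+ 2) _ :=
    is_deriveD (is_deriveM (is_derive_coord1 x v) (is_derive_coord1 x v))
    (is_deriveM (is_derive_coord2 x v) (is_derive_coord2 x v)).
  apply: is_derive_eq h _.
  by rewrite /GRing.scale/=; ring.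
have dr : is_derive x v (@cyl_r R) ((x.1.1 * v.1.1 + x.1.2 * v.1.2) / cyl_r x).
  apply: is_derive_eq (is_derive_comp1 d2 (is_derive_sqrt s0)) _.
  by rewrite -/(cyl_r x); field; rewrite gt_eqF.
have r1 : cyl_r x != 0 by rewrite gt_eqF.
have [dd de] := dr.
split; first exact: (derivableV r1 dd).
apply: etrans (deriveV r1 dd) _.
by rewrite de /GRing.scale/= /rinv; field.
Qed.

Lemma is_derive_pos2 (s : R) : is_derive s 1 (fun s : R => Num.max 0 s ^+ 2) (2 * Num.max 0 s).
Proof.
have [s0|s0|<-] := ltgtP 0 s.
- have d : is_derive s 1 (fun s : R => s ^+ 2) (2 * s).
    have h : is_derive s 1 (fun s : R => s ^+ 2) _ :=
      is_deriveM (is_derive_id s 1) (is_derive_id s 1).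
    by apply: is_derive_eq h _; rewrite /GRing.scale/=; ring.
  apply: near_eq_is_derive d; near=> y; congr (_ ^+ 2).
  have : 0 < y by near: y; exact: lt_nbhsr.
  by move=> y0; rewrite max_r// ltW.
- rewrite ?(max_l (ltW s0)) mulr0; apply: near_eq_is_derive (is_derive_cst (0 : R) s 1); near=> y.
  have : y < 0 by near: y; exact: lt_nbhsl.
  by move=> y0; rewrite /cst max_l ?expr0n// ltW.
(* At the corner the difference quotient is at most |h| in absolute value. *)
- rewrite ?maxxx mulr0.
  have H : h^-1 *: (Num.max 0 (h *: (1 : R) + (0 : R)) ^+ 2 - Num.max 0 0 ^+ 2) @[h --> (0 : R)^'] --> (0 : R).
    apply/cvgrPdist_lt => e e0; near=> h.
    have h0 : h != 0 by near: h; exact: nbhs_dnbhs_neq.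
    have he : `|h| < e by near: h; exact: dnbhs0_lt.
    rewrite maxxx expr0n/= subr0 addr0 /GRing.scale/= mulr1 sub0r normrN.
    apply: le_lt_trans he.
    have [h1|h1] := lerP 0 h; last by rewrite expr0n mulr0 normr0.
    by rewrite expr2 mulKf.
  split; first by apply/cvg_ex; exists 0.
  exact: cvg_lim.
Unshelve. all: end_near. Qed.

Lemma is_derive_pos3 (s : R) : is_derive s 1 (fun s : R => Num.max 0 s ^+ 3) (3 * Num.max 0 s ^+ 2).
Proof.
have -> : (fun s : R => Num.max 0 s ^+ 3) = (fun s => s * Num.max 0 s ^+ 2).
  by apply/funext => y; case: lerP => y0; rewrite ?expr0n ?mulr0// exprS.
have h : is_derive s 1 (fun s : R => s * Num.max 0 s ^+ 2) _ :=
  is_deriveM (is_derive_id s 1) (is_derive_pos2 s).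
apply: is_derive_eq h _; rewrite /GRing.scale/=.
by case: lerP => s0; rewrite ?expr0n/=; ring.
Qed.

End calculus.

(** * Axisymmetric fields *)

Section axisymmetry.
Context {R : realType}.
Implicit Types (u : R3 R -> R -> R3 R) (T : R).

Definition i0 : 'I_3 := @Ordinal 3 0 isT.
Definition i1 : 'I_3 := @Ordinal 3 1 isT.
Definition i2 : 'I_3 := @Ordinal 3 2 isT.

Lemma bvecs : (((bvec i0 : R3 R).1.1 = 1) * ((bvec i0 : R3 R).1.2 = 0) * ((bvec i0 : R3 R).2 = 0) *
  ((bvec i1 : R3 R).1.1 = 0) * ((bvec i1 : R3 R).1.2 = 1) * ((bvec i1 : R3 R).2 = 0) *
  ((bvec i2 : R3 R).1.1 = 0) * ((bvec i2 : R3 R).1.2 = 0) * ((bvec i2 : R3 R).2 = 1))%type.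
Proof. by []. Qed.

Lemma sum3 (V : zmodType) (F : 'I_3 -> V) : \sum_(i < 3) F i = F i0 + F i1 + F i2.
Proof.
rewrite !big_ord_recr big_ord0 /= add0r.
by congr (F _ + F _ + F _); exact: val_inj.
Qed.

Lemma dotE (v w : R3 R) : dot v w = v.1.1 * w.1.1 + v.1.2 * w.1.2 + v.2 * w.2.
Proof. by rewrite /dot sum3. Qed.

Lemma u_rE u x t : u_r u x t = ((u x t).1.1 * x.1.1 + (u x t).1.2 * x.1.2) * rinv x.
Proof. by rewrite /u_r dotE/= mulr0 addr0 /rinv mulrDl !mulrA. Qed.

Lemma u_thetaE u x t : u_theta u x t = (x.1.1 * (u x t).1.2 - x.1.2 * (u x t).1.1) * rinv x.
Proof. by rewrite /u_theta dotE/= /rinv; ring. Qed.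

Lemma u_zE u x t : u_z u x t = (u x t).2.
Proof. by rewrite /u_z dotE/= !mulr0 !add0r mulr1. Qed.

Lemma ucomp0E u x t : ucomp u i0 x t = (u x t).1.1. Proof. by []. Qed.
Lemma ucomp1E u x t : ucomp u i1 x t = (u x t).1.2. Proof. by []. Qed.
Lemma ucomp2E u x t : ucomp u i2 x t = (u x t).2. Proof. by []. Qed.

(** The fields r e_theta and, below, r e_r: polynomial in [x], hence free of any division by r. *)
Definition perp (x : R3 R) : R3 R := vec (- x.1.2) x.1.1 0.
Definition horiz (x : R3 R) : R3 R := vec x.1.1 x.1.2 0.

(* [x + h x^perp] is the image of [sqrt (1 + h^2) x] (horizontally) under the
   rotation of angle [atan h]. *)
Lemma axisymmetric_rotation T u x t h : axisymmetric T u -> 0 <= t < T -> 0 < cyl_r x ->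
  let s := Num.sqrt (1 + h ^+ 2) in
  let z := (s - 1) *: horiz x + x in let y := h *: perp x + x in
  (u y t).1.1 = ((u z t).1.1 - h * (u z t).1.2) / s /\
  (u y t).1.2 = ((u z t).1.2 + h * (u z t).1.1) / s.
Proof.
move=> axi tT r0 s z y.
have s2 : s ^+ 2 = 1 + h ^+ 2 by rewrite sqr_sqrtr// addr_ge0// sqr_ge0.
have s0 : 0 < s by rewrite sqrtr_gt0 ltr_pwDl// sqr_ge0.
have q0 : x.1.1 ^+ 2 + x.1.2 ^+ 2 != 0 by rewrite -cyl_rE expf_neq0// gt_eqF.
have y1 : y.1.1 = x.1.1 - h * x.1.2 by rewrite /y/= /GRing.scale/= mulrN addrC.
have y2 : y.1.2 = x.1.2 + h * x.1.1 by rewrite /y/= /GRing.scale/= addrC.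
have y3 : y.2 = x.2 by rewrite /y/= /GRing.scale/= mulr0 add0r.
have z1 : z.1.1 = s * x.1.1 by rewrite /z/= /GRing.scale/=; ring.
have z2 : z.1.2 = s * x.1.2 by rewrite /z/= /GRing.scale/=; ring.
have z3 : z.2 = x.2 by rewrite /z/= /GRing.scale/= mulr0 add0r.
have ryz : cyl_r y = cyl_r z.
  rewrite /cyl_r y1 y2 z1 z2; congr Num.sqrt.
  by rewrite !exprMn s2; ring.
have ry : 0 < cyl_r y.
  rewrite ryz lt_neqAle cyl_r_ge0 eq_sym cyl_r_eq0 z1 z2 !mulf_eq0 gt_eqF//=.
  by rewrite -cyl_r_eq0 gt_eqF.
have [] := axi t y z tT ry ryz; first by rewrite /cyl_z y3 z3.
rewrite !u_rE !u_thetaE /rinv -ryz => /(mulIf _) E1 /(mulIf _) E2 _.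
have {}E1 := E1 (lt0r_neq0 _); have {}E2 := E2 (lt0r_neq0 _).
move: E1 E2; rewrite invr_gt0 => /(_ ry) E1 /(_ ry) E2.
rewrite y1 y2 z1 z2 in E1 E2.
have sn : s != 0 by rewrite gt_eqF.
set p1 := (u y t).1.1 in E1 E2 *; set p2 := (u y t).1.2 in E1 E2 *.
set q1 := (u z t).1.1 in E1 E2 *; set q2 := (u z t).1.2 in E1 E2 *.
set a := x.1.1 in E1 E2 q0 *; set b := x.1.2 in E1 E2 q0 *.
(* Equality of the radial and angular components at [y] and [z] is a linear system for the
   horizontal components at [y]; it is inverted with the transposed matrix. *)
have F1 : p1 * (s ^+ 2 * (a ^+ 2 + b ^+ 2)) = s * (a ^+ 2 + b ^+ 2) * (q1 - h * q2).
  transitivity ((a - h * b) * (p1 * (a - h * b) + p2 * (b + h * a)) -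
    (b + h * a) * ((a - h * b) * p2 - (b + h * a) * p1)); first by rewrite s2; ring.
  by rewrite E1 E2; ring.
have F2 : p2 * (s ^+ 2 * (a ^+ 2 + b ^+ 2)) = s * (a ^+ 2 + b ^+ 2) * (q2 + h * q1).
  transitivity ((b + h * a) * (p1 * (a - h * b) + p2 * (b + h * a)) +
    (a - h * b) * ((a - h * b) * p2 - (b + h * a) * p1)); first by rewrite s2; ring.
  by rewrite E1 E2; ring.
have K : s ^+ 2 * (a ^+ 2 + b ^+ 2) != 0 by rewrite mulf_neq0// expf_neq0.
split; apply: (mulIf K).
  by rewrite F1; field.
by rewrite F2; field.
Qed.

Lemma is_derive_sqrt1 : is_derive (0 : R) 1 (fun h : R => Num.sqrt (1 + h ^+ 2) : R) 0.
Proof.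
have d1 : is_derive (0 : R) 1 (fun h : R => (1 + h ^+ 2 : R)) 0.
  have h : is_derive (0 : R) 1 (fun h : R => (1 + h ^+ 2 : R)) _ :=
    is_deriveD (is_derive_cst (1 : R) (0 : R) 1) (is_deriveM (is_derive_id (0 : R) 1) (is_derive_id (0 : R) 1)).
  by apply: is_derive_eq h _; rewrite /GRing.scale/=; ring.
have d2 : is_derive (1 + (0 : R) ^+ 2 : R) (1 : R) (@Num.sqrt R) (2 * Num.sqrt (1 + 0 ^+ 2))^-1.
  by apply: is_derive_sqrt; rewrite ltr_pwDl// sqr_ge0.
by have := is_derive_comp1 d1 d2; rewrite mul0r.
Qed.

(** The dilation sqrt(1 + h^2) - 1 is of second order in [h], so the derivatives [l1] and [l2] along
    it do not contribute; only the explicit linear term in [h] survives. *)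
Lemma rotation_derive (f phi1 phi2 : R -> R) (l1 l2 c : R) :
  is_derive (0 : R) 1 phi1 l1 -> is_derive (0 : R) 1 phi2 l2 ->
  (forall h, let s := Num.sqrt (1 + h ^+ 2) in
     f h = (phi1 (s - 1) + c * h * phi2 (s - 1)) / s) ->
  is_derive (0 : R) 1 f (c * phi2 0).
Proof.
move=> d1 d2 fE.
pose s (h : R) := Num.sqrt (1 + h ^+ 2).
have s0 : s 0 = 1 by rewrite /s expr0n/= addr0 sqrtr1.
have ds : is_derive (0 : R) 1 (fun h => s h - 1) 0.
  have h : is_derive (0 : R) 1 (fun h => s h - 1) _ :=
    is_deriveB is_derive_sqrt1 (is_derive_cst (1 : R) (0 : R) 1).
  by apply: is_derive_eq h _; rewrite subr0.
have E0 : s 0 - 1 = 0 by rewrite s0 subrr.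
have e1 : is_derive (0 : R) 1 (fun h => phi1 (s h - 1)) 0.
  have d1' : is_derive (s 0 - 1) 1 phi1 l1 by rewrite E0.
  by have := is_derive_comp1 ds d1'; rewrite mul0r.
have e2 : is_derive (0 : R) 1 (fun h => phi2 (s h - 1)) 0.
  have d2' : is_derive (s 0 - 1) 1 phi2 l2 by rewrite E0.
  by have := is_derive_comp1 ds d2'; rewrite mul0r.
have e3 : is_derive (0 : R) 1 (fun h => c * h) c.
  have h : is_derive (0 : R) 1 (fun h => c * h) _ := is_deriveZ c (is_derive_id (0 : R) 1).
  by apply: is_derive_eq h _; rewrite /GRing.scale/= mulr1.
have e4 : is_derive (0 : R) 1 (fun h => (s h)^-1) 0.
  have sn : s 0 != 0 by rewrite s0 oner_neq0.
  have [dd de] := is_derive_sqrt1; split; first exact: derivableV.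
  by apply: etrans (deriveV _ dd) _ => //; rewrite de scaler0.
have e5 : is_derive (0 : R) 1 (fun h => phi1 (s h - 1) + c * h * phi2 (s h - 1)) (c * phi2 0).
  have h : is_derive (0 : R) 1 (fun h => phi1 (s h - 1) + c * h * phi2 (s h - 1)) _ :=
    is_deriveD e1 (is_deriveM e3 e2).
  by apply: is_derive_eq h _; rewrite E0 /GRing.scale/=; ring.
have -> : f = (fun h => (phi1 (s h - 1) + c * h * phi2 (s h - 1)) * (s h)^-1).
  by apply/funext => h; rewrite fE.
have h : is_derive (0 : R) 1 (fun h => (phi1 (s h - 1) + c * h * phi2 (s h - 1)) * (s h)^-1) _ :=
  is_deriveM e5 e4.
by apply: is_derive_eq h _; rewrite s0 /GRing.scale/= invr1; ring.
Qed.

Lemma bvecE (a b : R) : vec a b 0 = a *: bvec i0 + b *: bvec i1 :> R3 R.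
Proof.
transitivity (((a *: 1 + b *: 0, a *: 0 + b *: 1), a *: 0 + b *: 0) : R3 R); last by [].
by rewrite !scaler0 !addr0 !add0r /GRing.scale/= !mulr1.
Qed.

Lemma is_derive_horizontal T (f : R3 R -> R -> R) (x : R3 R) t (a b : R) :
  smooth_in 1 T f -> 0 < t < T ->
  is_derive x (vec a b 0) (f ^~ t) (a * dpart i0 f x t + b * dpart i1 f x t).
Proof.
move=> [cf [hp _]] tT; rewrite bvecE.
have [_ h0] := hp i0; have [[c1 _] h1] := hp i1.
have /andP[t0 t1] := tT.
have dv := @is_deriveZdir R _ (f ^~ t) x (bvec i0) a _ (h0 x t tT).
have dw y := @is_deriveZdir R _ (f ^~ t) y (bvec i1) b _ (h1 y t tT).
have cg : {for x, continuous (fun y => b * dpart i1 f y t)}.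
  have c : {for x, continuous (fun y => dpart i1 f y t)}.
    by apply: (jcont_xcont t0 t1 c1); rewrite lexx.
  by move: c => /= c; apply: cvgM => //; exact: cvg_cst.
exact: (@is_deriveDdir R (f ^~ t) (fun y => b * dpart i1 f y t) x (a *: bvec i0) (b *: bvec i1) _ dv dw cg).
Qed.

(** Infinitesimal rotation invariance: differentiating the horizontal velocity along r e_theta turns
    it by a right angle. Since the coefficients are x_1 and x_2, the identities also show that the
    horizontal velocity is O(r) and bounded by r times its gradient. *)
Lemma axisymmetric_derive T u (x : R3 R) t : axisymmetric T u ->
  (forall i, smooth_in 1 T (ucomp u i)) -> 0 < t < T -> 0 < cyl_r x ->
  (u x t).1.2 = x.1.2 * dpart i0 (ucomp u i0) x t - x.1.1 * dpart i1 (ucomp u i0) x t /\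
  (u x t).1.1 = x.1.1 * dpart i1 (ucomp u i1) x t - x.1.2 * dpart i0 (ucomp u i1) x t.
Proof.
move=> axi su tT r0.
have tT' : 0 <= t < T by case/andP: tT => t0 ->; rewrite ltW.
pose phi i (k : R) := ucomp u i (k *: horiz x + x) t.
have dphi i : exists l, is_derive (0 : R) 1 (phi i) l.
  eexists; apply: (is_derive_ray (f := (ucomp u i)^~ t)); rewrite scale0r add0r.
  exact: is_derive_horizontal (su i) tT.
have dperp i : is_derive (0 : R) 1 (fun h : R => ucomp u i (h *: perp x + x) t)
    (- x.1.2 * dpart i0 (ucomp u i) x t + x.1.1 * dpart i1 (ucomp u i) x t).
  apply: (is_derive_ray (f := (ucomp u i)^~ t)); rewrite scale0r add0r.
  exact: is_derive_horizontal (su i) tT.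
have phi0 i : phi i 0 = ucomp u i x t by rewrite /phi scale0r add0r.
have [l0 d0] := dphi i0; have [l1 d1] := dphi i1.
split.
- have H h : ucomp u i0 (h *: perp x + x) t =
      (phi i0 (Num.sqrt (1 + h ^+ 2) - 1) + -1 * h * phi i1 (Num.sqrt (1 + h ^+ 2) - 1)) /
      Num.sqrt (1 + h ^+ 2).
    by have [E _] := axisymmetric_rotation h axi tT' r0; apply: etrans E _; rewrite mulN1r mulNr.
  have [_ E'] := @rotation_derive _ _ _ _ _ (-1) d0 d1 H.
  have [_ E] := dperp i0; move: E'; rewrite E phi0 => E'.
  by rewrite -ucomp1E; move: E'; move: (ucomp u i1 x t) (dpart i0 _ x t) (dpart i1 _ x t) (x.1.1) (x.1.2) => A B C a b; clear => E; lra.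
- have H h : ucomp u i1 (h *: perp x + x) t =
      (phi i1 (Num.sqrt (1 + h ^+ 2) - 1) + 1 * h * phi i0 (Num.sqrt (1 + h ^+ 2) - 1)) /
      Num.sqrt (1 + h ^+ 2).
    by have [_ E] := axisymmetric_rotation h axi tT' r0; apply: etrans E _; rewrite mul1r.
  have [_ E'] := @rotation_derive _ _ _ _ _ 1 d1 d0 H.
  have [_ E] := dperp i1; move: E'; rewrite E phi0 => E'.
  by rewrite -ucomp0E; move: E'; move: (ucomp u i0 x t) (dpart i0 _ x t) (dpart i1 _ x t) (x.1.1) (x.1.2) => A B C a b; clear => E; lra.
Qed.

End axisymmetry.

(** * The localized balance of the weighted swirl energy *)

Section identity.
Context {R : realFieldType}.

(* Indices denote derivatives, [k] is 1/r, [p] the pressure, [om] the vertical vorticity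
   and [q] the cutoff [1 - m |x|^2]; [dF1 + dF2 + dF3] is the divergence of a flux. *)
Lemma swirl_identity (a b c k m nu G G1 G2 G3 G11 G22 G33 Gt u1 u2 u3 u11 u22 u33
    p p1 p2 om q : R) :
  k ^+ 2 * (a ^+ 2 + b ^+ 2) = 1 ->
  Gt + (u1 * G1 + u2 * G2 + u3 * G3) + (a * p2 - b * p1)
    = nu * (G11 + G22 + G33 - 2 * om) ->
  om = k ^+ 2 * (a * G1 + b * G2) ->
  a * G2 - b * G1 = 0 ->
  u11 + u22 + u33 = 0 ->
  let k3 := k ^+ 3 in let k2 := k ^+ 2 in
  let A1 := q ^+ 3 * (- (u1 * G) + 2 * nu * G1 - 2 * nu * G * a * k2 + 2 * b * p)
            + 6 * m * nu * q ^+ 2 * G * a in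
  let A2 := q ^+ 3 * (- (u2 * G) + 2 * nu * G2 - 2 * nu * G * b * k2 - 2 * a * p)
            + 6 * m * nu * q ^+ 2 * G * b in
  let A3 := q ^+ 3 * (- (u3 * G) + 2 * nu * G3) + 6 * m * nu * q ^+ 2 * G * c in
  let dF1 := (G1 * k3 - 3 * a * k3 * k2 * G) * A1 + G * k3 *
    (- (6 * m * a) * q ^+ 2 * (- (u1 * G) + 2 * nu * G1 - 2 * nu * G * a * k2 + 2 * b * p)
     + q ^+ 3 * (- (u11 * G) - u1 * G1 + 2 * nu * G11 - 2 * nu * G1 * a * k2
          - 2 * nu * G * k2 + 4 * nu * G * a ^+ 2 * k2 ^+ 2 + 2 * b * p1)
     + 6 * m * nu * (- (4 * m * a) * q * G * a + q ^+ 2 * (G1 * a + G))) in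
  let dF2 := (G2 * k3 - 3 * b * k3 * k2 * G) * A2 + G * k3 *
    (- (6 * m * b) * q ^+ 2 * (- (u2 * G) + 2 * nu * G2 - 2 * nu * G * b * k2 - 2 * a * p)
     + q ^+ 3 * (- (u22 * G) - u2 * G2 + 2 * nu * G22 - 2 * nu * G2 * b * k2
          - 2 * nu * G * k2 + 4 * nu * G * b ^+ 2 * k2 ^+ 2 - 2 * a * p2)
     + 6 * m * nu * (- (4 * m * b) * q * G * b + q ^+ 2 * (G2 * b + G))) in
  let dF3 := G3 * k3 * A3 + G * k3 *
    (- (6 * m * c) * q ^+ 2 * (- (u3 * G) + 2 * nu * G3)
     + q ^+ 3 * (- (u33 * G) - u3 * G3 + 2 * nu * G33)
     + 6 * m * nu * (- (4 * m * c) * q * G * c + q ^+ 2 * (G3 * c + G))) in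
  2 * G * Gt * k3 * q ^+ 3 = dF1 + dF2 + dF3
    + G ^+ 2 * k3 * (- 3 * (a * u1 + b * u2) * k2 * q ^+ 3
        - 6 * m * (a * u1 + b * u2 + c * u3) * q ^+ 2
        + nu * (- (3 / 2) * k2 * q ^+ 3 - 12 * m * q ^+ 2
               + 24 * m ^+ 2 * (a ^+ 2 + b ^+ 2 + c ^+ 2) * q))
    - 2 * nu * k3 * q ^+ 3 * ((G1 - 3 / 2 * G * a * k2) ^+ 2
        + (G2 - 3 / 2 * G * b * k2) ^+ 2 + G3 ^+ 2).
Proof.
move=> kE /(canRL (addrK _)) /(canRL (addrK _)) -> -> th div k3 k2 A1 A2 A3 dF1 dF2 dF3.
have r0 : a ^+ 2 + b ^+ 2 != 0.
  by apply/eqP => e; move: kE; rewrite e mulr0 => /esym/eqP; rewrite oner_eq0.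
have k2E : k2 = (a ^+ 2 + b ^+ 2)^-1 by rewrite -[LHS]mulr1 -(mulfV r0) mulrA kE mul1r.
have u33E : u33 = - u11 - u22 by lra.
rewrite /dF1 /dF2 /dF3 /A1 /A2 /A3 -/k2 k2E u33E; clear dF1 dF2 dF3 A1 A2 A3; clearbody k3.
apply/eqP; rewrite -subr_eq0; apply/eqP.
(* Once the equation for [Gt] is substituted, only the pressure is left: the flux terms [2 * b * p]
   and [- 2 * a * p] have moved its angular derivative onto [G]. *)
transitivity (2 * k3 * q ^+ 3 * p * (a * G2 - b * G1)); last by rewrite th mulr0.
field.
by [].
Qed.
End identity.

Section flow.
Context {R : realType}.
Variables (T ta tb : R) (u : R3 R -> R -> R3 R) (p : R3 R -> R -> R).
Hypotheses (ta0 : 0 < ta) (tbT : tb < T).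
Hypothesis su : forall i, smooth_in 4 T (ucomp u i).
Hypothesis sp : smooth_in 4 T p.
Hypothesis axi : axisymmetric T u.
Local Notation cls := (axis_class ta tb).
Local Notation reg := (axis_reg ta tb).
Local Notation U := (ucomp u).

Lemma cls_smooth n f : smooth_in n T f -> cls 0 f.
Proof. by move/smooth_in_jcont; exact: (axis_class_jcont ta0 tbT). Qed.

Lemma reg_smooth n f i : smooth_in n.+1 T f -> reg (bvec i) 0 f (dpart i f).
Proof.
move=> sf; have [_ [hp _]] := sf; have [h1 h2] := hp i; split.
- exact: cls_smooth sf.
- by apply: axis_classW (cls_smooth h1).
- by move=> x t _ tJ; apply: h2; exact: (in_strip ta0 tbT).
Qed.

Lemma su1 i : smooth_in 1 T (U i).
Proof.
have [c [h1 [h2 h3]]] := su i; split => //; split; last split => //.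
  by move=> j; have [[c1 _] h] := h1 j; split.
by case: h2.
Qed.

Lemma sdu i j : smooth_in 3 T (dpart j (U i)).
Proof. by have [_ [h _]] := su i; have [] := h j. Qed.

Lemma sdtu i : smooth_in 3 T (dtime (U i)).
Proof. by have [_ [_ [h _]]] := su i. Qed.

Let cls_coord1 := axis_class_coord1 (R := R) ta tb.
Let cls_coord2 := axis_class_coord2 (R := R) ta tb.

Lemma cls_opp d f : cls d f -> cls d (fun x t => - f x t).
Proof.
move=> h; have := axis_classM (axis_class_cst ta tb (-1)) h; rewrite add0r.
by under eq_fun do under eq_fun do rewrite mulN1r.
Qed.

Lemma cls_sub d f g : cls d f -> cls d g -> cls d (fun x t => f x t - g x t).
Proof. by move=> hf hg; exact: (axis_classD hf (cls_opp hg)). Qed.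

(** Only the bound is borrowed from [g]; continuity and measurability remain those of [f], so
    equality off the axis is enough. It raises the order of the horizontal velocity from 0 to 1. *)
Lemma cls_congr d e f g : cls d f -> cls e g ->
  (forall x t, 0 < cyl_r x -> ta <= t <= tb -> f x t = g x t) -> cls e f.
Proof.
move=> [_ h1 h2 h3] [gO _ _ _] fg; split => //.
move=> N; have [C C0 hC] := gO N; exists C => // x t xN r0 tJ.
by rewrite fg//; exact: hC.
Qed.

Lemma cls_u0 : cls 1 (U i0).
Proof.
have h : cls 1 (fun x t => x.1.1 * dpart i1 (U i1) x t - x.1.2 * dpart i0 (U i1) x t).
  apply: cls_sub; rewrite -[1 : int]addr0; apply: axis_classM.
  - exact: cls_coord1.
  - exact: cls_smooth (sdu i1 i1).
  - exact: cls_coord2.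
  - exact: cls_smooth (sdu i1 i0).
apply: cls_congr (cls_smooth (su i0)) h _ => x t r0 tJ.
by have [_ E] := axisymmetric_derive axi su1 (in_strip ta0 tbT tJ) r0.
Qed.

Lemma cls_u1 : cls 1 (U i1).
Proof.
have h : cls 1 (fun x t => x.1.2 * dpart i0 (U i0) x t - x.1.1 * dpart i1 (U i0) x t).
  apply: cls_sub; rewrite -[1 : int]addr0; apply: axis_classM.
  - exact: cls_coord2.
  - exact: cls_smooth (sdu i0 i0).
  - exact: cls_coord1.
  - exact: cls_smooth (sdu i0 i1).
apply: cls_congr (cls_smooth (su i1)) h _ => x t r0 tJ.
by have [E _] := axisymmetric_derive axi su1 (in_strip ta0 tbT tJ) r0.
Qed.

Lemma reg_u0 i : reg (bvec i) 1 (U i0) (dpart i (U i0)).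
Proof.
have [_ _ h] := reg_smooth i (su i0); split; [exact: cls_u0| |exact: h].
by rewrite subrr; exact: cls_smooth (sdu i0 i).
Qed.

Lemma reg_u1 i : reg (bvec i) 1 (U i1) (dpart i (U i1)).
Proof.
have [_ _ h] := reg_smooth i (su i1); split; [exact: cls_u1| |exact: h].
by rewrite subrr; exact: cls_smooth (sdu i1 i).
Qed.

Lemma reg_coord1 i : reg (bvec i) 1 (fun x _ => x.1.1) (fun _ _ => (bvec i : R3 R).1.1).
Proof.
split; [exact: cls_coord1|exact: axis_class_cst|].
by move=> x t _ _; exact: is_derive_coord1.
Qed.

Lemma reg_coord2 i : reg (bvec i) 1 (fun x _ => x.1.2) (fun _ _ => (bvec i : R3 R).1.2).
Proof.
split; [exact: cls_coord2|exact: axis_class_cst|].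
by move=> x t _ _; exact: is_derive_coord2.
Qed.

Lemma reg_coord3 i : reg (bvec i) 0 (fun x _ => x.2) (fun _ _ => (bvec i : R3 R).2).
Proof.
split; [exact: (axis_class_coord3 ta0 tbT)|by apply: axis_classW (axis_class_cst ta tb _)|].
by move=> x t _ _; exact: is_derive_coord3.
Qed.

Lemma reg_rinv i : reg (bvec i) (-1) (fun x _ => rinv x)
  (fun x _ => - (x.1.1 * (bvec i : R3 R).1.1 + x.1.2 * (bvec i : R3 R).1.2) * rinv x ^+ 3).
Proof.
have ck := axis_class_rinv (R := R) ta tb.
split; [exact: ck| |by move=> x t r0 _; exact: is_derive_rinv].
have k3 : cls (- 3%:Z) (fun x _ => rinv x ^+ 3) := axis_classM ck (axis_classM ck ck).
exact: (axis_classM (cls_opp (axis_classD (axis_classM cls_coord1 (axis_class_cst ta tb (bvec i : R3 R).1.1))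
   (axis_classM cls_coord2 (axis_class_cst ta tb (bvec i : R3 R).1.2)))) k3).
Qed.

(** The circulation r u^theta, written so as to be smooth across the axis. *)
Definition swirl x t := x.1.1 * U i1 x t - x.1.2 * U i0 x t.
Definition dswirl i x t :=
  x.1.1 * dpart i (U i1) x t + U i1 x t * (bvec i : R3 R).1.1
  - (x.1.2 * dpart i (U i0) x t + U i0 x t * (bvec i : R3 R).1.2).
Definition ddswirl i x t :=
  (x.1.1 * dpart i (dpart i (U i1)) x t + 2 * (bvec i : R3 R).1.1 * dpart i (U i1) x t)
  - (x.1.2 * dpart i (dpart i (U i0)) x t + 2 * (bvec i : R3 R).1.2 * dpart i (U i0) x t).
Definition dtswirl x t := x.1.1 * dtime (U i1) x t - x.1.2 * dtime (U i0) x t.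

Lemma reg_opp v d f f' : reg v d f f' -> reg v d (fun x t => - f x t) (fun x t => - f' x t).
Proof.
move=> h; have := axis_regM (axis_regC ta tb v (-1)) h; rewrite add0r.
apply: axis_reg_ext => x t; first by rewrite mulN1r.
by rewrite mulr0 addr0 mulN1r.
Qed.

Lemma reg_sub v d f f' g g' : reg v d f f' -> reg v d g g' ->
  reg v d (fun x t => f x t - g x t) (fun x t => f' x t - g' x t).
Proof. by move=> hf hg; exact: (axis_regD hf (reg_opp hg)). Qed.

Lemma reg_swirl i : reg (bvec i) 2 swirl (dswirl i).
Proof.
exact: (reg_sub (axis_regM (reg_coord1 i) (reg_u1 i)) (axis_regM (reg_coord2 i) (reg_u0 i))).
Qed.

Lemma reg_dswirl i : reg (bvec i) 1 (dswirl i) (ddswirl i).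
Proof.
have h1 := axis_regM (reg_coord1 i) (reg_smooth i (sdu i1 i)).
have h2 := axis_regM (reg_coord2 i) (reg_smooth i (sdu i0 i)).
have h3 := axis_regM (reg_u1 i) (axis_regC ta tb (bvec i) (bvec i : R3 R).1.1).
have h4 := axis_regM (reg_u0 i) (axis_regC ta tb (bvec i) (bvec i : R3 R).1.2).
have := reg_sub (axis_regD h1 h3) (axis_regD h2 h4).
apply: axis_reg_ext => x t //.
rewrite /ddswirl; cbv beta.
move: (dpart i (dpart i (U i1)) x t) (dpart i (dpart i (U i0)) x t) (dpart i (U i1) x t)
  (dpart i (U i0) x t) (U i1 x t) (U i0 x t) ((bvec i : R3 R).1.1) ((bvec i : R3 R).1.2)
  (x.1.1) (x.1.2); clear => *; ring.
Qed.

Lemma cls_dtswirl : cls 1 dtswirl.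
Proof.
apply: cls_sub; rewrite -[1 : int]addr0; apply: axis_classM.
- exact: cls_coord1.
- exact: cls_smooth (sdtu i1).
- exact: cls_coord2.
- exact: cls_smooth (sdtu i0).
Qed.

(** It enters the energy cubed: differentiating the cube leaves a square in the flux, which has to
    be differentiated once more, and the square of a positive part is still C^1. *)
Definition cutoff (m : R) (x : R3 R) : R :=
  Num.max 0 (1 - m * (x.1.1 ^+ 2 + x.1.2 ^+ 2 + x.2 ^+ 2)).

Lemma cutoff_continuous m : continuous (cutoff m).
Proof.
move=> x.
have c1 : y.1.1 @[y --> x] --> x.1.1 by exact: (@coord1_continuous R).
have c2 : y.1.2 @[y --> x] --> x.1.2 by exact: (@coord2_continuous R).
have c3 : y.2 @[y --> x] --> x.2 by exact: (@coord3_continuous R).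
have h : (1 - m * (y.1.1 * y.1.1 + y.1.2 * y.1.2 + y.2 * y.2)) @[y --> x] -->
    1 - m * (x.1.1 * x.1.1 + x.1.2 * x.1.2 + x.2 * x.2).
  apply: cvgB; first exact: cvg_cst.
  apply: cvgM; first exact: cvg_cst.
  by apply: cvgD; [apply: cvgD; exact: cvgM|exact: cvgM].
have cm : continuous (fun s : R => Num.max 0 s).
  by move=> s; apply: continuous_max; [exact: cvg_cst|exact: cvg_id].
exact: (cvg_comp _ _ h (cm _)).
Qed.

Lemma is_derive_normsq m (x v : R3 R) : is_derive x v
  (fun x : R3 R => 1 - m * (x.1.1 ^+ 2 + x.1.2 ^+ 2 + x.2 ^+ 2))
  (- (2 * m * (x.1.1 * v.1.1 + x.1.2 * v.1.2 + x.2 * v.2))).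
Proof.
have d1 := is_derive_coord1 x v; have d2 := is_derive_coord2 x v; have d3 := is_derive_coord3 x v.
have h : is_derive x v (fun x : R3 R => 1 - m * (x.1.1 ^+ 2 + x.1.2 ^+ 2 + x.2 ^+ 2)) _ :=
  is_deriveB (is_derive_cst (1 : R) x v) (is_deriveZ m
    (is_deriveD (is_deriveD (is_deriveM d1 d1) (is_deriveM d2 d2)) (is_deriveM d3 d3))).
by apply: is_derive_eq h _; rewrite /GRing.scale/=; ring.
Qed.

Lemma cls_cutoff m n : cls 0 (fun x _ => cutoff m x ^+ n).
Proof.
apply: (axis_class_continuous ta0 tbT) => x.
elim: n => [|n IH]; first exact: cvg_cst.
rewrite /continuous_at exprS; under eq_fun do rewrite exprS.
by apply: cvgM => //; exact: cutoff_continuous.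
Qed.

Lemma cls_coord_dot (v : R3 R) : cls 0 (fun x _ => x.1.1 * v.1.1 + x.1.2 * v.1.2 + x.2 * v.2).
Proof.
apply: axis_classD; first apply: axis_classD.
- by apply: axis_classW (axis_classM cls_coord1 (axis_class_cst ta tb _)).
- by apply: axis_classW (axis_classM cls_coord2 (axis_class_cst ta tb _)).
- by apply: (axis_classM (d := 0) (e := 0)); [exact: (axis_class_coord3 ta0 tbT)|exact: axis_class_cst].
Qed.

Lemma reg_cutoff2 m v : reg v 0 (fun x _ => cutoff m x ^+ 2)
  (fun x _ => - (4 * m) * (x.1.1 * v.1.1 + x.1.2 * v.1.2 + x.2 * v.2) * cutoff m x).
Proof.
split; first exact: cls_cutoff.
- have := axis_classM (axis_classM (axis_class_cst ta tb (- (4 * m))) (cls_coord_dot v)) (cls_cutoff m 1).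
  by move=> h; exact: (axis_classW _ h).
- move=> x t _ _; apply: is_derive_eq (is_derive_comp1 (is_derive_normsq m x v) (is_derive_pos2 _)) _.
  by rewrite -/(cutoff m x); move: (cutoff m x) => q; ring.
Qed.

Lemma reg_cutoff3 m v : reg v 0 (fun x _ => cutoff m x ^+ 3)
  (fun x _ => - (6 * m) * (x.1.1 * v.1.1 + x.1.2 * v.1.2 + x.2 * v.2) * cutoff m x ^+ 2).
Proof.
split; first exact: cls_cutoff.
- have := axis_classM (axis_classM (axis_class_cst ta tb (- (6 * m))) (cls_coord_dot v)) (cls_cutoff m 2).
  by move=> h; exact: (axis_classW _ h).
- move=> x t _ _; apply: is_derive_eq (is_derive_comp1 (is_derive_normsq m x v) (is_derive_pos3 _)) _.
  by rewrite -/(cutoff m x); move: (cutoff m x) => q; ring.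
Qed.

Section flux.
Variables (nu m : R).
Local Notation e1 i := ((bvec i : R3 R).1.1).
Local Notation e2 i := ((bvec i : R3 R).1.2).
Local Notation e3 i := ((bvec i : R3 R).2).

(** A component of the vector field whose divergence is split off in [swirl_identity]; [X] is the
    coordinate in question. The second term is - nu G^2 r^-3 times the derivative of q^3: it trades
    the product of the gradients of G^2 and q^3 for second derivatives of q^3. *)
Definition flux (B : R3 R -> R -> R) (X : R3 R -> R) x t :=
  swirl x t * rinv x ^+ 3 *
  (cutoff m x ^+ 3 * B x t + 6 * m * nu * cutoff m x ^+ 2 * swirl x t * X x).

Definition dflux i (B dB : R3 R -> R -> R) (X : R3 R -> R) x t :=
  (dswirl i x t * rinv x ^+ 3
     - 3 * (x.1.1 * e1 i + x.1.2 * e2 i) * rinv x ^+ 3 * rinv x ^+ 2 * swirl x t)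
   * (cutoff m x ^+ 3 * B x t + 6 * m * nu * cutoff m x ^+ 2 * swirl x t * X x)
  + swirl x t * rinv x ^+ 3 *
    (- (6 * m * (x.1.1 * e1 i + x.1.2 * e2 i + x.2 * e3 i)) * cutoff m x ^+ 2 * B x t
     + cutoff m x ^+ 3 * dB x t
     + 6 * m * nu * (- (4 * m * (x.1.1 * e1 i + x.1.2 * e2 i + x.2 * e3 i)) * cutoff m x
          * swirl x t * X x + cutoff m x ^+ 2 * (dswirl i x t * X x + swirl x t))).

(** Here G = O(r^2) pays off: G r^-3 has order -1 and the bracket order 1, so the flux is bounded
    near the axis and its derivative is O(1/r), which is integrable. *)
Lemma reg_flux i B dB X : reg (bvec i) 1 B dB ->
  reg (bvec i) 0 (fun x _ => X x) (fun _ _ => 1) ->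
  reg (bvec i) 0 (flux B X) (dflux i B dB X).
Proof.
move=> rB rX.
have rk := reg_rinv i; have rG := reg_swirl i.
have rGk := axis_regM rG (axis_regM rk (axis_regM rk rk)).
have r1 := axis_regM (reg_cutoff3 m (bvec i)) rB.
have r2 := axis_regM (axis_regM (axis_regC ta tb (bvec i) (6 * m * nu)) (reg_cutoff2 m (bvec i)))
  (axis_regM rG rX).
have r2' := axis_regW (_ : (1 <= _)%R) r2.
have := axis_regM rGk (axis_regD r1 (r2' isT)).
apply: axis_reg_ext => x t.
  rewrite /flux; cbv beta.
  move: (cutoff m x) (rinv x) (swirl x t) (B x t) (X x); clear => *; ring.
rewrite /dflux; cbv beta.
move: (cutoff m x) (rinv x) (swirl x t) (B x t) (X x) (dswirl i x t) (dB x t) (e1 i) (e2 i) (e3 i)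
  (x.1.1) (x.1.2) (x.2); clear => *; ring.
Qed.

(** In this order: transport, diffusion, the drift - (2/r) d_r G produced by the vertical vorticity,
    and the pressure. The last two are written as divergences up to zero-order terms. *)
Definition B1 x t := - (U i0 x t * swirl x t) + 2 * nu * dswirl i0 x t
  - 2 * nu * swirl x t * x.1.1 * rinv x ^+ 2 + 2 * x.1.2 * p x t.
Definition dB1 x t := - (dpart i0 (U i0) x t * swirl x t) - U i0 x t * dswirl i0 x t
  + 2 * nu * ddswirl i0 x t - 2 * nu * dswirl i0 x t * x.1.1 * rinv x ^+ 2
  - 2 * nu * swirl x t * rinv x ^+ 2
  + 4 * nu * swirl x t * x.1.1 ^+ 2 * (rinv x ^+ 2) ^+ 2 + 2 * x.1.2 * dpart i0 p x t.
Definition B2 x t := - (U i1 x t * swirl x t) + 2 * nu * dswirl i1 x t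
  - 2 * nu * swirl x t * x.1.2 * rinv x ^+ 2 - 2 * x.1.1 * p x t.
Definition dB2 x t := - (dpart i1 (U i1) x t * swirl x t) - U i1 x t * dswirl i1 x t
  + 2 * nu * ddswirl i1 x t - 2 * nu * dswirl i1 x t * x.1.2 * rinv x ^+ 2
  - 2 * nu * swirl x t * rinv x ^+ 2
  + 4 * nu * swirl x t * x.1.2 ^+ 2 * (rinv x ^+ 2) ^+ 2 - 2 * x.1.1 * dpart i1 p x t.
Definition B3 x t := - (U i2 x t * swirl x t) + 2 * nu * dswirl i2 x t.
Definition dB3 x t := - (dpart i2 (U i2) x t * swirl x t) - U i2 x t * dswirl i2 x t
  + 2 * nu * ddswirl i2 x t.

Lemma reg_B1 : reg (bvec i0) 1 B1 dB1.
Proof.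
have rk := reg_rinv i0; have rG := reg_swirl i0.
have r1 := axis_regM (reg_smooth i0 (su i0)) rG.
have r1' := axis_regW (_ : (1 <= _)%R) r1.
have r2 := axis_regM (axis_regC ta tb (bvec i0) (2 * nu)) (reg_dswirl i0).
have r3 := axis_regM (axis_regC ta tb (bvec i0) (2 * nu))
  (axis_regM rG (axis_regM (reg_coord1 i0) (axis_regM rk rk))).
have r4 := axis_regM (axis_regC ta tb (bvec i0) 2) (axis_regM (reg_coord2 i0) (reg_smooth i0 sp)).
have := axis_regD (reg_sub (axis_regD (reg_opp (r1' isT)) r2) r3) r4.
apply: axis_reg_ext => x t.
  rewrite /B1; cbv beta.
  move: (rinv x) (swirl x t) (dswirl i0 x t) (U i0 x t) (p x t) (x.1.1) (x.1.2); clear => *; ring.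
rewrite /dB1; cbv beta; rewrite !bvecs.
move: (rinv x) (swirl x t) (dswirl i0 x t) (ddswirl i0 x t) (U i0 x t) (dpart i0 (U i0) x t)
  (p x t) (dpart i0 p x t) (x.1.1) (x.1.2); clear => *; ring.
Qed.

Lemma reg_B2 : reg (bvec i1) 1 B2 dB2.
Proof.
have rk := reg_rinv i1; have rG := reg_swirl i1.
have r1 := axis_regM (reg_smooth i1 (su i1)) rG.
have r1' := axis_regW (_ : (1 <= _)%R) r1.
have r2 := axis_regM (axis_regC ta tb (bvec i1) (2 * nu)) (reg_dswirl i1).
have r3 := axis_regM (axis_regC ta tb (bvec i1) (2 * nu))
  (axis_regM rG (axis_regM (reg_coord2 i1) (axis_regM rk rk))).
have r4 := axis_regM (axis_regC ta tb (bvec i1) 2) (axis_regM (reg_coord1 i1) (reg_smooth i1 sp)).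
have := reg_sub (reg_sub (axis_regD (reg_opp (r1' isT)) r2) r3) r4.
apply: axis_reg_ext => x t.
  rewrite /B2; cbv beta.
  move: (rinv x) (swirl x t) (dswirl i1 x t) (U i1 x t) (p x t) (x.1.1) (x.1.2); clear => *; ring.
rewrite /dB2; cbv beta; rewrite !bvecs.
move: (rinv x) (swirl x t) (dswirl i1 x t) (ddswirl i1 x t) (U i1 x t) (dpart i1 (U i1) x t)
  (p x t) (dpart i1 p x t) (x.1.1) (x.1.2); clear => *; ring.
Qed.

Lemma reg_B3 : reg (bvec i2) 1 B3 dB3.
Proof.
have rG := reg_swirl i2.
have r1 := axis_regM (reg_smooth i2 (su i2)) rG.
have r1' := axis_regW (_ : (1 <= _)%R) r1.
have r2 := axis_regM (axis_regC ta tb (bvec i2) (2 * nu)) (reg_dswirl i2).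
have := axis_regD (reg_opp (r1' isT)) r2.
apply: axis_reg_ext => x t.
  rewrite /B3; cbv beta.
  move: (swirl x t) (dswirl i2 x t) (U i2 x t); clear => *; ring.
rewrite /dB3; cbv beta.
move: (swirl x t) (dswirl i2 x t) (ddswirl i2 x t) (U i2 x t) (dpart i2 (U i2) x t); clear => *; ring.
Qed.

Definition dflux1 := dflux i0 B1 dB1 (fun x => x.1.1).
Definition dflux2 := dflux i1 B2 dB2 (fun x => x.1.2).
Definition dflux3 := dflux i2 B3 dB3 (fun x => x.2).

Lemma reg_flux1 : reg (bvec i0) 0 (flux B1 (fun x => x.1.1)) dflux1.
Proof. exact: (reg_flux reg_B1 (axis_regW (isT : (0 <= 1 :> int)%R) (reg_coord1 i0))). Qed.

Lemma reg_flux2 : reg (bvec i1) 0 (flux B2 (fun x => x.1.2)) dflux2.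
Proof. exact: (reg_flux reg_B2 (axis_regW (isT : (0 <= 1 :> int)%R) (reg_coord2 i1))). Qed.

Lemma reg_flux3 : reg (bvec i2) 0 (flux B3 (fun x => x.2)) dflux3.
Proof. exact: (reg_flux reg_B3 (reg_coord3 i2)). Qed.

End flux.

End flow.

Section balance.
Context {R : realType}.
Variables (T ta tb nu : R) (u : R3 R -> R -> R3 R) (p : R3 R -> R -> R).
Hypotheses (ta0 : 0 < ta) (tbT : tb < T).
Hypothesis ns : navier_stokes nu T u p.
Hypothesis axi : axisymmetric T u.
Hypothesis nu0 : 0 < nu.
Local Notation cls := (axis_class ta tb).
Local Notation U := (ucomp u).
Local Notation leb3 := (@leb3 R).
Local Notation G := (swirl u).

Let su i : smooth_in 4 T (U i). Proof. by case: ns => h _ _ _; exact: smooth_on_in. Qed.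
Let sp : smooth_in 4 T p. Proof. by case: ns => _ h _ _; exact: smooth_on_in. Qed.

Lemma momentum i x t : 0 < t < T ->
  dtime (U i) x t + (U i0 x t * dpart i0 (U i) x t + U i1 x t * dpart i1 (U i) x t
     + U i2 x t * dpart i2 (U i) x t) + dpart i p x t
  = nu * (dpart i0 (dpart i0 (U i)) x t + dpart i1 (dpart i1 (U i)) x t
      + dpart i2 (dpart i2 (U i)) x t).
Proof.
move=> tT; case: ns => _ _ _ mom; have := mom x t tT i; rewrite /laplacian.
rewrite (sum3 (fun j => U j x t * partial j (U i ^~ t) x)).
by rewrite (sum3 (fun j => partial j (partial j (U i ^~ t)) x)).
Qed.

Lemma divergence x t : 0 < t < T ->
  dpart i0 (U i0) x t + dpart i1 (U i1) x t + dpart i2 (U i2) x t = 0.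
Proof.
move=> tT; case: ns => _ _ div _; have := div x t tT.
by rewrite (sum3 (fun j => partial j (U j ^~ t) x)).
Qed.

Lemma swirl_pde x t : 0 < t < T ->
  dtswirl u x t + (U i0 x t * dswirl u i0 x t + U i1 x t * dswirl u i1 x t
     + U i2 x t * dswirl u i2 x t) + (x.1.1 * dpart i1 p x t - x.1.2 * dpart i0 p x t)
  = nu * (ddswirl u i0 x t + ddswirl u i1 x t + ddswirl u i2 x t
      - 2 * (dpart i0 (U i1) x t - dpart i1 (U i0) x t)).
Proof.
move=> tT; have := momentum i0 x tT; have := momentum i1 x tT.
rewrite /dtswirl /dswirl /ddswirl.
rewrite !bvecs.
move: (dtime (U i1) x t) (dtime (U i0) x t) (dpart i0 (dpart i0 (U i0)) x t)
  (dpart i1 (dpart i1 (U i0)) x t) (dpart i2 (dpart i2 (U i0)) x t) (dpart i0 (dpart i0 (U i1)) x t)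
  (dpart i1 (dpart i1 (U i1)) x t) (dpart i2 (dpart i2 (U i1)) x t)
  (dpart i0 (U i0) x t) (dpart i1 (U i0) x t) (dpart i2 (U i0) x t)
  (dpart i0 (U i1) x t) (dpart i1 (U i1) x t) (dpart i2 (U i1) x t)
  (dpart i0 p x t) (dpart i1 p x t) (U i0 x t) (U i1 x t) (U i2 x t) (x.1.1) (x.1.2).
clear => t1 t0 d000 d110 d220 d001 d111 d221 d00 d10 d20 d01 d11 d21 p0 p1 v0 v1 v2 a b E1 E0.
have E : a * (t1 + (v0 * d01 + v1 * d11 + v2 * d21) + p1)
   - b * (t0 + (v0 * d00 + v1 * d10 + v2 * d20) + p0)
   = a * (nu * (d001 + d111 + d221)) - b * (nu * (d000 + d110 + d220)) by rewrite E1 E0.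
apply/eqP; rewrite -subr_eq0; move/eqP: E; rewrite -subr_eq0 => /eqP E; apply/eqP.
by rewrite -[RHS]E; ring.
Qed.

(** The angular derivative of G vanishes, and the vertical vorticity is (1/r) d_r G; the latter
    makes the viscous term of the equation for G a Laplacian with a radial drift. *)
Lemma swirl_axisymmetric x t : 0 < t < T -> 0 < cyl_r x ->
  x.1.1 * dswirl u i1 x t - x.1.2 * dswirl u i0 x t = 0 /\
  dpart i0 (U i1) x t - dpart i1 (U i0) x t
    = rinv x ^+ 2 * (x.1.1 * dswirl u i0 x t + x.1.2 * dswirl u i1 x t).
Proof.
move=> tT r0.
have [] := axisymmetric_derive axi (su1 su) tT r0.
have := rinvE r0; rewrite -ucomp0E -ucomp1E /dswirl.
rewrite !bvecs.
move: (dpart i0 (U i0) x t) (dpart i1 (U i0) x t) (dpart i0 (U i1) x t) (dpart i1 (U i1) x t)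
  (U i0 x t) (U i1 x t) (x.1.1) (x.1.2) (rinv x ^+ 2).
clear => d00 d10 d01 d11 v0 v1 a b K KE E1 E0; split.
  by rewrite E1 E0; ring.
transitivity (K * (a ^+ 2 + b ^+ 2) * (d01 - d10)); first by rewrite KE mul1r.
by rewrite E1 E0; ring.
Qed.

Section energy.
Variable N : R.
Hypothesis N0 : 0 < N.
Local Notation m := (N ^- 2).
Local Notation q := (cutoff m).

Lemma cutoff_ge0 x : 0 <= q x.
Proof. by rewrite /cutoff le_max lexx. Qed.

Lemma cutoff_le1 x : q x <= 1.
Proof.
rewrite /cutoff ge_max ler01 gerBl mulr_ge0 ?invr_ge0 ?exprn_ge0 ?(ltW N0)//.
by rewrite !addr_ge0 ?sqr_ge0.
Qed.

Lemma cutoff_support x : 0 < q x -> m * (x.1.1 ^+ 2 + x.1.2 ^+ 2 + x.2 ^+ 2) < 1.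
Proof. by rewrite /cutoff lt_max ltxx/= subr_gt0. Qed.

Lemma cutoff_out x : ~~ inbox N x -> q x = 0.
Proof.
apply: contraNeq => q0.
have {}q0 : 0 < q x by rewrite lt_neqAle eq_sym q0 cutoff_ge0.
have := cutoff_support q0; rewrite mulrC ltr_pdivrMr ?exprn_gt0// mul1r => h.
have sq0 (y : R) : y ^+ 2 <= x.1.1 ^+ 2 + x.1.2 ^+ 2 + x.2 ^+ 2 -> `|y| <= N.
  move=> hy; rewrite -(ler_pXn2r (ltn0Sn 1)) ?nnegrE ?(ltW N0)//.
  by rewrite (real_normK (num_real y)) (le_trans hy)// ltW.
have := sqr_ge0 x.1.1; have := sqr_ge0 x.1.2; have := sqr_ge0 x.2 => h3 h2 h1.
by rewrite /inbox !sq0//; lra.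
Qed.

Definition box_rinv (x : R3 R) : R := rinv x * (inbox N x)%:R.

Lemma measurable_inbox : measurable_fun setT (inbox N).
Proof.
have mb : measurable_fun setT (fun s : R => `|s| <= N)%R.
  by apply: measurable_fun_ler => //; exact: normr_measurable.
apply: measurable_and; last apply: measurable_and.
- exact: (measurableT_comp mb (continuous_measurable_R3 (@coord1_continuous R))).
- exact: (measurableT_comp mb (continuous_measurable_R3 (@coord2_continuous R))).
- exact: (measurableT_comp mb (continuous_measurable_R3 (@coord3_continuous R))).
Qed.

Lemma measurable_box_rinv : measurable_fun setT box_rinv.
Proof.
apply: measurable_funM; first exact: measurable_rinv.
exact: (measurableT_comp (f := fun b : bool => b%:R : R) _ measurable_inbox).
Qed.

Lemma box_rinv_ge0 x : 0 <= box_rinv x.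
Proof. by rewrite mulr_ge0// rinv_ge0. Qed.

Lemma integrable_box_rinv (C : R) : leb3.-integrable setT (fun x => (C * box_rinv x)%:E).
Proof.
apply: (@integrable_bounded_rinv _ _ `|C| N).
- by apply: measurable_funM => //; exact: measurable_box_rinv.
- move=> x; rewrite normrM ler_wpM2l// ger0_norm ?box_rinv_ge0//.
  by rewrite /box_rinv ler_piMr ?rinv_ge0// lern1 leq_b1.
- by move=> x /negbTE xN; rewrite /box_rinv xN !mulr0.
Qed.

(** A majorant independent of time, for dominated convergence and differentiation under the integral
    sign. *)
Lemma cls_dominated f : cls (-1) f ->
  (forall x t, ~~ inbox N x -> f x t = 0) -> (forall x t, cyl_r x = 0 -> f x t = 0) ->
  exists2 C : R, 0 <= C & forall x t, ta <= t <= tb -> `|f x t| <= C * box_rinv x.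
Proof.
move=> [fO _ _ _] f1 f2; have [C C0 hC] := fO N; exists C => // x t tJ.
have [xN|xN] := boolP (inbox N x); last first.
  by rewrite f1// normr0 mulr_ge0// box_rinv_ge0.
have [r0|r0] := cyl_r_cases x; first by rewrite f2// normr0 mulr_ge0// box_rinv_ge0.
by apply: le_trans (hC x t xN r0 tJ) _; rewrite /box_rinv xN mulr1.
Qed.

Lemma cls_integrable f t : cls (-1) f ->
  (forall x t, ~~ inbox N x -> f x t = 0) -> (forall x t, cyl_r x = 0 -> f x t = 0) ->
  ta <= t <= tb -> leb3.-integrable setT (EFin \o f ^~ t).
Proof.
move=> cf f1 f2 tJ; have [C C0 hC] := cls_dominated cf f1 f2.
apply: (@integrable_bounded_rinv _ _ C N).
- exact: (axis_meas cf tJ).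
- move=> x; apply: le_trans (hC x t tJ) _; rewrite ler_wpM2l//.
  by rewrite /box_rinv ler_piMr ?rinv_ge0// lern1 leq_b1.
- by move=> x; exact: f1.
Qed.

Lemma dflux_out i B dB X x t : ~~ inbox N x -> dflux u nu m i B dB X x t = 0.
Proof. by move=> /cutoff_out qx; rewrite /dflux qx !expr0n/= !(mulr0, mul0r, addr0). Qed.

Lemma dflux_axis i B dB X x t : cyl_r x = 0 -> dflux u nu m i B dB X x t = 0.
Proof. by move=> /rinv_axis kx; rewrite /dflux kx !expr0n/= !(mulr0, mul0r, addr0, subr0). Qed.

Lemma flux_out B X x t : ~~ inbox N x -> flux u nu m B X x t = 0.
Proof. by move=> /cutoff_out qx; rewrite /flux qx !expr0n/= !(mulr0, mul0r, addr0). Qed.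

Lemma integrable_dflux i B dB X t : cls (0 - 1) (dflux u nu m i B dB X) -> ta <= t <= tb ->
  leb3.-integrable setT (EFin \o (dflux u nu m i B dB X) ^~ t).
Proof.
by move=> c tJ; apply: (cls_integrable c _ _ tJ) => x s; [exact: dflux_out|exact: dflux_axis].
Qed.

Lemma integral_dflux1 t : ta <= t <= tb ->
  leb3.-integrable setT (EFin \o (dflux1 u p nu m) ^~ t) /\
  (\int[leb3]_x (dflux1 u p nu m x t)%:E = 0)%E.
Proof.
move=> tJ; have [_ c d] := reg_flux1 ta0 tbT su sp axi nu m.
have ig := integrable_dflux c tJ; split => //.
apply: (@integral_partial1 R ((flux u nu m (B1 u p nu) (fun x => x.1.1)) ^~ t) _ N N0 ig).
- by move=> x; exact: flux_out.
- by move=> x r0; exact: (axis_xcont c r0 tJ).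
- by move=> x r0; exact: d.
Qed.

Lemma integral_dflux2 t : ta <= t <= tb ->
  leb3.-integrable setT (EFin \o (dflux2 u p nu m) ^~ t) /\
  (\int[leb3]_x (dflux2 u p nu m x t)%:E = 0)%E.
Proof.
move=> tJ; have [_ c d] := reg_flux2 ta0 tbT su sp axi nu m.
have ig := integrable_dflux c tJ; split => //.
apply: (@integral_partial2 R ((flux u nu m (B2 u p nu) (fun x => x.1.2)) ^~ t) _ N N0 ig).
- by move=> x; exact: flux_out.
- by move=> x r0; exact: (axis_xcont c r0 tJ).
- by move=> x r0; exact: d.
Qed.

Lemma integral_dflux3 t : ta <= t <= tb ->
  leb3.-integrable setT (EFin \o (dflux3 u nu m) ^~ t) /\
  (\int[leb3]_x (dflux3 u nu m x t)%:E = 0)%E.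
Proof.
move=> tJ; have [_ c d] := reg_flux3 ta0 tbT su axi nu m.
have ig := integrable_dflux c tJ; split => //.
apply: (@integral_partial3 R ((flux u nu m (B3 u nu) (fun x => x.2)) ^~ t) _ N N0 ig).
- by move=> x; exact: flux_out.
- by move=> x r0; exact: (axis_xcont c r0 tJ).
- by move=> x r0; exact: d.
Qed.

Definition energy_cut x t : R := G x t ^+ 2 * rinv x ^+ 3 * q x ^+ 3.
Definition denergy_cut x t : R := 2 * G x t * dtswirl u x t * rinv x ^+ 3 * q x ^+ 3.
(** What is left once the divergence and the squares are removed. The factor - 3 U comes from
    transporting the weight r^-3, the term in [6 * m] from transporting the cutoff; in the viscous
    part, [- (3 / 2)] is what completing the squares leaves, and the rest comes from derivatives of
    q^3. *)
Definition energy_rhs x t : R := G x t ^+ 2 * rinv x ^+ 3 *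
  (- 3 * (x.1.1 * U i0 x t + x.1.2 * U i1 x t) * rinv x ^+ 2 * q x ^+ 3
   - 6 * m * (x.1.1 * U i0 x t + x.1.2 * U i1 x t + x.2 * U i2 x t) * q x ^+ 2
   + nu * (- (3 / 2) * rinv x ^+ 2 * q x ^+ 3 - 12 * m * q x ^+ 2
      + 24 * m ^+ 2 * (x.1.1 ^+ 2 + x.1.2 ^+ 2 + x.2 ^+ 2) * q x)).

Lemma denergy_cut_le x t : ta <= t <= tb ->
  denergy_cut x t <= dflux1 u p nu m x t + dflux2 u p nu m x t + dflux3 u nu m x t + energy_rhs x t.
Proof.
move=> tJ; have tT := in_strip ta0 tbT tJ.
have [r0|r0] := cyl_r_cases x.
  rewrite [dflux1 _ _ _ _ _ _]dflux_axis// [dflux2 _ _ _ _ _ _]dflux_axis//.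
  rewrite [dflux3 _ _ _ _ _]dflux_axis// /denergy_cut /energy_rhs (rinv_axis r0) !expr0n/=.
  by rewrite !(mulr0, mul0r, addr0).
have [th omE] := swirl_axisymmetric tT r0.
have K := @swirl_identity R x.1.1 x.1.2 x.2 (rinv x) m nu (G x t) _ _ _ _ _ _ _ _ _ _ _ _ _
  (p x t) _ _ _ (q x) (rinvE r0) (swirl_pde x tT) omE th (divergence x tT).
move: K; cbv zeta => K.
(* This is 2 nu q^3 |grad Y_2|^2: since Y_2 = r^(-3/2) G, differentiating the weight gives the
   coefficient 3/2. *)
pose D := 2 * nu * rinv x ^+ 3 * q x ^+ 3 *
   ((dswirl u i0 x t - 3 / 2 * G x t * x.1.1 * rinv x ^+ 2) ^+ 2
   + (dswirl u i1 x t - 3 / 2 * G x t * x.1.2 * rinv x ^+ 2) ^+ 2 + dswirl u i2 x t ^+ 2).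
have D0 : 0 <= D.
  by rewrite !mulr_ge0 ?addr_ge0 ?sqr_ge0 ?exprn_ge0 ?rinv_ge0 ?cutoff_ge0 ?(ltW nu0).
suff E : dflux1 u p nu m x t + dflux2 u p nu m x t + dflux3 u nu m x t + energy_rhs x t =
   denergy_cut x t + D.
  by rewrite E lerDl.
rewrite /D /denergy_cut [2 * G x t * dtswirl u x t * rinv x ^+ 3 * q x ^+ 3]K.
rewrite /energy_rhs /dflux1 /dflux2 /dflux3 /dflux /B1 /dB1 /B2 /dB2 /B3 /dB3.
rewrite !bvecs.
move: (dswirl u i0 x t) (dswirl u i1 x t) (dswirl u i2 x t) (ddswirl u i0 x t) (ddswirl u i1 x t)
  (ddswirl u i2 x t) (dpart i0 (U i0) x t) (dpart i1 (U i1) x t) (dpart i2 (U i2) x t)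
  (dpart i0 p x t) (dpart i1 p x t) (p x t) (U i0 x t) (U i1 x t) (U i2 x t) (x.1.1) (x.1.2) (x.2)
  (q x) (rinv x) (G x t) m nu; clear => *; ring.
Qed.

Let cG : cls 2 G. Proof. by have [] := reg_swirl ta0 tbT su axi i0. Qed.
Let cU i : cls 0 (U i). Proof. exact: (cls_smooth ta0 tbT (su i)). Qed.
Let ck n := axis_class_rinvX (R := R) ta tb n.
Let cq n : cls 0 (fun x _ => q x ^+ n). Proof. exact: (cls_cutoff ta0 tbT m n). Qed.
Let c1 := axis_class_coord1 (R := R) ta tb.
Let c2 := axis_class_coord2 (R := R) ta tb.
Let c3 := axis_class_coord3 (R := R) ta0 tbT.
Let cc (c : R) := axis_class_cst ta tb c.

Lemma cls_energy_cut : cls (-1) energy_cut.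
Proof.
have h : cls 1 energy_cut := axis_classM (axis_classM (axis_classM cG cG) (ck 3)) (cq 3).
exact: axis_classW h.
Qed.

Lemma cls_denergy_cut : cls (-1) denergy_cut.
Proof.
have h : cls 0 denergy_cut := axis_classM (axis_classM (axis_classM (axis_classM (cc 2) cG)
  (cls_dtswirl ta0 tbT su)) (ck 3)) (cq 3).
exact: axis_classW h.
Qed.

Lemma cls_energy_rhs : cls (-1) energy_rhs.
Proof.
have g : cls 1 (fun x t => G x t ^+ 2 * rinv x ^+ 3) := axis_classM (axis_classM cG cG) (ck 3).
have h1 : cls 0 (fun x t => x.1.1 * U i0 x t + x.1.2 * U i1 x t).
  by apply: axis_classW (axis_classD (axis_classM c1 (cU i0)) (axis_classM c2 (cU i1))).
have h2 : cls (-2) (fun x t => - 3 * (x.1.1 * U i0 x t + x.1.2 * U i1 x t) * rinv x ^+ 2 * q x ^+ 3).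
  exact: (axis_classM (axis_classM (axis_classM (cc (- 3)) h1) (ck 2)) (cq 3)).
have h3 : cls (-2) (fun x t => 6 * m * (x.1.1 * U i0 x t + x.1.2 * U i1 x t + x.2 * U i2 x t) * q x ^+ 2).
  exact: (axis_classW (isT : (-2 <= 0 :> int)%R)
    (axis_classM (axis_classM (cc (6 * m)) (axis_classD h1 (axis_classM c3 (cU i2)))) (cq 2))).
have h4 : cls (-2) (fun x (_ : R) => nu * (- (3 / 2) * rinv x ^+ 2 * q x ^+ 3 - 12 * m * q x ^+ 2
      + 24 * m ^+ 2 * (x.1.1 ^+ 2 + x.1.2 ^+ 2 + x.2 ^+ 2) * q x)).
  have k1 : cls (-2) (fun x (_ : R) => - (3 / 2) * rinv x ^+ 2 * q x ^+ 3) :=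
    axis_classM (axis_classM (cc (- (3 / 2))) (ck 2)) (cq 3).
  have k2 := axis_classW (isT : (-2 <= 0 :> int)%R) (axis_classM (cc (12 * m)) (cq 2)).
  have s1 : cls 0 (fun x (_ : R) => x.1.1 ^+ 2) by apply: axis_classW (axis_classM c1 c1).
  have s2 : cls 0 (fun x (_ : R) => x.1.2 ^+ 2) by apply: axis_classW (axis_classM c2 c2).
  have s3 : cls 0 (fun x (_ : R) => x.2 ^+ 2) by exact: (axis_classM c3 c3).
  have k3 := axis_classW (isT : (-2 <= 0 :> int)%R)
    (axis_classM (axis_classM (cc (24 * m ^+ 2)) (axis_classD (axis_classD s1 s2) s3)) (cq 1)).
  exact: (axis_classM (cc nu) (axis_classD (cls_sub k1 k2) k3)).
exact: (axis_classM g (axis_classD (cls_sub h2 h3) h4)).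
Qed.

Lemma energy_cut_out x t : ~~ inbox N x -> energy_cut x t = 0.
Proof. by move=> /cutoff_out qx; rewrite /energy_cut qx !expr0n/= !(mulr0, mul0r, addr0). Qed.
Lemma energy_cut_axis x t : cyl_r x = 0 -> energy_cut x t = 0.
Proof. by move=> /rinv_axis kx; rewrite /energy_cut kx !expr0n/= !(mulr0, mul0r). Qed.
Lemma denergy_cut_out x t : ~~ inbox N x -> denergy_cut x t = 0.
Proof. by move=> /cutoff_out qx; rewrite /denergy_cut qx !expr0n/= !(mulr0, mul0r, addr0). Qed.
Lemma denergy_cut_axis x t : cyl_r x = 0 -> denergy_cut x t = 0.
Proof. by move=> /rinv_axis kx; rewrite /denergy_cut kx !expr0n/= !(mulr0, mul0r). Qed.
Lemma energy_rhs_out x t : ~~ inbox N x -> energy_rhs x t = 0.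
Proof. by move=> /cutoff_out qx; rewrite /energy_rhs qx !expr0n/= !(mulr0, mul0r, addr0, subr0). Qed.
Lemma energy_rhs_axis x t : cyl_r x = 0 -> energy_rhs x t = 0.
Proof. by move=> /rinv_axis kx; rewrite /energy_rhs kx !expr0n/= !(mulr0, mul0r). Qed.

Lemma integral_denergy_cut_le t : ta <= t <= tb ->
  \int[leb3]_x denergy_cut x t <= \int[leb3]_x energy_rhs x t.
Proof.
move=> tJ.
have id := cls_integrable cls_denergy_cut denergy_cut_out denergy_cut_axis tJ.
have ir := cls_integrable cls_energy_rhs energy_rhs_out energy_rhs_axis tJ.
have [i1' z1] := integral_dflux1 tJ; have [i2' z2] := integral_dflux2 tJ.
have [i3' z3] := integral_dflux3 tJ.
have i12 : leb3.-integrable setT (EFin \o (fun x => dflux1 u p nu m x t + dflux2 u p nu m x t)).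
  exact: (integrableD measurableT i1' i2').
have i123 : leb3.-integrable setT
    (EFin \o (fun x => dflux1 u p nu m x t + dflux2 u p nu m x t + dflux3 u nu m x t)).
  exact: (integrableD measurableT i12 i3').
have i4 : leb3.-integrable setT
    (EFin \o (fun x => dflux1 u p nu m x t + dflux2 u p nu m x t + dflux3 u nu m x t + energy_rhs x t)).
  exact: (integrableD measurableT i123 ir).
apply: (@le_trans _ _ (\int[leb3]_x
  (dflux1 u p nu m x t + dflux2 u p nu m x t + dflux3 u nu m x t + energy_rhs x t))).
  by apply: le_Rintegral => // x _; exact: denergy_cut_le.
rewrite (RintegralD measurableT i123 ir) (RintegralD measurableT i12 i3').
rewrite (RintegralD measurableT i1' i2').
by rewrite /Rintegral z1 z2 z3 !add0r.
Qed.

End energy.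
End balance.

(** * Dependence on time *)

Section time.
Context {R : realType}.
Variables (ta tb : R).
Local Notation cls := (axis_class ta tb).
Local Notation leb3 := (@leb3 R).
Local Notation mu := (@lebesgue_measure R).

Lemma itvW (t : R) : t \in `]ta, tb[ -> ta <= t <= tb.
Proof. by rewrite in_itv/= => /andP[/ltW -> /ltW ->]. Qed.

Lemma cls_integral_continuous (f : R3 R -> R -> R) (N : R) : 0 < N -> cls (-1) f ->
  (forall x t, ~~ inbox N x -> f x t = 0) -> (forall x t, cyl_r x = 0 -> f x t = 0) ->
  {in `]ta, tb[, continuous (fun t => \int[leb3]_x f x t)}.
Proof.
move=> N0 cf f1 f2.
have [C C0 hC] := cls_dominated cf f1 f2.
move=> t tJ.
apply: (@continuity_under_integral R _ _ leb3 (fun t x => f x t) setT measurableT ta tb _ _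
  (fun x => C * box_rinv N x)) => //.
- move=> s sJ; apply: (cls_integrable cf f1 f2).
  by apply: itvW.
- apply: aeW => x _ s sJ.
  by apply: (axis_tcont cf); apply: itvW; move: sJ; rewrite inE.
- exact: integrable_box_rinv.
- by move=> s sJ; apply: aeW => x _; apply: hC; apply: itvW.
- by rewrite inE.
Qed.

Lemma cls_integral_derive (f g : R3 R -> R -> R) (N : R) : 0 < N -> cls (-1) f -> cls (-1) g ->
  (forall x t, ~~ inbox N x -> f x t = 0) -> (forall x t, cyl_r x = 0 -> f x t = 0) ->
  (forall x t, ~~ inbox N x -> g x t = 0) -> (forall x t, cyl_r x = 0 -> g x t = 0) ->
  (forall x t, t \in `]ta, tb[ -> is_derive t 1 (f x) (g x t)) ->
  forall t, t \in `]ta, tb[ ->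
    is_derive t 1 (fun t => \int[leb3]_x f x t) (\int[leb3]_x g x t).
Proof.
move=> N0 cf cg f1 f2 g1 g2 dfg t tJ.
have [C C0 hC] := cls_dominated cg g1 g2.
have E s x : s \in `]ta, tb[ -> partial1of2 (fun t x => f x t) s x = g x s.
  by move=> sJ; rewrite partial1of2E; have [_ ->] := dfg x s sJ.
have h1 s : `]ta, tb[%classic s -> leb3.-integrable setT (EFin \o (fun x => f x s)).
  by move=> sJ; apply: (cls_integrable cf f1 f2); exact: itvW.
have h2 s x : `]ta, tb[%classic s -> setT x -> derivable (fun t => f x t) s 1.
  by move=> sJ _; have [] := dfg x s sJ.
have h3 x : 0 <= C * box_rinv N x by rewrite mulr_ge0// box_rinv_ge0.
have h4 : leb3.-integrable setT (EFin \o (fun x => C * box_rinv N x)) by exact: integrable_box_rinv.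
have h5 s x : `]ta, tb[%classic s -> setT x ->
    `|partial1of2 (fun t x => f x t) s x| <= C * box_rinv N x.
  by move=> sJ _; rewrite E//; apply: hC; exact: itvW.
split.
  exact: (@derivable_under_integral R _ _ leb3 (fun t x => f x t) setT measurableT t ta tb tJ
    h1 h2 (fun x => C * box_rinv N x) h3 h4 h5).
rewrite -derive1E.
rewrite (@differentiation_under_integral R _ _ leb3 (fun t x => f x t) setT measurableT t ta tb tJ
    h1 h2 (fun x => C * box_rinv N x) h3 h4 h5).
by apply: eq_Rintegral => x _; rewrite E.
Qed.

Lemma cutoff_mono (n k : nat) x : (n <= k)%N ->
  cutoff (n.+1%:R ^- 2) x <= cutoff (k.+1%:R ^- 2) x :> R.
Proof.
move=> nk; rewrite /cutoff ge_max !le_max lexx/= orbC lerD2l lerN2 ler_wpM2r//.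
  by rewrite !addr_ge0 ?sqr_ge0.
by rewrite lef_pV2 ?posrE ?exprn_gt0// lerXn2r ?nnegrE// ler_nat.
Qed.

Lemma cutoff_cvg (x : R3 R) : cutoff (n.+1%:R ^- 2) x @[n --> \oo] --> (1 : R).
Proof.
set S := x.1.1 ^+ 2 + x.1.2 ^+ 2 + x.2 ^+ 2.
have h : (fun n : nat => n.+1%:R ^- 2 * S) @ \oo --> (0 : R).
  rewrite -[0](mul0r S); apply: cvgMl.
  under eq_fun do rewrite -exprVn expr2.
  rewrite -[0](mulr0 0); apply: cvgM; exact: cvg_harmonic.
have h' : (fun n : nat => 1 - n.+1%:R ^- 2 * S) @ \oo --> (1 - 0 : R).
  by apply: cvgB => //; exact: cvg_cst.
have cm : continuous (fun s : R => Num.max 0 s).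
  by move=> s; apply: continuous_max; [exact: cvg_cst|exact: cvg_id].
have := cvg_comp _ _ h' (cm _).
by rewrite subr0 max_r.
Qed.

Lemma cutoff_integral_cvg (h : R3 R -> R) : measurable_fun setT h -> (forall x, 0 <= h x) ->
  (\int[leb3]_x (h x * cutoff (n.+1%:R ^- 2) x ^+ 3)%:E)%E @[n --> \oo] -->
  (\int[leb3]_x (h x)%:E)%E.
Proof.
move=> mh h0.
have -> : (\int[leb3]_x (h x)%:E =
    \int[leb3]_x (limn (fun n => (h x * cutoff (n.+1%:R ^- 2) x ^+ 3)%:E)))%E.
  apply: eq_integral => x _; apply/esym/cvg_lim => //.
  apply: cvg_EFin; first by near=> n.
  rewrite -[X in _ --> X]mulr1; apply: cvgM; first exact: cvg_cst.
  rewrite -[X in _ --> X](expr1n _ 3).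
  exact: (cvg_comp _ _ (cutoff_cvg x) (@exprn_continuous R 3 1)).
apply: cvg_monotone_convergence => //.
- move=> n; apply/measurable_EFinP; apply: measurable_funM => //.
  by apply: measurable_funX; apply: continuous_measurable_R3; exact: cutoff_continuous.
- by move=> n x _; rewrite lee_fin mulr_ge0// exprn_ge0// cutoff_ge0.
- move=> x _ n k nk; rewrite lee_fin ler_wpM2l// lerXn2r ?nnegrE ?cutoff_ge0//.
  exact: cutoff_mono.
Unshelve. all: end_near. Qed.

Variable T : R.
Hypotheses (ta0 : 0 < ta) (tbT : tb < T).

Lemma cls_cut (h : R3 R -> R -> R) (N : R) d : cls d h ->
  cls d (fun x t => h x t * cutoff (N ^- 2) x ^+ 3).
Proof.
by move=> ch; have := axis_classM ch (cls_cutoff ta0 tbT (N ^- 2) 3); rewrite addr0.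
Qed.

Lemma cls_cut_out (h : R3 R -> R -> R) (N : R) x t : 0 < N -> ~~ inbox N x ->
  h x t * cutoff (N ^- 2) x ^+ 3 = 0.
Proof. by move=> N0 xN; rewrite (cutoff_out N0 xN) expr0n mulr0. Qed.

(** The integral over all of space may be infinite at some times. It is the limit of truncated
    integrals, which are finite and continuous in time. *)
Lemma measurable_cls_integral (h : R3 R -> R -> R) : cls (-1) h ->
  (forall x t, 0 <= h x t) -> (forall x t, cyl_r x = 0 -> h x t = 0) ->
  measurable_fun `]ta, tb[ (fun t => \int[leb3]_x (h x t)%:E)%E.
Proof.
move=> ch h0 h2.
apply: (@emeasurable_fun_cvg _ _ _ _
  (fun n t => (\int[leb3]_x (h x t * cutoff (n.+1%:R ^- 2) x ^+ 3)%:E)%E)); last first.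
  move=> t tJ; apply: cutoff_integral_cvg => //.
  by apply: (axis_meas ch); exact: itvW.
move=> n.
have n0 : 0 < n.+1%:R :> R by [].
have cn := cls_cut n.+1%:R ch.
have f1 x t := @cls_cut_out h n.+1%:R x t n0.
have f2 x t : cyl_r x = 0 -> h x t * cutoff (n.+1%:R ^- 2) x ^+ 3 = 0.
  by move=> r0; rewrite h2// mul0r.
apply: (@eq_measurable_fun _ _ _ _ _ (EFin \o (fun t => \int[leb3]_x (h x t * cutoff (n.+1%:R ^- 2) x ^+ 3)))).
  move=> t; rewrite inE => tJ /=; rewrite /Rintegral fineK//.
  have ii := cls_integrable cn f1 f2 (itvW tJ).
  exact: integrable_fin_num ii.
apply/measurable_EFinP; apply: open_continuous_measurable_fun; first exact: interval_open.
by move=> t; rewrite inE => tJ; apply: (cls_integral_continuous n0 cn f1 f2).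
Qed.

End time.

(** * Comparison of integrals and Gronwall's lemma *)

Section monotone.
Context d (X : measurableType d) {R : realType} (m : {measure set X -> \bar R}).

(** The integral of a nonnegative function is a supremum over the simple functions below it, so
    enlarging the function and the domain enlarges the family. *)
Lemma ge0_le_integral_sub (A B : set X) (f g : X -> \bar R) : A `<=` B ->
  (forall x, 0 <= f x)%E -> (forall x, 0 <= g x)%E -> (forall x, A x -> f x <= g x)%E ->
  (\int[m]_(x in A) f x <= \int[m]_(x in B) g x)%E.
Proof.
move=> AB f0 g0 fg; rewrite integral_mkcond [leRHS]integral_mkcond.
rewrite !ge0_integralTE; last 2 first.
- by move=> x; apply: erestrict_ge0.
- by move=> x; apply: erestrict_ge0.
apply: le_ereal_sup => _ [h hf <-]; exists h => // x.
apply: le_trans (hf x) _; rewrite !patchE.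
case: ifPn => [|xA]; first by rewrite inE => xA; rewrite mem_set ?fg//; exact: AB.
by case: ifP.
Qed.
End monotone.

Section gronwall.
Context {R : realType}.
Local Notation mu := (@lebesgue_measure R).
Variables (a b : R) (f f' g : R -> R) (K : R).
Hypothesis K0 : 0 <= K.
Hypothesis df : forall t, t \in `]a, b[ -> is_derive t 1 f (f' t).
Hypothesis cf' : {in `]a, b[, continuous f'}.
Hypothesis cg : {in `]a, b[, continuous g}.

Lemma sub_itv (s t x : R) : s \in `]a, b[ -> t \in `]a, b[ -> x \in `[s, t] -> x \in `]a, b[.
Proof.
rewrite !in_itv/= => /andP[sa _] /andP[_ tb] /andP[sx xt].
by rewrite (lt_le_trans sa sx) (le_lt_trans xt tb).
Qed.

Lemma derive_continuous_in : {in `]a, b[, continuous f}.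
Proof.
move=> t tJ; apply: differentiable_continuous; apply/derivable1_diffP.
by have [] := df tJ.
Qed.

Lemma integrable_in (h : R -> R) (s t : R) : {in `]a, b[, continuous h} ->
  s \in `]a, b[ -> t \in `]a, b[ -> mu.-integrable `[s, t] (EFin \o h).
Proof.
by move=> ch sJ tJ; apply: continuous_itv_integrable => x xst; apply: ch; exact: sub_itv sJ tJ xst.
Qed.

Lemma gronwall (s t : R) : s <= t -> s \in `]a, b[ -> t \in `]a, b[ ->
  (forall x, x \in `[s, t] -> 0 <= g x) ->
  (forall x, x \in `[s, t] -> f' x <= K * f x + g x) ->
  f t <= expR (K * (t - s)) * (f s + \int[mu]_(x in `[s, t]) g x).
Proof.
rewrite le_eqVlt => /predU1P[<- _ _ _ _|st sJ tJ g0 fg].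
  by rewrite subrr mulr0 expR0 mul1r set_itv1 Rintegral_set1 addr0.
pose e (x : R) := expR (- (K * (x - s))).
have de (x : R) : is_derive x 1 e (- K * e x).
  have h1 : is_derive x 1 (fun x : R => - (K * (x - s))) (- K).
    have h : is_derive x 1 (fun x : R => - (K * (x - s))) _ :=
      is_deriveN (is_deriveZ K (is_deriveB (is_derive_id x 1) (is_derive_cst (s : R) x 1))).
    by apply: is_derive_eq h _; rewrite /GRing.scale/= subr0 mulr1.
  exact: is_derive_comp1 h1 (is_derive_expR _).
have ce : continuous e.
  by move=> x; apply: differentiable_continuous; apply/derivable1_diffP; have [] := de x.
pose F x := f x * e x.
pose F' x := (f' x - K * f x) * e x.
have dF x : x \in `[s, t] -> is_derive x 1 F (F' x).
  move=> xI.
  have h : is_derive x 1 F _ := is_deriveM (df (sub_itv sJ tJ xI)) (de x).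
  by apply: is_derive_eq h _; rewrite /F' /GRing.scale/=; ring.
have cF' x : x \in `[s, t] -> {for x, continuous F'}.
  move=> xI; have xJ := sub_itv sJ tJ xI.
  apply: cvgM; last exact: ce.
  apply: cvgB; first exact: cf'.
  by apply: cvgM; [exact: cvg_cst|exact: derive_continuous_in].
have E : \int[mu]_(x in `[s, t]) F' x = F t - F s.
  by rewrite /Rintegral (integral_antiderivative (ltW st) dF cF').
have iF' := continuous_itv_integrable cF'.
have ig := integrable_in cg sJ tJ.
have le : \int[mu]_(x in `[s, t]) F' x <= \int[mu]_(x in `[s, t]) g x.
  apply: le_Rintegral => // x xI.
  (* Together with [g0] this removes the integrating factor from the integral of [g]; it uses K >=
     0. *)
  have e1 : e x <= 1.
    rewrite /e -expR0 ler_expR oppr_le0 mulr_ge0// subr_ge0.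
    by move: xI; rewrite /= in_itv/= => /andP[].
  apply: (@le_trans _ _ (g x * e x)).
    by rewrite /F' ler_wpM2r ?expR_ge0// lerBlDl fg.
  by rewrite ler_piMr// g0.
rewrite E /F /e subrr mulr0 oppr0 expR0 mulr1 in le.
rewrite -ler_pdivrMl ?expR_gt0// -expRN.
by rewrite mulrC -lerBlDl.
Qed.

End gronwall.

(** * Differential inequalities for the truncated energy *)

Section estimates.
Context {R : realType}.
Variables (T ta tb nu M : R) (u : R3 R -> R -> R3 R) (p : R3 R -> R -> R).
Hypotheses (ta0 : 0 < ta) (tbT : tb < T).
Hypothesis ns : navier_stokes nu T u p.
Hypothesis axi : axisymmetric T u.
Hypothesis nu0 : 0 < nu.
Hypothesis M0 : 0 <= M.
Hypothesis uM : forall x t, ta <= t <= tb -> sqnorm (u x t) <= M ^+ 2.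
Local Notation cls := (axis_class ta tb).
Local Notation U := (ucomp u).
Local Notation leb3 := (@leb3 R).
Local Notation mu := (@lebesgue_measure R).
Local Notation G := (swirl u).

Let su i : smooth_in 4 T (U i). Proof. by case: ns => h _ _ _; exact: smooth_on_in. Qed.

Definition gradsq x t : R := \sum_(i < 3) \sum_(j < 3) (dpart j (U i) x t) ^+ 2.
(* The last factor makes it vanish on the axis, where the smooth [gradsq] need not. *)
Definition gradsq_off x t : R := gradsq x t * (rinv x * cyl_r x).
Definition urad x t : R := x.1.1 * U i0 x t + x.1.2 * U i1 x t.
Definition ysq x t : R := G x t ^+ 2 * rinv x ^+ 3.
Definition uysq x t : R := ysq x t * urad x t * rinv x ^+ 2.

Lemma gradsq_ge0 x t : 0 <= gradsq x t.
Proof. by apply: sumr_ge0 => i _; apply: sumr_ge0 => j _; rewrite sqr_ge0. Qed.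

Lemma rinv_cyl_r x : 0 < cyl_r x -> rinv x * cyl_r x = 1 :> R.
Proof. by move=> r0; rewrite /rinv mulVf// gt_eqF. Qed.

Lemma gradsq_off_ge0 x t : 0 <= gradsq_off x t.
Proof. by rewrite !mulr_ge0 ?gradsq_ge0 ?rinv_ge0 ?cyl_r_ge0. Qed.

Lemma gradsq_off_le x t : gradsq_off x t <= gradsq x t.
Proof.
rewrite /gradsq_off; have [r0|r0] := cyl_r_cases x; first by rewrite r0 !mulr0 gradsq_ge0.
by rewrite rinv_cyl_r// mulr1.
Qed.

Lemma ysq_ge0 x t : 0 <= ysq x t.
Proof. by rewrite mulr_ge0 ?sqr_ge0 ?exprn_ge0 ?rinv_ge0. Qed.

Lemma sqnormE (v : R3 R) : sqnorm v = v.1.1 ^+ 2 + v.1.2 ^+ 2 + v.2 ^+ 2.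
Proof. by rewrite /sqnorm dotE !expr2. Qed.

(** Cauchy-Schwarz on the formulas of [axisymmetric_derive], the defect being an explicit sum of
    squares. It is a pointwise form of Hardy's inequality: the gradient controls the horizontal
    velocity divided by r. *)
Lemma horizontal_le x t : ta <= t <= tb -> 0 < cyl_r x ->
  U i0 x t ^+ 2 + U i1 x t ^+ 2 <= (x.1.1 ^+ 2 + x.1.2 ^+ 2) * gradsq x t.
Proof.
move=> tJ r0; have [] := axisymmetric_derive axi (su1 su) (in_strip ta0 tbT tJ) r0.
rewrite -ucomp0E -ucomp1E /gradsq !sum3 => -> ->.
move: (dpart i0 (U i0) x t) (dpart i1 (U i0) x t) (dpart i2 (U i0) x t)
  (dpart i0 (U i1) x t) (dpart i1 (U i1) x t) (dpart i2 (U i1) x t)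
  (dpart i0 (U i2) x t) (dpart i1 (U i2) x t) (dpart i2 (U i2) x t) (x.1.1) (x.1.2).
clear => d00 d10 d20 d01 d11 d21 d02 d12 d22 a b; rewrite -subr_ge0.
have -> : (a ^+ 2 + b ^+ 2) * (d00 ^+ 2 + d10 ^+ 2 + d20 ^+ 2 +
    (d01 ^+ 2 + d11 ^+ 2 + d21 ^+ 2) + (d02 ^+ 2 + d12 ^+ 2 + d22 ^+ 2)) -
    ((a * d11 - b * d01) ^+ 2 + (b * d00 - a * d10) ^+ 2) =
  (a * d01 + b * d11) ^+ 2 + (a * d00 + b * d10) ^+ 2 +
  (a ^+ 2 + b ^+ 2) * (d20 ^+ 2 + d21 ^+ 2 + (d02 ^+ 2 + d12 ^+ 2 + d22 ^+ 2)) by ring.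
apply: addr_ge0; first by rewrite addr_ge0 ?sqr_ge0.
by apply: mulr_ge0; rewrite !addr_ge0 ?sqr_ge0.
Qed.

Lemma swirl_urad x t : 0 < cyl_r x ->
  (G x t * rinv x) ^+ 2 + (urad x t * rinv x) ^+ 2 = U i0 x t ^+ 2 + U i1 x t ^+ 2.
Proof.
move=> /rinvE kE; rewrite -[RHS]mul1r -kE /swirl /urad.
by move: (U i0 x t) (U i1 x t) (x.1.1) (x.1.2) (rinv x); clear => *; ring.
Qed.

Lemma horizontal_le_sqnorm x t : U i0 x t ^+ 2 + U i1 x t ^+ 2 <= sqnorm (u x t).
Proof. by rewrite sqnormE -ucomp0E -ucomp1E -ucomp2E lerDl sqr_ge0. Qed.

Lemma swirl_rinv_le x t : ta <= t <= tb -> 0 < cyl_r x ->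
  G x t ^+ 2 * rinv x ^+ 4 <= gradsq x t.
Proof.
move=> tJ r0; rewrite (exprD _ 2 2) mulrA -exprMn -[leRHS]mul1r -(rinvE r0) -mulrA mulrC.
rewrite ler_wpM2l ?sqr_ge0//; apply: le_trans (horizontal_le tJ r0).
by rewrite -(swirl_urad t r0) lerDl sqr_ge0.
Qed.

Lemma swirl_rinv2_le x t : 0 < cyl_r x -> G x t ^+ 2 * rinv x ^+ 2 <= sqnorm (u x t).
Proof.
move=> r0; apply: le_trans (horizontal_le_sqnorm x t).
by rewrite -exprMn -(swirl_urad t r0) lerDl sqr_ge0.
Qed.

Lemma urad_rinv_le x t : ta <= t <= tb -> 0 < cyl_r x ->
  urad x t ^+ 2 * rinv x ^+ 2 <= M ^+ 2.
Proof.
move=> tJ r0; apply: le_trans (uM x tJ); apply: le_trans (horizontal_le_sqnorm x t).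
by rewrite -exprMn -(swirl_urad t r0) lerDr sqr_ge0.
Qed.

Lemma ysq_axis x t : cyl_r x = 0 -> ysq x t = 0.
Proof. by move=> /rinv_axis kx; rewrite /ysq kx expr0n/= mulr0. Qed.

Lemma uysq_axis x t : cyl_r x = 0 -> uysq x t = 0.
Proof. by move=> /ysq_axis h; rewrite /uysq h !mul0r. Qed.

(** |Y_2|^2 is the geometric mean of (u^theta)^2 and (u^theta / r)^2; the first is bounded by the
    energy density and the second by the squared gradient. *)
Lemma ysq_le x t : ta <= t <= tb -> ysq x t <= 2^-1 * (sqnorm (u x t) + gradsq_off x t).
Proof.
move=> tJ; have [r0|r0] := cyl_r_cases x.
  rewrite ysq_axis// mulr_ge0// addr_ge0 ?gradsq_off_ge0//.
  by rewrite sqnormE !addr_ge0 ?sqr_ge0.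
have h1 := swirl_rinv_le tJ r0; have h2 := swirl_rinv2_le t r0.
rewrite /gradsq_off rinv_cyl_r// mulr1 /ysq.
apply: (@le_trans _ _ (2^-1 * (G x t ^+ 2 * rinv x ^+ 2 + G x t ^+ 2 * rinv x ^+ 4))); last first.
  by rewrite ler_wpM2l// lerD.
rewrite -subr_ge0.
have -> : 2^-1 * (G x t ^+ 2 * rinv x ^+ 2 + G x t ^+ 2 * rinv x ^+ 4) - G x t ^+ 2 * rinv x ^+ 3
  = 2^-1 * (G x t * rinv x * (1 - rinv x)) ^+ 2.
  by move: (G x t) (rinv x); move=> *; field.
by rewrite mulr_ge0 ?sqr_ge0.
Qed.

(** U |Y_2|^2 equals u^r (u^theta / r)^2, so the gradient absorbs all the negative powers of r and
    u^r costs only the sup bound. *)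
Lemma uysq_le x t : ta <= t <= tb -> `|uysq x t| <= M * gradsq_off x t.
Proof.
move=> tJ; have [r0|r0] := cyl_r_cases x.
  by rewrite uysq_axis// normr0 mulr_ge0// gradsq_off_ge0.
have h1 := swirl_rinv_le tJ r0; have h2 := urad_rinv_le tJ r0.
rewrite /gradsq_off rinv_cyl_r// mulr1 /uysq /ysq.
have -> : G x t ^+ 2 * rinv x ^+ 3 * urad x t * rinv x ^+ 2 =
  (urad x t * rinv x) * (G x t ^+ 2 * rinv x ^+ 4) by move: (G x t) (rinv x) (urad x t); clear => *; ring.
rewrite normrM; apply: ler_pM => //.
  rewrite -(ler_pXn2r (ltn0Sn 1)) ?nnegrE//.
  by rewrite (real_normK (num_real _)) exprMn.
by rewrite ger0_norm// mulr_ge0 ?sqr_ge0// exprn_ge0// rinv_ge0.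
Qed.

(** The maximum over k = 1/r of 3 M k - (3/2) nu k^2, attained at k = M / nu. *)
Definition rate : R := 3 / 2 * M ^+ 2 / nu.

Lemma rate_ge0 : 0 <= rate.
Proof. by rewrite /rate !mulr_ge0 ?sqr_ge0// invr_ge0 ltW. Qed.

(** The first term bounds the transport of the cutoff, 6 N^-2 |x . u| with |x| <= N; the second
    bounds the diffusive term 24 nu N^-4 |x|^2. *)
Definition slack (N : R) : R := 6 * M / N + 24 * nu / N ^+ 2.

Section cutoff_estimates.
Variable N : R.
Hypothesis N0 : 0 < N.
Local Notation q := (cutoff (N ^- 2)).
Local Notation en := (energy_cut u N).
Local Notation rhs := (energy_rhs nu u N).

Definition ysq_cut x t : R := ysq x t * q x.
Definition uysq_cut x t : R := uysq x t * q x ^+ 3.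

Lemma slack_ge0 : 0 <= slack N.
Proof. by rewrite addr_ge0// !mulr_ge0 ?invr_ge0 ?exprn_ge0// ltW. Qed.

Lemma rhs_le x t : ta <= t <= tb ->
  rhs x t <= ysq x t * (- 3 * urad x t * rinv x ^+ 2 * q x ^+ 3
     - 3 / 2 * nu * rinv x ^+ 2 * q x ^+ 3) + slack N * ysq_cut x t.
Proof.
move=> tJ; rewrite /energy_rhs -/(urad x t) -/(ysq x t) /ysq_cut.
rewrite [slack N * _]mulrCA -mulrDr ler_wpM2l ?ysq_ge0//.
have [q0|q0] := lerP (q x) 0.
  have -> : q x = 0 by apply/eqP; rewrite eq_le q0 cutoff_ge0.
  by rewrite !expr0n/= !mulr0 !(subr0, addr0, mulr0).
have q1 := cutoff_le1 N0 x; have hs := cutoff_support q0.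
have m0 : 0 <= N ^- 2 by rewrite invr_ge0 exprn_ge0// ltW.
set S := x.1.1 ^+ 2 + x.1.2 ^+ 2 + x.2 ^+ 2 in hs *.
have S0 : 0 <= S by rewrite /S !addr_ge0 ?sqr_ge0.
(* [D] is the scalar product of x and u; on the support of the cutoff |x| <= N, and Lagrange's
   identity gives Cauchy-Schwarz. *)
set D := urad x t + x.2 * U i2 x t.
have hD : `|D| <= N * M.
  have hSN : S <= N ^+ 2.
    by move: hs; rewrite mulrC ltr_pdivrMr ?exprn_gt0// mul1r => /ltW.
  rewrite -(ler_pXn2r (ltn0Sn 1)) ?nnegrE ?mulr_ge0 ?(ltW N0)//.
  rewrite (real_normK (num_real _)) exprMn.
  apply: (@le_trans _ _ (S * sqnorm (u x t))).
    rewrite /D /S /urad sqnormE -ucomp0E -ucomp1E -ucomp2E.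
    move: (U i0 x t) (U i1 x t) (U i2 x t) (x.1.1) (x.1.2) (x.2); clear => v0 v1 v2 a b c.
    rewrite -subr_ge0.
    have -> : (a ^+ 2 + b ^+ 2 + c ^+ 2) * (v0 ^+ 2 + v1 ^+ 2 + v2 ^+ 2) - (a * v0 + b * v1 + c * v2) ^+ 2
      = (a * v1 - b * v0) ^+ 2 + (a * v2 - c * v0) ^+ 2 + (b * v2 - c * v1) ^+ 2 by ring.
    by rewrite !addr_ge0 ?sqr_ge0.
  apply: ler_pM => //; last exact: uM.
  by rewrite sqnormE !addr_ge0 ?sqr_ge0.
have q2 : q x ^+ 2 <= q x by rewrite expr2 ler_piMr// ltW.
have t1 : - (6 * N ^- 2 * D * q x ^+ 2) <= 6 * M / N * q x.
  apply: (@le_trans _ _ (6 * N ^- 2 * (N * M) * q x ^+ 2)).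
    rewrite -mulNr -mulrN ler_wpM2r ?sqr_ge0// ler_wpM2l ?mulr_ge0//.
    by rewrite lerNl; move: hD; rewrite ler_norml => /andP[].
  have -> : 6 * N ^- 2 * (N * M) = 6 * M / N by field; rewrite gt_eqF.
  by rewrite ler_wpM2l// !mulr_ge0// invr_ge0 ltW.
have t2 : 24 * (N ^- 2) ^+ 2 * S * q x <= 24 * N ^- 2 * q x.
  rewrite ler_wpM2r ?(ltW q0)// expr2 -!mulrA ler_wpM2l// ler_piMr//.
  by rewrite mulrC -[X in X <= _]mulrC; exact: ltW.
have t3 : 0 <= 12 * N ^- 2 * q x ^+ 2 by apply: mulr_ge0; [apply: mulr_ge0 => //|exact: sqr_ge0].
have t4 : nu * (- (12 * N ^- 2 * q x ^+ 2) + 24 * (N ^- 2) ^+ 2 * S * q x) <= nu * (24 * N ^- 2 * q x).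
  rewrite ler_wpM2l ?(ltW nu0)//; apply: le_trans t2.
  by rewrite gerDr oppr_le0.
rewrite -/D.
have -> : - 3 * urad x t * rinv x ^+ 2 * q x ^+ 3 - 6 * N ^- 2 * D * q x ^+ 2 +
    nu * (- (3 / 2) * rinv x ^+ 2 * q x ^+ 3 - 12 * N ^- 2 * q x ^+ 2 +
    24 * (N ^- 2) ^+ 2 * S * q x) =
  (- 3 * urad x t * rinv x ^+ 2 * q x ^+ 3 - 3 / 2 * nu * rinv x ^+ 2 * q x ^+ 3) +
  (- (6 * N ^- 2 * D * q x ^+ 2)
   + nu * (- (12 * N ^- 2 * q x ^+ 2) + 24 * (N ^- 2) ^+ 2 * S * q x)).
  clearbody D S; move: (urad x t) (rinv x) (q x) (N ^- 2); clear => *; ring.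
rewrite lerD2l.
have -> : slack N * q x = 6 * M / N * q x + nu * (24 * N ^- 2 * q x).
  by rewrite /slack; move: (q x) (N ^- 2) (6 * M / N); clear => *; ring.
exact: lerD.
Qed.

(* Young's inequality, completing the square in [rinv * (urad + nu)]. *)
Lemma rhs_le_rate x t : ta <= t <= tb ->
  rhs x t <= rate * en x t + slack N * ysq_cut x t.
Proof.
move=> tJ; apply: le_trans (rhs_le x tJ) _; rewrite lerD2r.
rewrite /energy_cut -/(ysq x t) [rate * _]mulrCA ler_wpM2l ?ysq_ge0//.
rewrite -mulrBl ler_wpM2r ?exprn_ge0 ?cutoff_ge0//.
have [r0|r0] := cyl_r_cases x.
  by rewrite (rinv_axis r0) expr0n/= !mulr0 subr0 rate_ge0.
have h := urad_rinv_le tJ r0.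
apply: (@le_trans _ _ (3 / 2 / nu * (urad x t ^+ 2 * rinv x ^+ 2))); last first.
  have -> : rate = 3 / 2 / nu * M ^+ 2 by rewrite /rate mulrAC.
  by rewrite ler_wpM2l// !mulr_ge0// invr_ge0 ltW.
rewrite -subr_ge0.
have -> : 3 / 2 / nu * (urad x t ^+ 2 * rinv x ^+ 2) -
    (- 3 * urad x t * rinv x ^+ 2 - 3 / 2 * nu * rinv x ^+ 2) =
    3 / 2 / nu * (rinv x * (urad x t + nu)) ^+ 2.
  have nn : nu != 0 by rewrite gt_eqF.
  by move: (urad x t) (rinv x) => *; field.
apply: mulr_ge0; last exact: sqr_ge0.
by rewrite divr_ge0 ?(ltW nu0)//.
Qed.

(** The viscous remainder is discarded because of its sign, not spent on the drift as in
    [rhs_le_rate]; the drift keeps its exact coefficient 3. *)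
Lemma rhs_le_uysq x t : ta <= t <= tb ->
  rhs x t <= - 3 * uysq_cut x t + slack N * ysq_cut x t.
Proof.
move=> tJ; apply: le_trans (rhs_le x tJ) _; rewrite lerD2r /uysq_cut /uysq.
have -> : - 3 * (ysq x t * urad x t * rinv x ^+ 2 * q x ^+ 3) =
  ysq x t * (- 3 * urad x t * rinv x ^+ 2 * q x ^+ 3).
  by move: (ysq x t) (urad x t) (rinv x) (q x); clear => *; ring.
rewrite ler_wpM2l ?ysq_ge0// gerBl.
by rewrite !mulr_ge0 ?exprn_ge0 ?rinv_ge0 ?cutoff_ge0 ?(ltW nu0).
Qed.

End cutoff_estimates.

Let cG : cls 2 G. Proof. by have [] := reg_swirl ta0 tbT su axi i0. Qed.
Let cU i : cls 0 (U i). Proof. exact: (cls_smooth ta0 tbT (su i)). Qed.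

Lemma cls_cyl_r : cls 1 (fun x _ => cyl_r x).
Proof.
apply: axis_class_steady.
- by move=> N; exists 1 => // x t _ r0 _; rewrite mul1r expr1z ger0_norm ?cyl_r_ge0.
- by move=> x _; exact: cyl_r_continuous.
- by apply: continuous_measurable_R3; exact: cyl_r_continuous.
Qed.

Lemma cls_ysq1 : cls 1 ysq.
Proof. exact: (axis_classM (axis_classM cG cG) (axis_class_rinvX ta tb 3)). Qed.

Lemma cls_ysq : cls (-1) ysq.
Proof. exact: axis_classW cls_ysq1. Qed.

Lemma cls_urad : cls 1 urad.
Proof.
have c1 := axis_class_coord1 (R := R) ta tb; have c2 := axis_class_coord2 (R := R) ta tb.
exact: (axis_classD (axis_classM c1 (cU i0)) (axis_classM c2 (cU i1))).
Qed.

Lemma cls_uysq : cls (-1) uysq.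
Proof.
have h : cls 0 uysq := axis_classM (axis_classM cls_ysq1 cls_urad) (axis_class_rinvX ta tb 2).
exact: axis_classW h.
Qed.

Lemma cls_gradsq_off : cls (-1) gradsq_off.
Proof.
have cd i j : cls 0 (fun x t => dpart j (U i) x t ^+ 2).
  have c := cls_smooth ta0 tbT (sdu su i j); exact: (axis_classM c c).
have cg : cls 0 gradsq.
  have -> : gradsq = (fun x t =>
      (dpart i0 (U i0) x t ^+ 2 + dpart i1 (U i0) x t ^+ 2 + dpart i2 (U i0) x t ^+ 2) +
      (dpart i0 (U i1) x t ^+ 2 + dpart i1 (U i1) x t ^+ 2 + dpart i2 (U i1) x t ^+ 2) +
      (dpart i0 (U i2) x t ^+ 2 + dpart i1 (U i2) x t ^+ 2 + dpart i2 (U i2) x t ^+ 2)).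
    by apply/funext => x; apply/funext => t; rewrite /gradsq !sum3.
  have cs i : cls 0 (fun x t => dpart i0 (U i) x t ^+ 2 + dpart i1 (U i) x t ^+ 2 + dpart i2 (U i) x t ^+ 2).
    exact: (axis_classD (axis_classD (cd i i0) (cd i i1)) (cd i i2)).
  exact: (axis_classD (axis_classD (cs i0) (cs i1)) (cs i2)).
have h : cls 0 gradsq_off := axis_classM cg (axis_classM (axis_class_rinv ta tb) cls_cyl_r).
exact: axis_classW h.
Qed.

Lemma cls_ysq_cut N : cls (-1) (ysq_cut N).
Proof. exact: (axis_classM cls_ysq (cls_cutoff ta0 tbT (N ^- 2) 1)). Qed.

Lemma cls_uysq_cut N : cls (-1) (uysq_cut N).
Proof. exact: (axis_classM cls_uysq (cls_cutoff ta0 tbT (N ^- 2) 3)). Qed.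

Lemma ysq_cut_out N x t : 0 < N -> ~~ inbox N x -> ysq_cut N x t = 0.
Proof. by move=> N0 xN; rewrite /ysq_cut (cutoff_out N0 xN) mulr0. Qed.

Lemma uysq_cut_out N x t : 0 < N -> ~~ inbox N x -> uysq_cut N x t = 0.
Proof. by move=> N0 xN; rewrite /uysq_cut (cutoff_out N0 xN) expr0n mulr0. Qed.

Lemma ysq_cut_axis N x t : cyl_r x = 0 -> ysq_cut N x t = 0.
Proof. by move=> r0; rewrite /ysq_cut ysq_axis// mul0r. Qed.

Lemma uysq_cut_axis N x t : cyl_r x = 0 -> uysq_cut N x t = 0.
Proof. by move=> r0; rewrite /uysq_cut uysq_axis// mul0r. Qed.

(* Without the cutoff, [Zc] and [Vc] become [Z2], and [Pc] the integral of [U * Y2 ^+ 2]. *)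
Definition Zc (N t : R) : R := \int[leb3]_x energy_cut u N x t.
Definition dZc (N t : R) : R := \int[leb3]_x denergy_cut u N x t.
Definition Vc (N t : R) : R := \int[leb3]_x ysq_cut N x t.
Definition Pc (N t : R) : R := \int[leb3]_x uysq_cut N x t.

Section fixed_cutoff.
Variable N : R.
Hypothesis N0 : 0 < N.

Lemma integrable_energy_cut t : ta <= t <= tb -> leb3.-integrable setT (EFin \o (energy_cut u N) ^~ t).
Proof.
move=> tJ; apply: (cls_integrable (N := N) (cls_energy_cut ta0 tbT ns axi N)) tJ.
  by move=> x s; exact: energy_cut_out.
exact: energy_cut_axis.
Qed.

Lemma integrable_ysq_cut t : ta <= t <= tb -> leb3.-integrable setT (EFin \o (ysq_cut N) ^~ t).
Proof.
move=> tJ; apply: (cls_integrable (N := N) (cls_ysq_cut N)) tJ.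
  by move=> x s; exact: ysq_cut_out.
exact: ysq_cut_axis.
Qed.

Lemma integrable_uysq_cut t : ta <= t <= tb -> leb3.-integrable setT (EFin \o (uysq_cut N) ^~ t).
Proof.
move=> tJ; apply: (cls_integrable (N := N) (cls_uysq_cut N)) tJ.
  by move=> x s; exact: uysq_cut_out.
exact: uysq_cut_axis.
Qed.

Let ir t : ta <= t <= tb -> leb3.-integrable setT (EFin \o (energy_rhs nu u N) ^~ t).
Proof.
move=> tJ; apply: (cls_integrable (N := N) (cls_energy_rhs ta0 tbT ns axi N)) tJ.
  by move=> x s; exact: energy_rhs_out.
exact: energy_rhs_axis.
Qed.

Lemma dZc_le (c : R) (f : R3 R -> R -> R) t : ta <= t <= tb ->
  leb3.-integrable setT (EFin \o f ^~ t) ->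
  (forall x, energy_rhs nu u N x t <= c * f x t + slack N * ysq_cut N x t) ->
  dZc N t <= c * (\int[leb3]_x f x t) + slack N * Vc N t.
Proof.
move=> tJ jf h.
apply: le_trans (integral_denergy_cut_le ta0 tbT ns axi nu0 N0 tJ) _.
have i1 : leb3.-integrable setT (EFin \o (fun x => c * f x t)).
  by have := integrableZl measurableT c jf.
have j2 : leb3.-integrable setT (EFin \o (fun x => slack N * ysq_cut N x t)).
  by have := integrableZl measurableT (slack N) (integrable_ysq_cut tJ).
rewrite -(RintegralZl c measurableT jf) -(RintegralZl (slack N) measurableT (integrable_ysq_cut tJ)).
rewrite -(RintegralD measurableT i1 j2).
apply: le_Rintegral => //; first exact: ir.
by have := integrableD measurableT i1 j2.
Qed.

Lemma dZc_le_rate t : ta <= t <= tb -> dZc N t <= rate * Zc N t + slack N * Vc N t.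
Proof.
by move=> tJ; apply: (dZc_le tJ (integrable_energy_cut tJ)) => x; exact: (rhs_le_rate N0 x tJ).
Qed.

Lemma dZc_le_u t : ta <= t <= tb -> dZc N t <= - 3 * Pc N t + slack N * Vc N t.
Proof.
by move=> tJ; apply: (dZc_le tJ (integrable_uysq_cut tJ)) => x; exact: (rhs_le_uysq N0 x tJ).
Qed.

Lemma Zc_continuous : {in `]ta, tb[, continuous (Zc N)}.
Proof.
apply: (cls_integral_continuous N0 (cls_energy_cut ta0 tbT ns axi N)).
  by move=> x s; exact: energy_cut_out.
exact: energy_cut_axis.
Qed.

Lemma dZc_continuous : {in `]ta, tb[, continuous (dZc N)}.
Proof.
apply: (cls_integral_continuous N0 (cls_denergy_cut ta0 tbT ns axi N)).
  by move=> x s; exact: denergy_cut_out.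
exact: denergy_cut_axis.
Qed.

Lemma Vc_continuous : {in `]ta, tb[, continuous (Vc N)}.
Proof.
apply: (cls_integral_continuous N0 (cls_ysq_cut N)).
  by move=> x s; exact: ysq_cut_out.
exact: ysq_cut_axis.
Qed.

Lemma Pc_continuous : {in `]ta, tb[, continuous (Pc N)}.
Proof.
apply: (cls_integral_continuous N0 (cls_uysq_cut N)).
  by move=> x s; exact: uysq_cut_out.
exact: uysq_cut_axis.
Qed.

Lemma is_derive_swirl_time x t : ta <= t <= tb -> is_derive t 1 (G x) (dtswirl u x t).
Proof.
move=> tJ; have tT := in_strip ta0 tbT tJ.
have d i : is_derive t 1 (U i x) (dtime (U i) x t).
  by have [_ [_ [_ h]]] := su i; exact: h.
have h : is_derive t 1 (G x) _ := is_deriveB (is_deriveZ x.1.1 (d i1)) (is_deriveZ x.1.2 (d i0)).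
exact: h.
Qed.

Lemma is_derive_Zc t : t \in `]ta, tb[ -> is_derive t 1 (Zc N) (dZc N t).
Proof.
apply: (cls_integral_derive N0 (cls_energy_cut ta0 tbT ns axi N) (cls_denergy_cut ta0 tbT ns axi N)).
- by move=> x s; exact: energy_cut_out.
- exact: energy_cut_axis.
- by move=> x s; exact: denergy_cut_out.
- exact: denergy_cut_axis.
move=> x s sJ; have d := is_derive_swirl_time x (itvW sJ).
have h : is_derive s 1 (fun s => (rinv x ^+ 3 * cutoff (N ^- 2) x ^+ 3) * (G x s * G x s)) _ :=
  is_deriveZ (rinv x ^+ 3 * cutoff (N ^- 2) x ^+ 3) (is_deriveM d d).
have -> : energy_cut u N x = (fun s => (rinv x ^+ 3 * cutoff (N ^- 2) x ^+ 3) * (G x s * G x s)).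
  apply/funext => y; rewrite /energy_cut.
  by move: (G x y) (rinv x) (cutoff _ x); clear => *; ring.
apply: is_derive_eq h _; rewrite /denergy_cut /GRing.scale/=.
by move: (G x s) (rinv x) (cutoff _ x) (dtswirl u x s); clear => *; ring.
Qed.

Lemma Vc_ge0 t : 0 <= Vc N t.
Proof. by apply: Rintegral_ge0 => x _; rewrite mulr_ge0 ?ysq_ge0 ?cutoff_ge0. Qed.

Lemma Zc_ge0 t : 0 <= Zc N t.
Proof.
by apply: Rintegral_ge0 => x _; rewrite mulr_ge0 ?exprn_ge0 ?cutoff_ge0//; exact: ysq_ge0.
Qed.

Lemma Zc_gronwall s t : s <= t -> s \in `]ta, tb[ -> t \in `]ta, tb[ ->
  Zc N t <= expR (rate * (t - s)) * (Zc N s + slack N * \int[mu]_(x in `[s, t]) Vc N x).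
Proof.
move=> st sJ tJ.
have iV := integrable_in Vc_continuous sJ tJ.
rewrite -(@RintegralZl _ _ R mu `[s, t]%classic (Vc N) (slack N) (measurable_itv _) iV).
apply: (gronwall rate_ge0 is_derive_Zc dZc_continuous _ st sJ tJ).
- move=> x xJ; apply: cvgM; first exact: cvg_cst.
  exact: Vc_continuous.
- by move=> x _; rewrite mulr_ge0 ?(slack_ge0 N0) ?Vc_ge0.
- by move=> x xI; apply: dZc_le_rate; apply: itvW; exact: sub_itv sJ tJ xI.
Qed.

End fixed_cutoff.

End estimates.

(** * Removing the cutoff *)

Section depletion.
Context {R : realType}.
Variables (T ta tb nu M E : R) (u : R3 R -> R -> R3 R) (p : R3 R -> R -> R).
Hypotheses (ta0 : 0 < ta) (tbT : tb < T).
Hypothesis ns : navier_stokes nu T u p.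
Hypothesis axi : axisymmetric T u.
Hypothesis nu0 : 0 < nu.
Hypothesis M0 : 0 <= M.
Hypothesis uM : forall x t, ta <= t <= tb -> sqnorm (u x t) <= M ^+ 2.
Hypothesis energyE : forall t, ta <= t <= tb -> (\int[@leb3 R]_x (sqnorm (u x t))%:E <= E%:E)%E.
Hypothesis dissipE :
  (\int[@lebesgue_measure R]_(t in `]ta, tb[) \int[@leb3 R]_x (gradsq_off u x t)%:E <= E%:E)%E.
Local Notation cls := (axis_class ta tb).
Local Notation leb3 := (@leb3 R).
Local Notation mu := (@lebesgue_measure R).

Definition dissipation t : \bar R := (\int[leb3]_x (gradsq_off u x t)%:E)%E.
Definition Zbar t : \bar R := (\int[leb3]_x (ysq u x t)%:E)%E.

Let su i : smooth_in 4 T (ucomp u i). Proof. by case: ns => h _ _ _; exact: smooth_on_in. Qed.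

Lemma dissip_ge0 t : (0 <= dissipation t)%E.
Proof. by apply: integral_ge0 => x _; rewrite lee_fin gradsq_off_ge0. Qed.

Lemma Zbar_ge0 t : (0 <= Zbar t)%E.
Proof. by apply: integral_ge0 => x _; rewrite lee_fin ysq_ge0. Qed.

Lemma gradsq_off_axis x t : cyl_r x = 0 -> gradsq_off u x t = 0.
Proof. by move=> r0; rewrite /gradsq_off r0 !mulr0. Qed.

Lemma measurable_dissip : measurable_fun `]ta, tb[ dissipation.
Proof.
apply: (measurable_cls_integral ta0 tbT (cls_gradsq_off ta0 tbT ns)).
  by move=> x t; exact: gradsq_off_ge0.
exact: gradsq_off_axis.
Qed.

Lemma measurable_sqnorm t : ta <= t <= tb -> measurable_fun setT (fun x => sqnorm (u x t)).
Proof.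
move=> tJ; have m i : measurable_fun setT (ucomp u i ^~ t).
  exact: (axis_meas (cls_smooth ta0 tbT (su i)) tJ).
have -> : (fun x => sqnorm (u x t)) =
    (fun x => ucomp u i0 x t ^+ 2 + ucomp u i1 x t ^+ 2 + ucomp u i2 x t ^+ 2).
  by apply/funext => x; rewrite sqnormE -ucomp0E -ucomp1E -ucomp2E.
apply: measurable_funD; last exact: measurable_funX.
by apply: measurable_funD; exact: measurable_funX.
Qed.

Lemma sqnorm_ge0 (v : R3 R) : 0 <= sqnorm v.
Proof. by rewrite sqnormE !addr_ge0 ?sqr_ge0. Qed.

Lemma E_ge0 : ta <= tb -> 0 <= E.
Proof.
move=> ab; rewrite -lee_fin; have tJ : ta <= ta <= tb by rewrite lexx.
apply: le_trans (energyE tJ); apply: integral_ge0 => x _.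
by rewrite lee_fin sqnorm_ge0.
Qed.

Lemma Zbar_le t : ta <= t <= tb -> (Zbar t <= 2^-1%:E * (E%:E + dissipation t))%E.
Proof.
move=> tJ.
have mS : measurable_fun setT (EFin \o (fun x => sqnorm (u x t))).
  by apply/measurable_EFinP; exact: measurable_sqnorm.
have mD : measurable_fun setT (EFin \o (gradsq_off u ^~ t)).
  by apply/measurable_EFinP; exact: (axis_meas (cls_gradsq_off ta0 tbT ns) tJ).
apply: (@le_trans _ _ (\int[leb3]_x (2^-1%:E * ((sqnorm (u x t))%:E + (gradsq_off u x t)%:E)))%E).
  apply: ge0_le_integral_sub => [//|x|x|x xI].
  - by rewrite lee_fin ysq_ge0.
  - by rewrite -EFinD -EFinM lee_fin mulr_ge0// addr_ge0 ?sqnorm_ge0 ?gradsq_off_ge0.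
  - by rewrite -EFinD -EFinM lee_fin (ysq_le ta0 tbT ns axi x tJ).
rewrite ge0_integralZl_EFin//; last 2 first.
- by move=> x _; rewrite -EFinD lee_fin addr_ge0 ?sqnorm_ge0 ?gradsq_off_ge0.
- exact: emeasurable_funD.
apply: lee_wpmul2l => //; rewrite ge0_integralD//; last 2 first.
- by move=> x _; rewrite lee_fin sqnorm_ge0.
- by move=> x _; rewrite lee_fin gradsq_off_ge0.
exact: leeD2r (energyE tJ).
Qed.

Lemma VcE N t : 0 < N -> ta <= t <= tb -> (Vc u N t)%:E = (\int[leb3]_x (ysq_cut u N x t)%:E)%E.
Proof. by move=> N0 tJ; rewrite /Vc /Rintegral fineK//; exact: integrable_fin_num (integrable_ysq_cut ta0 tbT ns axi N0 tJ). Qed.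

Lemma ZcE N t : 0 < N -> ta <= t <= tb -> (Zc u N t)%:E = (\int[leb3]_x (energy_cut u N x t)%:E)%E.
Proof. by move=> N0 tJ; rewrite /Zc /Rintegral fineK//; exact: integrable_fin_num (integrable_energy_cut ta0 tbT ns axi N0 tJ). Qed.

Lemma Vc_le_Zbar N t : 0 < N -> ta <= t <= tb -> ((Vc u N t)%:E <= Zbar t)%E.
Proof.
move=> N0 tJ; rewrite VcE//; apply: ge0_le_integral_sub => [//|x|x|x xI].
- by rewrite lee_fin mulr_ge0 ?ysq_ge0 ?cutoff_ge0.
- by rewrite lee_fin ysq_ge0.
- by rewrite lee_fin ler_piMr ?ysq_ge0 ?cutoff_le1.
Qed.

Lemma Zc_le_Zbar N t : 0 < N -> ta <= t <= tb -> ((Zc u N t)%:E <= Zbar t)%E.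
Proof.
move=> N0 tJ; rewrite ZcE//; apply: ge0_le_integral_sub => [//|x|x|x xI].
- by rewrite lee_fin mulr_ge0 ?exprn_ge0 ?cutoff_ge0//; exact: ysq_ge0.
- by rewrite lee_fin ysq_ge0.
- rewrite lee_fin ler_piMr ?exprn_ile1 ?cutoff_ge0 ?cutoff_le1//; exact: ysq_ge0.
Qed.

Lemma dissip_sub_le (A : set R) : A `<=` `]ta, tb[ -> (\int[mu]_(t in A) dissipation t <= E%:E)%E.
Proof.
move=> AI; apply: le_trans dissipE; apply: ge0_le_integral_sub => [//|t|t|t _ //]; exact: dissip_ge0.
Qed.

(** The bound does not depend on [N], so the error in Gronwall's inequality disappears with [slack]
    although [Vc] is not controlled by [Zc]. *)
Lemma Vc_integral_le N s t : 0 < N -> s <= t -> s \in `]ta, tb[ -> t \in `]ta, tb[ ->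
  \int[mu]_(x in `[s, t]) Vc u N x <= 2^-1 * (E * (t - s) + E).
Proof.
move=> N0 st sJ tJ.
have mI : measurable (`[s, t]%classic : set R) by exact: measurable_itv.
have iI := integrable_in (Vc_continuous ta0 tbT ns axi N0) sJ tJ.
have sub : `[s, t]%classic `<=` `]ta, tb[%classic by move=> x; exact: sub_itv sJ tJ.
have E0 : 0 <= E by apply: E_ge0; have /andP[a b] := itvW sJ; exact: le_trans a b.
rewrite -lee_fin /Rintegral fineK; last exact: (integrable_fin_num _ iI).
apply: (@le_trans _ _ (\int[mu]_(x in `[s, t]) (2^-1%:E * (E%:E + dissipation x)))%E).
  apply: ge0_le_integral_sub => [//|x|x|x xI].
  - by rewrite lee_fin Vc_ge0.
  - by rewrite mule_ge0// adde_ge0// dissip_ge0.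
  - have xJ := itvW (sub _ xI).
    exact: le_trans (Vc_le_Zbar N0 xJ) (Zbar_le xJ).
have mD : measurable_fun `[s, t] dissipation by apply: measurable_funS measurable_dissip.
rewrite ge0_integralZl_EFin//; last 2 first.
- by move=> x _; rewrite adde_ge0// dissip_ge0.
- by apply: emeasurable_funD.
rewrite EFinM; apply: lee_wpmul2l => //.
rewrite ge0_integralD//; last by move=> x _; exact: dissip_ge0.
rewrite EFinD; apply: leeD; last exact: dissip_sub_le.
by rewrite integral_cst//= lebesgue_measure_itv/= lte_fin; case: ifP => // _; rewrite mule0 lee_fin mulr_ge0// subr_ge0.
Qed.

Lemma slack_cvg : slack nu M n.+1%:R @[n --> \oo] --> 0.
Proof.
rewrite [X in _ --> X](_ : _ = 6 * M * 0 + 24 * nu * (0 * 0)); last by rewrite !mulr0 addr0.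
apply: cvgD; first by apply: cvgMr; exact: cvg_harmonic.
apply: cvgMr; under eq_fun do rewrite -exprVn expr2.
by apply: cvgM; exact: cvg_harmonic.
Qed.

Lemma slack_le n : slack nu M n.+1%:R <= 6 * M + 24 * nu.
Proof.
have n1 : 1 <= n.+1%:R :> R by rewrite ler1n.
apply: lerD; first by rewrite ler_pdivrMr ?ltr0n// ler_peMr// mulr_ge0.
by rewrite ler_pdivrMr ?exprn_gt0 ?ltr0n// ler_peMr ?exprn_ege1// mulr_ge0// ltW.
Qed.

(** The mean of the dissipation over the interval is at most E / (t0 - ta); [E + 1] makes the
    contradiction strict. *)
Lemma dissip_small t0 : ta < t0 -> t0 < tb ->
  exists2 s, s \in `]ta, t0[ & (dissipation s <= ((E + 1) / (t0 - ta))%:E)%E.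
Proof.
move=> at0 t0b; apply: contrapT => hn.
have h s : s \in `]ta, t0[ -> (((E + 1) / (t0 - ta))%:E <= dissipation s)%E.
  move=> sI; apply: ltW; rewrite ltNge; apply/negP => ds; apply: hn; by exists s.
have E0 : 0 <= E by apply: E_ge0; exact: ltW (lt_trans at0 t0b).
have d0 : 0 < t0 - ta by rewrite subr_gt0.
have sub : `]ta, t0[%classic `<=` `]ta, tb[%classic.
  by move=> x /=; rewrite !in_itv/= => /andP[-> xt]; exact: lt_trans xt t0b.
have := dissip_sub_le sub; apply/negP; rewrite -ltNge.
apply: (@lt_le_trans _ _ (\int[mu]_(s in `]ta, t0[) (((E + 1) / (t0 - ta))%:E))%E).
  rewrite integral_cst//= lebesgue_measure_itv/= lte_fin at0 -EFinD -EFinM lte_fin.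
  by rewrite divfK ?gt_eqF// ltrDl.
apply: ge0_le_integral_sub => [//|x|x|x xI]; last exact: h.
- by rewrite lee_fin; apply: divr_ge0; [exact: addr_ge0|exact: ltW].
- exact: dissip_ge0.
Qed.

Lemma Zc_cvg t : ta <= t <= tb -> (Zc u n.+1%:R t)%:E @[n --> \oo] --> Zbar t.
Proof.
move=> tJ; have h := @cutoff_integral_cvg R (ysq u ^~ t) (axis_meas (cls_ysq ta0 tbT ns axi) tJ).
have -> : (fun n => (Zc u n.+1%:R t)%:E) = (fun n =>
    \int[leb3]_x (ysq u x t * cutoff (n.+1%:R ^- 2) x ^+ 3)%:E)%E.
  by apply/funext => n; rewrite ZcE.
exact: (h (fun x => ysq_ge0 u x t)).
Qed.

Definition Vbound : R := 2^-1 * (E * (tb - ta) + E).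

Lemma Vc_integral_le_bound N s t : 0 < N -> s <= t -> s \in `]ta, tb[ -> t \in `]ta, tb[ ->
  \int[mu]_(x in `[s, t]) Vc u N x <= Vbound.
Proof.
move=> N0 st sJ tJ; apply: le_trans (Vc_integral_le N0 st sJ tJ) _.
have /andP[as_ sb] := itvW sJ; have /andP[at_ tb_] := itvW tJ.
have E0 : 0 <= E by apply: E_ge0; exact: le_trans as_ sb.
by rewrite ler_wpM2l// lerD2r ler_wpM2l// lerB.
Qed.

Lemma Vbound_ge0 : ta <= tb -> 0 <= Vbound.
Proof.
move=> ab; have E0 := E_ge0 ab.
by rewrite /Vbound mulr_ge0// addr_ge0// mulr_ge0// subr_ge0.
Qed.

Lemma Zc_growth N s t : 0 < N -> s <= t -> s \in `]ta, tb[ -> t \in `]ta, tb[ ->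
  Zc u N t <= expR (rate nu M * (tb - ta)) * (Zc u N s + slack nu M N * Vbound).
Proof.
move=> N0 st sJ tJ.
apply: le_trans (Zc_gronwall ta0 tbT ns axi nu0 M0 uM N0 st sJ tJ) _.
have /andP[as_ sb] := itvW sJ; have /andP[at_ tb_] := itvW tJ.
apply: ler_pM.
- exact: expR_ge0.
- apply: addr_ge0; first exact: Zc_ge0.
  by rewrite mulr_ge0 ?(slack_ge0 nu0 M0 N0)//; apply: Rintegral_ge0 => x _; exact: Vc_ge0.
- rewrite ler_expR; apply: ler_wpM2l; first exact: rate_ge0.
  exact: lerB.
- by rewrite lerD2l ler_wpM2l ?(slack_ge0 nu0 M0 N0)// Vc_integral_le_bound.
Qed.

(** Finite dissipation at some time s < t0 makes the full weighted energy finite at s by [Zbar_le].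
    The growth estimate for the truncated energies carries this bound forward uniformly in [N], and
    monotone convergence removes the cutoff. *)
Lemma Zbar_bounded t0 : t0 \in `]ta, tb[ -> exists2 B : R, 0 <= B &
  forall t, t0 <= t -> t \in `]ta, tb[ -> (Zbar t <= B%:E)%E.
Proof.
rewrite in_itv/= => /andP[at0 t0b].
have ab : ta <= tb by exact: ltW (lt_trans at0 t0b).
have [s sI ds] := dissip_small at0 t0b.
have sJ : s \in `]ta, tb[.
  by move: sI; rewrite !in_itv/= => /andP[-> st]; exact: lt_trans st t0b.
have st0 : s <= t0 by move: sI; rewrite in_itv/= => /andP[_ /ltW].
set C := (E + 1) / (t0 - ta) in ds.
have hZ : (Zbar s <= (2^-1 * (E + C))%:E)%E.
  apply: le_trans (Zbar_le (itvW sJ)) _; rewrite EFinM lee_wpmul2l//.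
  by rewrite EFinD leeD2l.
pose B := expR (rate nu M * (tb - ta)) * (2^-1 * (E + C) + (6 * M + 24 * nu) * Vbound).
have hB t : t0 <= t -> t \in `]ta, tb[ -> (Zbar t <= B%:E)%E.
  move=> t0t tJ; rewrite -(cvg_lim _ (Zc_cvg (itvW tJ)))//.
  apply: lime_le; first by apply/cvg_ex; exists (Zbar t); exact: Zc_cvg (itvW tJ).
  apply: nearW => n; rewrite lee_fin.
  apply: le_trans (Zc_growth (ltr0Sn R n) (le_trans st0 t0t) sJ tJ) _.
  rewrite ler_wpM2l ?expR_ge0// lerD//.
    by rewrite -lee_fin; apply: le_trans (Zc_le_Zbar (ltr0Sn R n) (itvW sJ)) hZ.
  by rewrite ler_wpM2r ?slack_le ?Vbound_ge0.
exists B => //; have t0J : t0 \in `]ta, tb[ by rewrite in_itv/= at0.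
by rewrite -lee_fin; apply: le_trans (hB _ (lexx _) t0J); exact: Zbar_ge0.
Qed.

(** The growth estimate read backwards: the truncated energy at [t1] tends to a positive limit and
    is at most a fixed multiple of its value at any earlier t, up to an error that vanishes with the
    slack. *)
Lemma Zc_lower t0 t1 : t0 \in `]ta, tb[ -> t1 \in `]ta, tb[ -> t0 <= t1 -> (0 < Zbar t1)%E ->
  exists2 c : R, 0 < c & exists n0 : nat, forall n, (n0 <= n)%N ->
    forall t, t \in `[t0, t1] -> c <= Zc u n.+1%:R t.
Proof.
move=> t0J t1J t01 z0.
have ab : ta <= tb by have /andP[a b] := itvW t0J; exact: le_trans a b.
have [B B0 hB] := Zbar_bounded t0J.
have zf : Zbar t1 \is a fin_num.
  by rewrite ge0_fin_numE ?Zbar_ge0//; apply: le_lt_trans (hB _ t01 t1J) _; exact: ltry.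
set z := fine (Zbar t1).
have zp : 0 < z by apply: fine_gt0; rewrite z0/= ltey_eq zf.
have cz : Zc u n.+1%:R t1 @[n --> \oo] --> z.
  by have := Zc_cvg (itvW t1J); rewrite -(fineK zf) => /fine_cvg.
set K := expR (rate nu M * (tb - ta)).
have K0 : 0 < K by exact: expR_gt0.
have cs : slack nu M n.+1%:R * Vbound @[n --> \oo] --> 0.
  by rewrite -[X in _ --> X](mul0r Vbound); apply: cvgMl; exact: slack_cvg.
(* Half of the limit survives at [t1], hence z / (2 K) at time t; half of that is sacrificed to the
   error term. *)
have c0 : 0 < z / (4 * K) by rewrite divr_gt0// mulr_gt0.
exists (z / (4 * K)) => //.
have z2 : z / 2 < z by rewrite ltr_pdivrMr// ltr_pMr// ltr1n.
have [n1 _ h1] := cvgr_gt _ cz _ z2.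
have [n2 _ h2] := cvgr_lt _ cs _ c0.
exists (maxn n1 n2) => n; rewrite geq_max => /andP[n1n n2n] t tI.
have h3 := h1 _ n1n; have h4 := h2 _ n2n.
have tt1 : t <= t1 by move: tI; rewrite in_itv/= => /andP[].
have := Zc_growth (ltr0Sn R n) tt1 (sub_itv t0J t1J tI) t1J; rewrite -/K => h5.
have {h5} : K^-1 * (z / 2) <= Zc u n.+1%:R t + slack nu M n.+1%:R * Vbound.
  by rewrite ler_pdivrMl//; apply: le_trans h5; exact: ltW.
have -> : K^-1 * (z / 2) = z / (4 * K) + z / (4 * K) by field; rewrite gt_eqF.
move=> h5; rewrite -(lerD2r (z / (4 * K))); apply: le_trans h5 _.
by rewrite lerD2l; exact: ltW.
Qed.

Lemma axis_class_max0 d (f : R3 R -> R -> R) : cls d f -> cls d (fun x t => Num.max (f x t) 0).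
Proof.
move=> [hO hx ht hm]; split.
- move=> N; have [C C0 hC] := hO N; exists C => // x t xN r0 tJ; apply: le_trans (hC x t xN r0 tJ).
  by rewrite ger0_norm ?le_max ?lexx ?orbT// ge_max ler_norm normr_ge0.
- move=> x t r0 tJ; apply: (continuous_max (f := f ^~ t) (g := cst 0)); first exact: hx.
  exact: cvg_cst.
- move=> x t tJ; apply: (continuous_max (f := f x) (g := cst 0)); first exact: ht.
  exact: cvg_cst.
- by move=> t tJ; apply: measurable_maxr => //; exact: hm.
Qed.

(** [Zr] and [Pr] are real with default value 0, whereas [Zbar] keeps the value +oo; [ZrE]
    identifies [Zr] with [Zbar] once finiteness is known. *)
Definition Zr t : R := \int[leb3]_x ysq u x t.
Definition Pr t : R := \int[leb3]_x uysq u x t.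

Lemma measurable_Zr : measurable_fun `]ta, tb[ Zr.
Proof.
apply: measurableT_comp; first exact: fine_measurable.
apply: (measurable_cls_integral ta0 tbT (cls_ysq ta0 tbT ns axi)).
  by move=> x t; exact: ysq_ge0.
by move=> x t; exact: ysq_axis.
Qed.

Lemma measurable_Pr : measurable_fun `]ta, tb[ Pr.
Proof.
apply: measurableT_comp; first exact: fine_measurable.
have c := cls_uysq ta0 tbT ns axi.
have c' : cls (-1) (fun x t => - uysq u x t).
  have := axis_classM (axis_class_cst ta tb (-1)) c.
  by rewrite add0r; under eq_fun do under eq_fun do rewrite mulN1r.
(* Measurability in time is available for nonnegative integrands. The splitting into positive and
   negative parts is the definition of the integral, so it holds at every time, integrable or
   not. *)
have -> : (fun t => \int[leb3]_x (uysq u x t)%:E)%E = (fun t =>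
    \int[leb3]_x (Num.max (uysq u x t) 0)%:E - \int[leb3]_x (Num.max (- uysq u x t) 0)%:E)%E.
  apply/funext => t; rewrite integralE; congr (_ - _)%E.
    by apply: eq_integral => x _; rewrite funeposE EFin_max.
  by apply: eq_integral => x _; rewrite funenegE -EFinN EFin_max.
apply: emeasurable_funB.
- apply: (measurable_cls_integral ta0 tbT (axis_class_max0 c)).
    by move=> x t; rewrite le_max lexx orbT.
  by move=> x t r0; rewrite uysq_axis// maxxx.
- apply: (measurable_cls_integral ta0 tbT (axis_class_max0 c')).
    by move=> x t; rewrite le_max lexx orbT.
  by move=> x t r0; rewrite uysq_axis// oppr0 maxxx.
Qed.

Let mD t : ta <= t <= tb -> measurable_fun setT (EFin \o (gradsq_off u ^~ t)).
Proof.
by move=> tJ; apply/measurable_EFinP; exact: (axis_meas (cls_gradsq_off ta0 tbT ns) tJ).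
Qed.

Lemma uysq_cut_le N x t : 0 < N -> ta <= t <= tb -> `|uysq_cut u N x t| <= M * gradsq_off u x t.
Proof.
move=> N0 tJ; rewrite normrM; apply: le_trans (uysq_le ta0 tbT ns axi M0 uM x tJ).
by rewrite ler_piMr// ger0_norm ?exprn_ge0 ?exprn_ile1 ?cutoff_ge0 ?cutoff_le1.
Qed.

Lemma Pc_le N t : 0 < N -> ta <= t <= tb -> ((`|Pc u N t|)%:E <= M%:E * dissipation t)%E.
Proof.
move=> N0 tJ.
have ii := integrable_uysq_cut ta0 tbT ns axi N0 tJ.
rewrite -abse_EFin /Pc /Rintegral fineK; last exact: (integrable_fin_num _ ii).
apply: le_trans (le_abse_integral _ _ (measurable_int _ ii)) _ => //.
rewrite /dissipation -ge0_integralZl_EFin//; last 2 first.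
- by move=> x _; rewrite lee_fin gradsq_off_ge0.
- exact: mD.
apply: ge0_le_integral_sub => [//|x|x|x _].
- exact: abse_ge0.
- by rewrite -EFinM lee_fin mulr_ge0// gradsq_off_ge0.
- by rewrite -EFinM lee_fin; exact: uysq_cut_le.
Qed.

Lemma Pc_cvg t : ta <= t <= tb -> (dissipation t < +oo)%E -> Pc u n.+1%:R t @[n --> \oo] --> Pr t.
Proof.
move=> tJ dt.
have idis : leb3.-integrable setT (fun x => M%:E * (gradsq_off u x t)%:E)%E.
  apply: integrableZl => //; apply/integrableP; split; first exact: mD.
  under eq_integral do rewrite gee0_abs ?lee_fin ?gradsq_off_ge0//.
  exact: dt.
have h1 n : measurable_fun setT (EFin \o (uysq_cut u n.+1%:R ^~ t)).
  by apply/measurable_EFinP; exact: (axis_meas (cls_uysq_cut ta0 tbT ns axi n.+1%:R) tJ).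
have h2 : measurable_fun setT (EFin \o (uysq u ^~ t)).
  by apply/measurable_EFinP; exact: (axis_meas (cls_uysq ta0 tbT ns axi) tJ).
have h3 : {ae leb3, forall x, setT x -> (EFin \o (uysq_cut u n.+1%:R ^~ t)) x @[n --> \oo] -->
    (EFin \o (uysq u ^~ t)) x}.
  apply: aeW => x _; apply: cvg_EFin; first by near=> n.
  rewrite -[X in _ --> X]mulr1; apply: cvgM; first exact: cvg_cst.
  rewrite -[X in _ --> X](expr1n _ 3).
  exact: (cvg_comp _ _ (cutoff_cvg x) (@exprn_continuous R 3 1)).
have h4 : {ae leb3, forall x, forall n, setT x ->
    (`|(EFin \o (uysq_cut u n.+1%:R ^~ t)) x| <= M%:E * (gradsq_off u x t)%:E)%E}.
  by apply: aeW => x n _; rewrite -EFinM lee_fin; exact: uysq_cut_le.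
have [j1 _ h] := @dominated_convergence _ _ R leb3 setT measurableT
  (fun n => EFin \o (uysq_cut u n.+1%:R ^~ t)) (EFin \o (uysq u ^~ t))
  (fun x => M%:E * (gradsq_off u x t)%:E)%E h1 h2 h3 idis h4.
move: h; rewrite -(fineK (integrable_fin_num measurableT j1)) => /fine_cvg.
exact.
Unshelve. all: end_near. Qed.

Lemma ZrE t : (Zbar t < +oo)%E -> (Zr t)%:E = Zbar t.
Proof. by move=> zt; rewrite /Zr /Rintegral fineK// ge0_fin_numE// Zbar_ge0. Qed.

Lemma Zc_cvg_Zr t : ta <= t <= tb -> (Zbar t < +oo)%E -> Zc u n.+1%:R t @[n --> \oo] --> Zr t.
Proof. by move=> tJ zt; have := Zc_cvg tJ; rewrite -(ZrE zt) => /fine_cvg. Qed.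

Lemma dissip_integrable s t : s \in `]ta, tb[ -> t \in `]ta, tb[ ->
  mu.-integrable `[s, t] dissipation.
Proof.
move=> sJ tJ; have sub : `[s, t]%classic `<=` `]ta, tb[%classic by move=> x; exact: sub_itv sJ tJ.
apply/integrableP; split.
  by apply: measurable_funS measurable_dissip.
under eq_integral do rewrite gee0_abs ?dissip_ge0//.
by apply: le_lt_trans (dissip_sub_le sub) _; exact: ltry.
Qed.

(** By [dZc_le_u], an upper bound for the time derivative of [ln (Zc u N t)]. *)
Definition quotient N t : R := (- 3 * Pc u N t + slack nu M N * Vc u N t) / Zc u N t.

Section interval.
Variables t0 t1 : R.
Hypotheses (t0J : t0 \in `]ta, tb[) (t1J : t1 \in `]ta, tb[) (t01 : t0 < t1).
Let tI t : t \in `[t0, t1] -> t \in `]ta, tb[. Proof. exact: sub_itv. Qed.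

Lemma is_derive_ln_Zc N t : 0 < N -> t \in `[t0, t1] -> 0 < Zc u N t ->
  is_derive t 1 (fun t => ln (Zc u N t)) (dZc u N t / Zc u N t).
Proof.
move=> N0 tt z0.
exact: is_derive_comp1 (is_derive_Zc ta0 tbT ns axi N0 (tI tt)) (is_derive1_ln z0).
Qed.

Lemma quotient_integrable N : 0 < N -> (forall t, t \in `[t0, t1] -> 0 < Zc u N t) ->
  mu.-integrable `[t0, t1] (EFin \o quotient N).
Proof.
move=> N0 z0; apply: continuous_itv_integrable => t tt.
have c1 := Zc_continuous ta0 tbT ns axi N0 (tI tt).
have c2 := Vc_continuous ta0 tbT ns axi N0 (tI tt).
have c3 := Pc_continuous ta0 tbT ns axi N0 (tI tt).
apply: cvgM; last by apply: cvgV => //; rewrite gt_eqF// z0.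
by apply: cvgD; apply: cvgM => //; exact: cvg_cst.
Qed.

Lemma ln_Zc_le N : 0 < N -> (forall t, t \in `[t0, t1] -> 0 < Zc u N t) ->
  ln (Zc u N t1) - ln (Zc u N t0) <= \int[mu]_(t in `[t0, t1]) quotient N t.
Proof.
move=> N0 z0.
have cd t : t \in `[t0, t1] -> {for t, continuous (fun t => dZc u N t / Zc u N t)}.
  move=> tt.
  have c1 := Zc_continuous ta0 tbT ns axi N0 (tI tt).
  have c2 := dZc_continuous ta0 tbT ns axi N0 (tI tt).
  by apply: cvgM => //; apply: cvgV => //; rewrite gt_eqF// z0.
have -> : ln (Zc u N t1) - ln (Zc u N t0) = \int[mu]_(t in `[t0, t1]) (dZc u N t / Zc u N t).
  by rewrite /Rintegral
    (integral_antiderivative (ltW t01) (fun t tt => is_derive_ln_Zc N0 tt (z0 t tt)) cd).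
apply: le_Rintegral.
- exact: measurable_itv.
- exact: continuous_itv_integrable.
- exact: quotient_integrable.
- move=> t tt; rewrite ler_wpM2r ?invr_ge0 ?(ltW (z0 t tt))//.
  exact: (dZc_le_u ta0 tbT ns axi nu0 M0 uM N0 (itvW (tI tt))).
Qed.

Lemma quotient_cvg t : t \in `[t0, t1] -> (dissipation t < +oo)%E -> (Zbar t < +oo)%E -> 0 < Zr t ->
  quotient n.+1%:R t @[n --> \oo] --> - 3 * Pr t / Zr t.
Proof.
move=> tt dt zt z0; have tJ := itvW (tI tt).
apply: cvgM; last by apply: cvgV; [rewrite gt_eqF|exact: Zc_cvg_Zr].
rewrite -[X in _ --> X]addr0; apply: cvgD.
  by apply: cvgM; [exact: cvg_cst|exact: Pc_cvg].
have zf : Zbar t \is a fin_num by rewrite ge0_fin_numE// Zbar_ge0.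
have B0 n : 0 <= slack nu M n.+1%:R * Vc u n.+1%:R t <= slack nu M n.+1%:R * fine (Zbar t).
  have s0 := slack_ge0 nu0 M0 (ltr0Sn R n).
  apply/andP; split; first exact: mulr_ge0 s0 (Vc_ge0 _ _ _).
  apply: ler_wpM2l => //; rewrite -lee_fin (fineK zf).
  exact: (Vc_le_Zbar (ltr0Sn R n) tJ).
apply: (squeeze_cvgr (nearW _ B0)); first exact: cvg_cst.
rewrite -[X in _ --> X](mul0r (fine (Zbar t))); apply: cvgMl.
exact: slack_cvg.
Qed.

(** The majorant for dominated convergence in time: the denominator is bounded below by [Zc_lower],
    and the numerator is at most a multiple of the dissipation, integrable in time, plus a
    constant. *)
Lemma quotient_le N t (c B : R) : 0 < N -> t \in `[t0, t1] -> 0 < c -> c <= Zc u N t ->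
  Vc u N t <= B -> slack nu M N <= 6 * M + 24 * nu ->
  ((`|quotient N t|)%:E <= (3 / c)%:E * (M%:E * dissipation t) + ((6 * M + 24 * nu) * B / c)%:E)%E.
Proof.
move=> N0 tt c0 cz vB sl; have tJ := itvW (tI tt).
have s0 := slack_ge0 nu0 M0 N0; have v0 := Vc_ge0 u N t.
have z0 := lt_le_trans c0 cz.
apply: (@le_trans _ _ ((3 / c * `|Pc u N t|)%:E + ((6 * M + 24 * nu) * B / c)%:E)%E).
  rewrite -EFinD lee_fin normrM normrV ?unitfE ?gt_eqF// (gtr0_norm z0).
  have h : `|- 3 * Pc u N t + slack nu M N * Vc u N t| <= 3 * `|Pc u N t| + (6 * M + 24 * nu) * B.
    apply: le_trans (ler_normD _ _) _; apply: lerD.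
      by rewrite normrM normrN normr_nat.
    by rewrite ger0_norm ?mulr_ge0// ler_pM.
  have -> : 3 / c * `|Pc u N t| + (6 * M + 24 * nu) * B / c =
      (3 * `|Pc u N t| + (6 * M + 24 * nu) * B) / c by rewrite [in RHS]mulrDl [in RHS]mulrAC.
  by apply: ler_pM => //; rewrite ?invr_ge0 ?(ltW z0)// lef_pV2.
rewrite leeD2r// EFinM lee_wpmul2l//; last exact: Pc_le.
by rewrite lee_fin divr_ge0// ltW.
Qed.

(** The division is done before the cutoff is removed, so the limit in [N] acts on a ratio with
    denominator bounded below. The ratio converges at times of finite dissipation, that is, almost
    everywhere. *)
Lemma depletion_le : (0 < Zbar t1)%E ->
  [/\ forall t, t \in `[t0, t1] -> (Zbar t < +oo)%E /\ 0 < Zr t,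
      mu.-integrable `[t0, t1] (EFin \o (fun t => - 3 * Pr t / Zr t)) &
  ln (Zr t1) - ln (Zr t0) <= \int[mu]_(t in `[t0, t1]) (- 3 * Pr t / Zr t)].
Proof.
move=> z1.
have ab : ta <= tb by have /andP[a b] := itvW t0J; exact: le_trans a b.
have [c c0 [n0 hc]] := Zc_lower t0J t1J (ltW t01) z1.
have [B B0 hB] := Zbar_bounded t0J.
have t0t t : t \in `[t0, t1] -> t0 <= t by rewrite in_itv/= => /andP[].
have zf t : t \in `[t0, t1] -> (Zbar t < +oo)%E.
  by move=> tt; apply: le_lt_trans (hB _ (t0t _ tt) (tI tt)) _; exact: ltry.
have zp t : t \in `[t0, t1] -> 0 < Zr t.
  move=> tt; apply: (lt_le_trans c0).
  apply: (ler_cvg_to (cvg_cst c) (Zc_cvg_Zr (itvW (tI tt)) (zf _ tt))).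
  by exists n0 => // n /hc; apply.
have sub : `[t0, t1]%classic `<=` `]ta, tb[%classic by move=> x; exact: sub_itv t0J t1J.
have mQ : measurable_fun `[t0, t1] (fun t => Pr t / Zr t).
  apply: measurable_funM; first by apply: measurable_funS measurable_Pr.
  apply: measurable_inv; first by apply: measurable_funS measurable_Zr.
  by move=> t; apply: Rintegral_ge0 => x _; exact: ysq_ge0.
(* The sequence is shifted by [n0], from which index on the lower bound [c] holds on the whole
   interval. *)
pose f n := EFin \o quotient (n + n0).+1%:R.
pose g t := ((3 / c)%:E * (M%:E * dissipation t) + ((6 * M + 24 * nu) * B / c)%:E)%E.
have zc n t : t \in `[t0, t1] -> c <= Zc u (n + n0).+1%:R t.
  by move=> tt; apply: hc => //; exact: leq_addl.
have zc0 n t : t \in `[t0, t1] -> 0 < Zc u (n + n0).+1%:R t.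
  by move=> tt; apply: lt_le_trans c0 (zc n t tt).
have intf n := quotient_integrable (ltr0Sn R (n + n0)) (zc0 n).
have h1 n : measurable_fun `[t0, t1] (f n) := measurable_int _ (intf n).
have h2 : measurable_fun `[t0, t1] (EFin \o (fun t => - 3 * Pr t / Zr t)).
  have -> : (fun t => - 3 * Pr t / Zr t) = (fun t => - 3 * (Pr t / Zr t)).
    by apply/funext => t; rewrite mulrA.
  by apply/measurable_EFinP; apply: measurable_funM.
have idis := dissip_integrable t0J t1J.
have mI : measurable (`[t0, t1]%classic : set (measurableTypeR R)) := measurable_itv _.
have ig : mu.-integrable `[t0, t1] g.
  apply: integrableD => //.
    by apply: integrableZl => //; apply: integrableZl.
  by apply: continuous_itv_integrable => x _; exact: cvg_cst.
have h3 : {ae mu, forall t, `[t0, t1]%classic t -> f n t @[n --> \oo] --> (- 3 * Pr t / Zr t)%:E}.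
  have := integrable_ae mI idis; apply: filterS => t ht tt.
  have dt : (dissipation t < +oo)%E by rewrite -ge0_fin_numE ?dissip_ge0 ?ht.
  apply: cvg_EFin; first by near=> n.
  have := quotient_cvg tt dt (zf _ tt) (zp _ tt).
  by rewrite -(cvg_shiftn n0).
have h4 : {ae mu, forall t, forall n, `[t0, t1]%classic t -> (`|f n t| <= g t)%E}.
  apply: aeW => t n tt; apply: quotient_le => //; last exact: slack_le.
  - exact: zc.
  - rewrite -lee_fin; apply: le_trans (hB _ (t0t _ tt) (tI tt)).
    exact: (Vc_le_Zbar _ (itvW (tI tt))).
have [j1 _ h] := @dominated_convergence _ _ R mu `[t0, t1]%classic mI f
  (EFin \o (fun t => - 3 * Pr t / Zr t)) g h1 h2 h3 ig h4.
have hlim : \int[mu]_(t in `[t0, t1]) quotient (n + n0).+1%:R t @[n --> \oo] -->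
    \int[mu]_(t in `[t0, t1]) (- 3 * Pr t / Zr t).
  move: h; rewrite -(fineK (integrable_fin_num mI j1)) => /fine_cvg.
  exact.
have lim_ln t : t \in `[t0, t1] -> ln (Zc u (n + n0).+1%:R t) @[n --> \oo] --> ln (Zr t).
  move=> tt; have cz := Zc_cvg_Zr (itvW (tI tt)) (zf _ tt).
  have h' : Zc u (n + n0).+1%:R t @[n --> \oo] --> Zr t by move: cz; rewrite -(cvg_shiftn n0).
  exact: (cvg_comp _ _ h' (continuous_ln (zp _ tt))).
split => //; first by move=> t tt; split; [exact: zf|exact: zp].
have e0 : t0 \in `[t0, t1] by rewrite in_itv/= lexx ltW.
have e1 : t1 \in `[t0, t1] by rewrite in_itv/= lexx ltW.
apply: (ler_cvg_to (cvgB (lim_ln _ e1) (lim_ln _ e0)) hlim).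
by apply: nearW => n; apply: ln_Zc_le => //; exact: zc0.
Unshelve. all: end_near. Qed.

End interval.

End depletion.

(** * The depletion inequality for [Z2] *)

Section swirl_depletion.
Context {R : realType}.
Variables (T nu : R) (u : R3 R -> R -> R3 R) (p : R3 R -> R -> R).
Local Notation leb3 := (@leb3 R).
Local Notation mu := (@lebesgue_measure R).

Lemma sqr_Y2 x t : Y2 u x t ^+ 2 = ysq u x t.
Proof.
rewrite /Y2 /ysq exprMn exprVn sqr_sqrtr ?cyl_r_ge0// u_thetaE.
by rewrite exprMn mulrCA -/(rinv x) /swirl -exprS.
Qed.

Lemma U_Y2 x t : U u x t * Y2 u x t ^+ 2 = uysq u x t.
Proof.
rewrite sqr_Y2 /U u_rE /uysq /urad -/(rinv x) ucomp0E ucomp1E.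
by move: (ysq u x t) (rinv x) (u x t) => *; ring.
Qed.

Lemma Z2E t : Z2 u t = Zr u t.
Proof. by apply: eq_Rintegral => x _; exact: sqr_Y2. Qed.

Lemma U2E t : 0 < Zr u t -> U2 u t = Pr u t / Zr u t.
Proof.
move=> z; rewrite /U2 Z2E z; congr (_ / _).
by apply: eq_Rintegral => x _; exact: U_Y2.
Qed.

(** Regularity gives a bound near each time; compactness of the segment, which stays away from 0 and
    T, makes it uniform. *)
Lemma bounded_segment ta tb : (forall t, 0 < t < T -> regular_time T u t) ->
  0 < ta -> tb < T ->
  exists2 M : R, 0 <= M & forall x t, ta <= t <= tb -> sqnorm (u x t) <= M ^+ 2.
Proof.
move=> reg ta0 tbT.
have /compact_near_coveringP h : compact `[ta, tb]%classic by exact: segment_compact.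
have [M [_ hM]] : \forall M \near +oo, `[ta, tb]%classic `<=` [set t | forall x, enorm (u x t) <= M].
  apply: h => t; rewrite /= in_itv/= => /andP[tat ttb].
  have t0 : 0 < t by exact: lt_le_trans tat.
  have tT : t < T by exact: le_lt_trans tbT.
  have [d d0 [M hM]] : regular_time T u t by apply: reg; rewrite t0.
  exists ([set s | 0 < s < T /\ `|s - t| < d], [set K | M < K]) => /=.
    split; last by exists M; rewrite num_real; split.
    have e0 : 0 < Num.min d (Num.min t (T - t)) by rewrite !lt_min d0 t0 subr_gt0.
    exists (Num.min d (Num.min t (T - t))) => //= s; rewrite /ball_ /= !lt_min => /and3P[h1 h2 h3].
    split; last by rewrite distrC.
    move: h2 h3; rewrite !ltr_norml => /andP[a1 a2] /andP[a3 a4].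
    by apply/andP; split; lra.
  move=> [s K] /= [[/andP[s0 sT] sd] MK] x; apply: le_trans (ltW MK).
  by apply: hM => //; rewrite (ltW s0).
exists (Num.max 0 (M + 1)); first by rewrite le_max lexx.
move=> x t tJ; have h1 : enorm (u x t) <= M + 1 by apply: hM; rewrite ?ltrDl//= in_itv.
rewrite -(sqr_sqrtr (sqnorm_ge0 (u x t))) lerXn2r ?nnegrE ?sqrtr_ge0 ?le_max ?lexx//.
by rewrite h1 orbT.
Qed.

Hypothesis ns : navier_stokes nu T u p.
Hypothesis axi : axisymmetric T u.
Hypothesis nu0 : 0 < nu.
Hypothesis fe : finite_energy T u.
Hypothesis reg : forall t, 0 < t < T -> regular_time T u t.

Lemma swirl_depletion t0 t1 : 0 < t0 -> t0 < t1 -> t1 < T ->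
  (0 < \int[leb3]_x (Y2 u x t1 ^+ 2)%:E)%E ->
  [/\ 0 < Z2 u t0, (Z2 u t1)%:E = (\int[leb3]_x (Y2 u x t1 ^+ 2)%:E)%E &
      ln (Z2 u t1) - ln (Z2 u t0) <= 3 * calA2 u t0 t1].
Proof.
move=> t00 t01 t1T.
have -> : (\int[leb3]_x (Y2 u x t1 ^+ 2)%:E = Zbar u t1)%E.
  by apply: eq_integral => x _; rewrite sqr_Y2.
move=> z1.
(* The window is larger than [t0, t1] on both sides: differentiation under the integral needs
   interior times, and a time of finite dissipation is needed before [t0]. *)
pose ta := t0 / 2; pose tb := (t1 + T) / 2.
have ta0 : 0 < ta by rewrite divr_gt0.
have tat0 : ta < t0 by rewrite /ta; lra.
have t1tb : t1 < tb by rewrite /tb; lra.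
have tbT : tb < T by rewrite /tb; lra.
have [M M0 uM] := bounded_segment reg ta0 tbT.
have [E [hE1 hE2]] := fe.
have hE t : ta <= t <= tb -> (\int[leb3]_x (sqnorm (u x t))%:E <= E%:E)%E.
  move=> /andP[h1 h2]; apply: hE1.
  by rewrite (le_trans (ltW ta0) h1) (le_lt_trans h2 tbT).
have hD : (\int[mu]_(t in `]ta, tb[) dissipation u t <= E%:E)%E.
  apply: le_trans hE2; apply: ge0_le_integral_sub => [t|t|t|t _].
  - rewrite /= !in_itv/= => /andP[h1 h2].
    by rewrite (ltW (lt_trans ta0 h1)) (lt_trans h2 tbT).
  - exact: dissip_ge0.
  - by apply: integral_ge0 => x _; rewrite lee_fin; exact: gradsq_ge0.
  - apply: ge0_le_integral_sub => [//|x|x|x _]; rewrite lee_fin.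
    + exact: gradsq_off_ge0.
    + exact: gradsq_ge0.
    + exact: gradsq_off_le.
have t0J : t0 \in `]ta, tb[ by rewrite in_itv/= tat0 (lt_trans t01).
have t1J : t1 \in `]ta, tb[ by rewrite in_itv/= t1tb (lt_trans tat0).
have [zp iq le] := depletion_le ta0 tbT ns axi nu0 M0 uM hE hD t0J t1J t01 z1.
have e0 : t0 \in `[t0, t1] by rewrite in_itv/= lexx ltW.
have e1 : t1 \in `[t0, t1] by rewrite in_itv/= lexx ltW.
have cA : calA2 u t0 t1 = 3^-1 * \int[mu]_(t in `[t0, t1]) (- 3 * Pr u t / Zr u t).
  have mI : measurable (`[t0, t1]%classic : set (measurableTypeR R)) := measurable_itv _.
  rewrite -(@RintegralZl _ _ R mu `[t0, t1]%classic (fun t => - 3 * Pr u t / Zr u t) 3^-1 mI iq).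
  apply: eq_Rintegral => t; rewrite inE => tt.
  by rewrite U2E ?(zp _ tt).2//; move: (Pr u t) (Zr u t)^-1 => *; field.
rewrite !Z2E cA mulVKf//; split => //; first by have [] := zp _ e0.
by apply: ZrE; have [] := zp _ e1.
Qed.

End swirl_depletion.

(** * Concentration of the swirl near the axis *)

Section wedge.
Context {R : realType}.
Local Notation mu := (@lebesgue_measure R).
Local Notation leb3 := (@leb3 R).

(** Replaces the angular integration of polar coordinates: pi / 2 is the opening of the sector |y|
    <= c seen from the origin. *)
Lemma integral_arc (c : R) : 0 < c ->
  (\int[mu]_(y in `[(- c)%R, c]) ((c ^+ 2 + y ^+ 2)^-1)%:E = (pi / 2 * c^-1)%:E)%E.
Proof.
move=> c0; have cc : - c <= c by lra.
have cn : c != 0 by rewrite gt_eqF.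
have pos (y : R) : c ^+ 2 + y ^+ 2 != 0.
  by rewrite gt_eqF// ltr_wpDr ?sqr_ge0 ?exprn_gt0.
have pos1 (y : R) : 1 + (c^-1 * y) ^+ 2 != 0 by rewrite gt_eqF// ltr_wpDr ?sqr_ge0.
have dh (y : R) : y \in `[- c, c] ->
    is_derive y 1 (fun y => c^-1 * atan (c^-1 * y)) ((c ^+ 2 + y ^+ 2)^-1).
  move=> _.
  have h1 : is_derive y 1 (fun y : R => c^-1 * y) (c^-1).
    have h : is_derive y 1 (fun y : R => c^-1 * y) _ := is_deriveZ c^-1 (is_derive_id y 1).
    by apply: is_derive_eq h _; rewrite /GRing.scale/= mulr1.
  have h2 : is_derive y 1 (fun y : R => c^-1 * atan (c^-1 * y)) _ :=
    is_deriveZ c^-1 (is_derive_comp1 h1 (is_derive1_atan _)).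
  apply: is_derive_eq h2 _; rewrite /GRing.scale/=.
  have := pos y; have := pos1 y => p1 p2; field.
  by rewrite p2 cn.
have ch (y : R) : y \in `[- c, c] -> {for y, continuous (fun y : R => (c ^+ 2 + y ^+ 2)^-1)}.
  move=> _; apply: cvgV => //.
  by apply: cvgD; [exact: cvg_cst|exact: exprn_continuous].
rewrite (integral_antiderivative cc dh ch); congr EFin.
rewrite mulrN atanN mulVf// atan1; field.
exact: cn.
Qed.

Definition shell (d e s : R) : R := (d <= `|s| <= e)%R%:R.

Lemma measurable_shell d e : measurable_fun setT (shell d e).
Proof.
apply: (measurableT_comp (f := fun b : bool => b%:R : R)) => //.
by apply: measurable_and; apply: measurable_fun_ler => //; exact: normr_measurable.
Qed.

Lemma integral_shell (d e : R) : 0 < d -> d <= e ->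
  (\int[mu]_s (shell d e s * `|s|^-1)%:E = (2 * (ln e - ln d))%:E)%E.
Proof.
move=> d0 de.
have e0 : 0 < e by exact: lt_le_trans de.
have mI1 : measurable (`[d, e]%classic : set (measurableTypeR R)) := measurable_itv _.
have mI2 : measurable (`[(- e)%R, (- d)%R]%classic : set (measurableTypeR R)) := measurable_itv _.
have -> : (\int[mu]_s (shell d e s * `|s|^-1)%:E =
    \int[mu]_(s in `[(- e)%R, (- d)%R] `|` `[d, e]) (`|s|^-1)%:E)%E.
  rewrite [RHS]integral_mkcond; apply: eq_integral => s _.
  have [s0|s0] := lerP 0 s.
    rewrite patchE /shell (ger0_norm s0); case: ifPn => [|sn].
      rewrite inE/= !in_itv/= => -[/andP[h1 h2]|-> ]; last by rewrite mul1r.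
      by exfalso; move: (le_trans s0 h2); rewrite oppr_ge0 leNgt d0.
    case: (boolP (d <= s <= e)) => [de1|_]; last by rewrite mul0r.
    by exfalso; move: sn; rewrite notin_setE/= !in_itv/=; apply; right.
  rewrite patchE /shell (ltr0_norm s0); case: ifPn => [|sn].
    rewrite inE/= !in_itv/= => -[/andP[h1 h2]|/andP[h1 h2]].
      by rewrite lerNr h2 lerNl h1 mul1r.
    by exfalso; move: (le_lt_trans h1 s0); rewrite ltNge (ltW d0).
  case: (boolP (d <= - s <= e)) => [/andP[h1 h2]|_]; last by rewrite mul0r.
  exfalso; move: sn; rewrite notin_setE/= !in_itv/=; apply; left.
  by rewrite lerNl h2 lerNr h1.
have mf : measurable_fun (`[(- e)%R, (- d)%R] `|` `[d, e])%classic (fun s : R => (`|s|^-1)%:E).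
  apply: measurable_funTS; apply/measurable_EFinP; apply: measurable_inv => [|x]; last exact: normr_ge0.
  exact: normr_measurable.
have dj : [disjoint `[(- e)%R, (- d)%R]%classic & `[d, e]%classic].
  rewrite disj_set2E; apply/eqP; rewrite -subset0 => s []; rewrite /= !in_itv/= => /andP[_ h1] /andP[h2 _].
  by move: (lt_le_trans d0 (le_trans h2 h1)); rewrite oppr_gt0 ltNge (ltW d0).
have f0 (s : R) : (`[(- e)%R, (- d)%R] `|` `[d, e])%classic s -> (0 <= (`|s|^-1)%:E)%E.
  by move=> _; rewrite lee_fin invr_ge0.
rewrite (ge0_integral_setU mu mI2 mI1 mf f0 dj).
have -> : (2 * (ln e - ln d))%:E = ((- ln (- (- d)) - - ln (- (- e)))%:E + (ln e - ln d)%:E)%E.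
  by rewrite -EFinD !opprK; congr EFin; lra.
have de' : - e <= - d by rewrite lerN2.
have dh1 (s : R) : s \in `[- e, - d] -> is_derive s 1 (fun s => - ln (- s)) (- s)^-1.
  rewrite in_itv/= => /andP[h1 h2]; have s0 : 0 < - s by lra.
  have h : is_derive s 1 (fun s : R => - ln (- s)) _ :=
    is_deriveN (is_derive_comp1 (is_deriveN (is_derive_id s 1)) (is_derive1_ln s0)).
  by apply: is_derive_eq h _; rewrite mulN1r opprK.
have ch1 (s : R) : s \in `[- e, - d] -> {for s, continuous (fun s : R => (- s)^-1)}.
  rewrite in_itv/= => /andP[h1 h2]; apply: cvgV; first by rewrite gt_eqF//; lra.
  by apply: cvgN; exact: cvg_id.
have dh2 (s : R) : s \in `[d, e] -> is_derive s 1 (@ln R) s^-1.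
  by rewrite in_itv/= => /andP[h1 h2]; apply: is_derive1_ln; lra.
have ch2 (s : R) : s \in `[d, e] -> {for s, continuous (fun s : R => s^-1)}.
  rewrite in_itv/= => /andP[h1 h2]; apply: cvgV; first by rewrite gt_eqF//; lra.
  exact: cvg_id.
rewrite -(integral_antiderivative de' dh1 ch1) -(integral_antiderivative de dh2 ch2).
congr (_ + _)%E; apply: eq_integral => s; rewrite inE/= in_itv/= => /andP[h1 h2].
  by rewrite ler0_norm//; lra.
by rewrite ger0_norm//; lra.
Qed.

(* 1/r^2 on the double sector [|s2| <= |s1|] cut to [d <= |s1| <= e]; together with its
   mirror image it covers the region [d <= max(|s1|, |s2|) <= e]. *)
Definition wedge (d e : R) (s : R * R) : R :=
  shell d e s.1 * (`|s.2| <= `|s.1|)%R%:R * (s.1 ^+ 2 + s.2 ^+ 2)^-1.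

Lemma wedge_ge0 d e s : 0 <= wedge d e s.
Proof. by rewrite !mulr_ge0// invr_ge0 addr_ge0 ?sqr_ge0. Qed.

Lemma measurable_wedge d e : measurable_fun setT (wedge d e).
Proof.
apply: measurable_funM; first apply: measurable_funM.
- exact: (measurableT_comp (measurable_shell d e) measurable_fst).
- apply: (measurableT_comp (f := fun b : bool => b%:R : R)) => //.
  apply: measurable_fun_ler.
    exact: (measurableT_comp (@normr_measurable R setT) measurable_snd).
  exact: (measurableT_comp (@normr_measurable R setT) measurable_fst).
- apply: measurable_inv => [|s]; last by rewrite addr_ge0 ?sqr_ge0.
  by apply: measurable_funD; apply: measurable_funX.
Qed.

Lemma integral_wedge_line (d e x : R) : 0 < d ->
  (\int[mu]_y (wedge d e (x, y))%:E = (pi / 2)%:E * (shell d e x * `|x|^-1)%:E)%E.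
Proof.
move=> d0; rewrite /wedge/=; rewrite /shell; case: (boolP (d <= `|x| <= e)) => [/andP[dx xe]|_]; last first.
  rewrite mul0r mule0; under eq_integral do rewrite !mul0r.
  by rewrite integral0.
have x0 : 0 < `|x| by exact: lt_le_trans dx.
rewrite mul1r -EFinM -(integral_arc x0) [RHS]integral_mkcond.
apply: eq_integral => y _; rewrite patchE mul1r (real_normK (num_real x)).
by case: ifPn; [rewrite inE/= in_itv/= -ler_norml => ->; rewrite mul1r
  |rewrite notin_setE/= in_itv/= -ler_norml => /negP/negbTE ->; rewrite mul0r].
Qed.

Lemma integral_wedge_const (d e : R) : 0 < d -> d <= e ->
  (\int[mu]_x ((pi / 2)%:E * (shell d e x * `|x|^-1)%:E) = (pi * (ln e - ln d))%:E)%E.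
Proof.
move=> d0 de; rewrite ge0_integralZl_EFin//.
- by rewrite integral_shell// -EFinM; congr EFin; field.
- by move=> x _; rewrite lee_fin mulr_ge0// invr_ge0.
- apply/measurable_EFinP; apply: measurable_funM; first exact: measurable_shell.
  apply: measurable_inv => // ; exact: normr_measurable.
- by rewrite divr_ge0// pi_ge0.
Qed.

Lemma integral_wedge (d e : R) : 0 < d -> d <= e ->
  (\int[leb2]_s (wedge d e s)%:E = (pi * (ln e - ln d))%:E)%E.
Proof.
move=> d0 de; rewrite leb2E fubini_tonelli1/=; last 2 first.
- by apply/measurable_EFinP; exact: measurable_wedge.
- by move=> s; rewrite lee_fin wedge_ge0.
rewrite -(integral_wedge_const d0 de); apply: eq_integral => x _.
exact: integral_wedge_line.
Qed.

Lemma integral_wedge_swap (d e : R) : 0 < d -> d <= e ->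
  (\int[leb2]_s (wedge d e (unstable.swap s))%:E = (pi * (ln e - ln d))%:E)%E.
Proof.
move=> d0 de; rewrite leb2E fubini_tonelli2/=; last 2 first.
- by apply/measurable_EFinP; exact: (measurableT_comp (measurable_wedge d e) (@measurable_swap _ _ _ _)).
- by move=> s; rewrite lee_fin wedge_ge0.
rewrite -(integral_wedge_const d0 de); apply: eq_integral => x _.
exact: integral_wedge_line.
Qed.

End wedge.

Section concentration.
Context {R : realType}.
Local Notation leb3 := (@leb3 R).

Lemma coords_le_enorm (v : R3 R) :
  [/\ `|v.1.1| <= enorm v, `|v.1.2| <= enorm v & `|v.2| <= enorm v].
Proof.
have a := sqr_ge0 v.1.1; have b := sqr_ge0 v.1.2; have c := sqr_ge0 v.2.
by split; rewrite -sqrtr_sqr ler_wsqrtr// sqnormE; lra.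
Qed.

Lemma enorm_continuous : continuous (@enorm R).
Proof.
move=> x; suff h : {for x, continuous (@sqnorm R)} by exact: (cvg_comp _ _ h (@sqrt_continuous R _)).
have -> : @sqnorm R = (fun x => x.1.1 ^+ 2 + x.1.2 ^+ 2 + x.2 ^+ 2).
  by apply/funext => y; exact: sqnormE.
have sq (f : R3 R -> R) : {for x, continuous f} -> f y ^+ 2 @[y --> x] --> f x ^+ 2.
  by move=> cf; exact: (cvg_comp _ _ cf (@exprn_continuous R 2 (f x))).
have c1 := sq _ (@coord1_continuous R x); have c2 := sq _ (@coord2_continuous R x).
have c3 := sq _ (@coord3_continuous R x).
exact: cvgD (cvgD c1 c2) c3.
Qed.

Lemma measurable_eball (x : R3 R) (e : R) : measurable (eball x e).
Proof.
have m : measurable_fun setT (fun y : R3 R => enorm (y - x)).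
  apply: continuous_measurable_R3 => y.
  apply: (cvg_comp (fun y : R3 R => y - x) (@enorm R)); last exact: enorm_continuous.
  by apply: cvgB; [exact: cvg_id|exact: cvg_cst].
have := m measurableT `]-oo, e[%classic (measurable_itv _); rewrite setTI.
by congr measurable; apply/seteqP; split => y /=; rewrite in_itv.
Qed.

Variables (u : R3 R -> R -> R3 R) (t zs Gs e : R).
Hypothesis Gs0 : 0 < Gs.
Hypothesis e0 : 0 < e.
Local Notation B := (eball (vec 0 0 zs) e).

Lemma sqr_Y2_cyl x : Y2 u x t ^+ 2 = (cyl_r x)^-1 * u_theta u x t ^+ 2.
Proof. by rewrite /Y2 exprMn exprVn sqr_sqrtr ?cyl_r_ge0. Qed.

(** Within distance [rho] of the axis the weight of Y_2 is used; beyond it, |u^theta| <= Gs / r and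
    1/r^2 is covered by one of the two wedges. The inner radius is divided by sqrt 2 because the
    larger of |x_1|, |x_2| is at least r / sqrt 2. *)
Lemma sqr_u_theta_le x (rho : R) : 0 < rho -> B x -> 0 < cyl_r x ->
  `|circulation u x t| <= Gs ->
  u_theta u x t ^+ 2 <= rho * Y2 u x t ^+ 2 +
    Gs ^+ 2 * ((wedge (rho / Num.sqrt 2) e x.1 + wedge (rho / Num.sqrt 2) e (unstable.swap x.1)) * slab zs e x.2).
Proof.
move=> rho0 xB r0 hG; rewrite sqr_Y2_cyl.
have [r_rho|rho_r] := lerP (cyl_r x) rho.
  apply: (@le_trans _ _ (rho * ((cyl_r x)^-1 * u_theta u x t ^+ 2))).
    by rewrite mulrA ler_peMl ?sqr_ge0// ler_pdivlMr// mul1r.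
  by rewrite lerDl mulr_ge0 ?sqr_ge0// mulr_ge0// addr_ge0 ?wedge_ge0.
apply: (@le_trans _ _ (Gs ^+ 2 * (cyl_r x ^+ 2)^-1)).
  rewrite ler_pdivlMr ?exprn_gt0// mulrC -exprMn -/(circulation u x t).
  by rewrite -(real_normK (num_real (circulation u x t))) lerXn2r ?nnegrE// ltW.
apply: (@le_trans _ _ (Gs ^+ 2 * ((wedge (rho / Num.sqrt 2) e x.1 + wedge (rho / Num.sqrt 2) e (unstable.swap x.1)) * slab zs e x.2))); last first.
  by rewrite lerDr mulr_ge0 ?(ltW rho0)// mulr_ge0 ?sqr_ge0// invr_ge0 ltW.
rewrite ler_wpM2l ?sqr_ge0//.
have [] := coords_le_enorm (x - vec 0 0 zs); rewrite /= !subr0 => n1 n2 n3.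
have xe : enorm (x - vec 0 0 zs) < e := xB.
have -> : slab zs e x.2 = 1 by rewrite /slab (le_trans n3 (ltW xe)).
rewrite mulr1 cyl_rE.
have s2 : 0 < Num.sqrt 2 :> R by rewrite sqrtr_gt0.
have d0 : 0 <= rho / Num.sqrt 2 by rewrite divr_ge0// ltW.
have key (a b : R) : `|b| <= `|a| -> a ^+ 2 + b ^+ 2 = cyl_r x ^+ 2 -> `|a| <= e ->
    wedge (rho / Num.sqrt 2) e (a, b) = (a ^+ 2 + b ^+ 2)^-1.
  move=> ba ab ae; rewrite /wedge/= ba /shell ae andbT.
  have -> : rho / Num.sqrt 2 <= `|a|.
    rewrite -(ler_pXn2r (ltn0Sn 1)) ?nnegrE// expr_div_n sqr_sqrtr//.
    rewrite ler_pdivrMr// (real_normK (num_real a)).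
    apply: (@le_trans _ _ (cyl_r x ^+ 2)); first by rewrite lerXn2r ?nnegrE ?cyl_r_ge0 ?ltW.
    have : `|b| ^+ 2 <= `|a| ^+ 2 by rewrite lerXn2r ?nnegrE.
    rewrite -ab (real_normK (num_real a)) (real_normK (num_real b)); lra.
  by rewrite !mul1r.
have [ba|ab] := lerP `|x.1.2| `|x.1.1|.
  have -> : x.1 = (x.1.1, x.1.2) by case: (x.1).
  by rewrite (key _ _ ba) ?cyl_rE ?(le_trans n1 (ltW xe))//= lerDl wedge_ge0.
have -> : unstable.swap x.1 = (x.1.2, x.1.1) by [].
rewrite (key _ _ (ltW ab)) ?cyl_rE ?(le_trans n2 (ltW xe))//=; last by rewrite addrC.
by rewrite [x.1.2 ^+ 2 + _]addrC lerDr wedge_ge0.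
Qed.

Hypothesis mU : forall i, measurable_fun setT (ucomp u i ^~ t).
Hypothesis energy_fin : (\int[leb3]_x (sqnorm (u x t))%:E < +oo)%E.
Hypothesis hG : {ae leb3, forall x, `|circulation u x t| <= Gs}.

Let mx1 : measurable_fun setT (fun x : R3 R => x.1.1).
Proof. exact: continuous_measurable_R3 (@coord1_continuous R). Qed.
Let mx2 : measurable_fun setT (fun x : R3 R => x.1.2).
Proof. exact: continuous_measurable_R3 (@coord2_continuous R). Qed.
Let mk := @measurable_rinv R.

Lemma measurable_u_theta : measurable_fun setT (u_theta u ^~ t).
Proof.
have -> : u_theta u ^~ t = (fun x => (x.1.1 * ucomp u i1 x t - x.1.2 * ucomp u i0 x t) * rinv x).
  by apply/funext => x; rewrite u_thetaE.
by apply: measurable_funM => //; apply: measurable_funB; apply: measurable_funM.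
Qed.

Lemma sqnorm_u_merE x : sqnorm (u_mer u x t) =
  (u_r u x t * (x.1.1 * rinv x)) ^+ 2 + (u_r u x t * (x.1.2 * rinv x)) ^+ 2 + ucomp u i2 x t ^+ 2.
Proof.
rewrite sqnormE /u_mer /= /GRing.scale/= !mulr0 !addr0 add0r mulr1 u_zE.
by [].
Qed.

Lemma measurable_u_mer : measurable_fun setT (fun x => sqnorm (u_mer u x t)).
Proof.
under eq_fun do rewrite sqnorm_u_merE u_rE.
have mr : measurable_fun setT (fun x : R3 R => ((u x t).1.1 * x.1.1 + (u x t).1.2 * x.1.2) * rinv x).
  apply: measurable_funM => //; apply: measurable_funD; apply: measurable_funM => //.
    exact: (mU i0).
  exact: (mU i1).
apply: measurable_funD; last exact: measurable_funX (mU i2).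
by apply: measurable_funD; apply: measurable_funX; apply: measurable_funM => //; apply: measurable_funM.
Qed.

Lemma sqnorm_split x : 0 < cyl_r x ->
  sqnorm (u x t) = u_theta u x t ^+ 2 + sqnorm (u_mer u x t).
Proof.
move=> r0; have kr := rinvE r0.
rewrite sqnorm_u_merE u_rE u_thetaE sqnormE ucomp2E addrA; congr (_ + _).
move: (u x t).1.1 (u x t).1.2 (x.1.1) (x.1.2) (rinv x) kr; clear => a b c d k kr.
transitivity ((a ^+ 2 + b ^+ 2) * (k ^+ 2 * (c ^+ 2 + d ^+ 2))); first by rewrite kr mulr1.
have -> : ((c * b - d * a) * k) ^+ 2 + (((a * c + b * d) * k * (c * k)) ^+ 2 + ((a * c + b * d) * k * (d * k)) ^+ 2) =
  (c * b - d * a) ^+ 2 * k ^+ 2 + (a * c + b * d) ^+ 2 * k ^+ 2 * (k ^+ 2 * (c ^+ 2 + d ^+ 2)) by ring.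
by rewrite [in RHS]kr; ring.
Qed.

Lemma integrable_energy_part (f : R3 R -> R) : measurable_fun setT f -> (forall x, 0 <= f x <= sqnorm (u x t)) ->
  leb3.-integrable B (EFin \o f).
Proof.
move=> mf f0; apply: (@integrableS _ _ _ leb3 setT) => //; first exact: measurable_eball.
apply/integrableP; split; first exact/measurable_EFinP.
apply: le_lt_trans energy_fin; apply: ge0_le_integral_sub => [//|x|x|x _].
- exact: abse_ge0.
- by rewrite lee_fin sqnorm_ge0.
- by have /andP[f1 f2] := f0 x; rewrite /= lee_fin ger0_norm.
Qed.

Lemma sqr_u_theta_le_sqnorm x : 0 <= u_theta u x t ^+ 2 <= sqnorm (u x t).
Proof.
rewrite sqr_ge0/=; have [r0|r0] := cyl_r_cases x.
  by rewrite u_thetaE (rinv_axis r0) mulr0 expr0n/= sqnorm_ge0.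
by rewrite (sqnorm_split r0) lerDl sqnorm_ge0.
Qed.

Lemma sqnorm_u_mer_le x : 0 <= sqnorm (u_mer u x t) <= sqnorm (u x t).
Proof.
rewrite sqnorm_ge0/=; have [r0|r0] := cyl_r_cases x.
  rewrite sqnorm_u_merE (rinv_axis r0) !mulr0 expr0n/= !add0r sqnormE ucomp2E.
  by rewrite lerDr addr_ge0 ?sqr_ge0.
by rewrite (sqnorm_split r0) lerDr sqr_ge0.
Qed.

Lemma measurable_sqnorm_u : measurable_fun setT (fun x => sqnorm (u x t)).
Proof.
under eq_fun do rewrite sqnormE.
apply: measurable_funD; last exact: measurable_funX (mU i2).
by apply: measurable_funD; apply: measurable_funX; [exact: (mU i0)|exact: (mU i1)].
Qed.

Lemma integral_energy_split : \int[leb3]_(x in B) sqnorm (u x t) =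
  \int[leb3]_(x in B) (u_theta u x t ^+ 2) + \int[leb3]_(x in B) sqnorm (u_mer u x t).
Proof.
have mB := measurable_eball (vec 0 0 zs) e.
have mw : measurable_fun setT (fun x => u_theta u x t ^+ 2) by apply: measurable_funX; exact: measurable_u_theta.
have iw := integrable_energy_part mw sqr_u_theta_le_sqnorm.
have im := integrable_energy_part measurable_u_mer sqnorm_u_mer_le.
rewrite -(@RintegralD _ _ R leb3 B (fun x => u_theta u x t ^+ 2) (fun x => sqnorm (u_mer u x t)) mB iw im).
rewrite /Rintegral; congr fine; apply: ae_eq_integral => //.
- by apply: measurable_funTS; apply/measurable_EFinP; exact: measurable_sqnorm_u.
- apply: measurable_funTS; apply/measurable_EFinP; apply: measurable_funD => //.
  exact: measurable_u_mer.
- apply: filterS coord1_ae => x x0 _.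
  by rewrite sqnorm_split// cyl_r_gt0 x0.
Qed.

(** The ball lies in the slab of height 2 e, and the two wedges contribute pi times the logarithm
    each, whence 4 pi e. The integral of |Y_2|^2 stays extended-real, being possibly infinite
    here. *)
Lemma integral_u_theta_le (rho : R) : 0 < rho -> rho <= e ->
  ((\int[leb3]_(x in B) (u_theta u x t ^+ 2))%:E <=
    rho%:E * \int[leb3]_x (Y2 u x t ^+ 2)%:E +
    (Gs ^+ 2 * (4 * pi * e * (ln e - ln (rho / Num.sqrt 2))))%:E)%E.
Proof.
move=> rho0 rhoe.
have mB := measurable_eball (vec 0 0 zs) e.
have mw : measurable_fun setT (fun x => u_theta u x t ^+ 2) by apply: measurable_funX; exact: measurable_u_theta.
have iw := integrable_energy_part mw sqr_u_theta_le_sqnorm.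
have mY : measurable_fun setT (fun x => Y2 u x t ^+ 2).
  under eq_fun do rewrite sqr_Y2_cyl.
  exact: measurable_funM.
set d := rho / Num.sqrt 2.
have s2 : 0 < Num.sqrt 2 :> R by rewrite sqrtr_gt0.
have s1 : 1 <= Num.sqrt 2 :> R by rewrite -[X in X <= _]sqrtr1 ler_wsqrtr// ler1n.
have d0 : 0 < d by rewrite divr_gt0.
have de : d <= e by apply: le_trans rhoe; rewrite ler_pdivrMr// ler_peMr// ltW.
pose w1 (x : R3 R) := wedge d e x.1 * slab zs e x.2.
pose w2 (x : R3 R) := wedge d e (unstable.swap x.1) * slab zs e x.2.
have m1 : measurable_fun setT (wedge d e) := measurable_wedge d e.
have m2 : measurable_fun setT (fun s => wedge d e (unstable.swap s)) := measurableT_comp m1 (@measurable_swap _ _ _ _).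
have ms : measurable_fun setT (fun x : R3 R => slab zs e x.2).
  exact: (measurableT_comp (measurable_slab zs e) measurable_snd).
have mw1 : measurable_fun setT w1 by apply: measurable_funM => //; exact: (measurableT_comp m1 measurable_fst).
have mw2 : measurable_fun setT w2 by apply: measurable_funM => //; exact: (measurableT_comp m2 measurable_fst).
have w10 x : 0 <= w1 x by rewrite mulr_ge0// wedge_ge0.
have w20 x : 0 <= w2 x by rewrite mulr_ge0// wedge_ge0.
have I1 := integral_slab_prod zs e m1 (@wedge_ge0 _ d e).
have I2 := integral_slab_prod zs e m2 (fun s => wedge_ge0 d e (unstable.swap s)).
rewrite (integral_wedge d0 de) -EFinM max_r ?(ltW e0)// in I1.
rewrite (integral_wedge_swap d0 de) -EFinM max_r ?(ltW e0)// in I2.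
rewrite /Rintegral fineK; last exact: (@integrable_fin_num _ _ R leb3 B mB _ iw).
pose F x : \bar R := (rho%:E * (Y2 u x t ^+ 2)%:E + (Gs ^+ 2)%:E * ((w1 x)%:E + (w2 x)%:E))%E.
have FE x : F x = (rho * Y2 u x t ^+ 2 + Gs ^+ 2 * (w1 x + w2 x))%:E by [].
have F0 x : (0 <= F x)%E.
  rewrite FE lee_fin; apply: addr_ge0; first by rewrite mulr_ge0 ?sqr_ge0// ltW.
  by rewrite mulr_ge0 ?sqr_ge0// addr_ge0.
have mYE : measurable_fun setT (fun x => (Y2 u x t ^+ 2)%:E) by exact/measurable_EFinP.
have mW : measurable_fun setT (fun x => (w1 x)%:E + (w2 x)%:E)%E.
  by apply: emeasurable_funD; exact/measurable_EFinP.
have mF : measurable_fun setT F.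
  by apply: emeasurable_funD; apply: measurable_funeM.
apply: (@le_trans _ _ (\int[leb3]_(x in B) F x)%E).
  apply: ae_ge0_le_integral => //.
  - by move=> x _; rewrite lee_fin sqr_ge0.
  - by apply: measurable_funTS; exact/measurable_EFinP.
  - exact: measurable_funTS.
  - apply: filterS2 coord1_ae hG => x x0 xG xB.
    rewrite FE lee_fin /w1 /w2 -mulrDl.
    by apply: sqr_u_theta_le xG; rewrite ?cyl_r_gt0 ?x0.
apply: (@le_trans _ _ (\int[leb3]_x F x)%E); first exact: ge0_le_integral_sub.
rewrite ge0_integralD//; last 4 first.
- by move=> x _; rewrite -EFinM lee_fin mulr_ge0 ?sqr_ge0// ltW.
- exact: measurable_funeM.
- by move=> x _; rewrite -EFinD -EFinM lee_fin mulr_ge0 ?sqr_ge0// addr_ge0.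
- exact: measurable_funeM.
rewrite ge0_integralZl_EFin//; [|by move=> x _; rewrite lee_fin sqr_ge0|exact: ltW].
rewrite leeD2l// ge0_integralZl_EFin//; [|by move=> x _; rewrite -EFinD lee_fin addr_ge0|exact: sqr_ge0].
rewrite ge0_integralD//; [|by move=> x _; rewrite lee_fin|exact/measurable_EFinP
  |by move=> x _; rewrite lee_fin|exact/measurable_EFinP].
rewrite I1 I2 -EFinD -EFinM lee_fin ler_wpM2l ?sqr_ge0//.
by rewrite le_eqVlt; apply/orP; left; apply/eqP; ring.
Qed.

Lemma concentration (A := A_ u (vec 0 0 zs) e t) : 16 * pi * Gs ^+ 2 * ln 2 <= A ^+ 2 ->
  e^-1 * \int[leb3]_(x in B) sqnorm (u_mer u x t) <= A ^+ 2 / 4 ->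
  ((A ^+ 2 / 8 * expR (A ^+ 2 / (8 * pi * Gs ^+ 2)))%:E <= \int[leb3]_x (Y2 u x t ^+ 2)%:E)%E.
Proof.
move=> bigA mer.
have AE : A ^+ 2 = e^-1 * \int[leb3]_(x in B) sqnorm (u x t).
  rewrite /A /A_ sqr_sqrtr// /scaled_energy mulr_ge0 ?invr_ge0 ?(ltW e0)//.
  by apply: Rintegral_ge0 => x _; exact: sqnorm_ge0.
have p0 : 0 < pi :> R by exact: pi_gt0.
set L := A ^+ 2 / (8 * pi * Gs ^+ 2).
have D0 : 0 < 8 * pi * Gs ^+ 2 by rewrite !mulr_gt0 ?exprn_gt0.
have L0 : 0 <= L by rewrite divr_ge0 ?sqr_ge0// ltW.
have LE : 8 * pi * Gs ^+ 2 * L = A ^+ 2 by rewrite mulrC divfK// gt_eqF.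
have x0 : 0 < expR (- L) by exact: expR_gt0.
set rho := e * expR (- L).
have rho0 : 0 < rho by rewrite mulr_gt0.
have rhoe : rho <= e by rewrite ler_piMr ?(ltW e0)// -expR0 ler_expR oppr_le0.
have := integral_u_theta_le rho0 rhoe.
have s2 : 0 < Num.sqrt 2 :> R by rewrite sqrtr_gt0.
have ln2 : 2 * ln (Num.sqrt 2) = ln 2 :> R.
  by rewrite mulr_natl -lnXn// sqr_sqrtr.
have -> : ln e - ln (rho / Num.sqrt 2) = L + ln 2 / 2.
  rewrite ln_div ?posrE// /rho lnM ?posrE// expRK -ln2.
  by move: (ln e) (ln (Num.sqrt 2)) => a b; lra.
have hW : e * (3 / 4 * A ^+ 2) <= \int[leb3]_(x in B) (u_theta u x t ^+ 2).
  move: AE mer; rewrite integral_energy_split.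
  move: (\int[leb3]_(x in B) _) (\int[leb3]_(x in B) _) => a b h1 h2.
  rewrite -ler_pdivlMl//; move: h1; rewrite mulrDr => h1; lra.
(* The choice of [L] makes the main logarithm A^2 / 2; the term with [ln 2] costs at most A^2 / 8,
   which is what the threshold in [bigA] ensures. Of the 3/4 of the energy carried by the swirl, 3/4
   - 5/8 = 1/8 remains near the axis. *)
have hlog : Gs ^+ 2 * (4 * pi * e * (L + ln 2 / 2)) <= e * (5 / 8 * A ^+ 2).
  have -> : Gs ^+ 2 * (4 * pi * e * (L + ln 2 / 2)) =
    e * (1 / 2 * (8 * pi * Gs ^+ 2 * L) + 1 / 8 * (16 * pi * Gs ^+ 2 * ln 2)) by field.
  by rewrite LE ler_wpM2l ?(ltW e0)//; lra.
have : (0 <= \int[leb3]_x (Y2 u x t ^+ 2)%:E)%E.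
  by apply: integral_ge0 => x _; rewrite lee_fin sqr_ge0.
(* An infinite integral satisfies the bound trivially. *)
case: (\int[leb3]_x (Y2 u x t ^+ 2)%:E)%E => [z| |]// z0; last by rewrite leey.
rewrite -EFinM -EFinD !lee_fin => h.
have {}h : e * (1 / 8 * A ^+ 2) <= e * (expR (- L) * z).
  have := le_trans hW (le_trans h (lerD (lexx _) hlog)); rewrite /rho -(mulrA e).
  rewrite ![e * (_ / _ * _)]mulrCA.
  by move: (e * (expR (- L) * z)) (e * A ^+ 2) => a b; lra.
move: h; rewrite ler_pM2l// expRN ler_pdivlMl ?expR_gt0//.
by rewrite mul1r [8^-1 * _]mulrC => h; rewrite mulrC.
Qed.

End concentration.

(** * Combining concentration and depletion *)

Section final.
Context {R : realType}.
Local Notation leb3 := (@leb3 R).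

Lemma ae_le_Lnormy (f : R3 R -> R) (c : R) :
  ('N[leb3]_+oo [EFin \o f] <= c%:E)%E -> {ae leb3, forall x, `|f x| <= c}.
Proof.
rewrite unlock /Lnorm; case: ifPn => [_ /ess_supP|m0 _].
  by apply: filterS => x; rewrite /= lee_fin.
(* When the whole space has measure zero the norm is 0 by convention and carries no information, but
   then the whole space is an admissible exceptional set. *)
exists setT; split => //; apply/eqP; rewrite eq_le measure_ge0 andbT.
by rewrite leNgt.
Qed.

(** The logarithm of the concentration bound is compared with ln Z_2(t0) + 3 A_2 and divided by 3:
    24 is 3 times 8, 2/3 comes from ln A^2, and ln 2 is a third of ln 8. Concentration also supplies
    the positivity of Z_2(t) that the depletion inequality requires. *)
Lemma depletion_of_concentration (nu T Gs t0 t zs e : R) (u : R3 R -> R -> R3 R)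
    (p : R3 R -> R -> R) (A := A_ u (vec 0 0 zs) e t) :
  0 < nu -> navier_stokes nu T u p -> axisymmetric T u -> finite_energy T u ->
  (forall t, 0 < t < T -> regular_time T u t) -> 0 < Gs ->
  ('N[leb3]_+oo [EFin \o (circulation u ^~ t)] <= Gs%:E)%E ->
  0 < t0 -> t0 < t -> t < T -> 0 < e -> 0 < A -> 16 * pi * Gs ^+ 2 * ln 2 <= A ^+ 2 ->
  e^-1 * \int[leb3]_(x in eball (vec 0 0 zs) e) sqnorm (u_mer u x t) <= A ^+ 2 / 4 ->
  calA2 u t0 t >= A ^+ 2 / (24 * pi * Gs ^+ 2) + 2 / 3 * ln A - 1 / 3 * ln (Z2 u t0) - ln 2.
Proof.
move=> nu0 ns axi fe reg Gs0 hN t00 t0t tT e0 A0 bigA mer.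
have tp : 0 < t := lt_trans t00 t0t.
pose ta := t / 2; pose tb := (t + T) / 2.
have ta0 : 0 < ta by rewrite divr_gt0.
have tbT : tb < T by rewrite /tb; lra.
have tJ : ta <= t <= tb by apply/andP; split; rewrite /ta /tb; lra.
have mU i : measurable_fun setT (ucomp u i ^~ t).
  have su : smooth_in 4 T (ucomp u i) by case: ns => h _ _ _; exact: smooth_on_in.
  exact: (axis_meas (cls_smooth ta0 tbT su) tJ).
have fin : (\int[leb3]_x (sqnorm (u x t))%:E < +oo)%E.
  have [E [h _]] := fe; apply: le_lt_trans (h t _) _; last exact: ltry.
  by rewrite (ltW tp).
have h := concentration Gs0 e0 mU fin (ae_le_Lnormy hN) bigA mer.
have X0 : (0 < (A ^+ 2 / 8 * expR (A ^+ 2 / (8 * pi * Gs ^+ 2)))%:E)%E.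
  by rewrite lte_fin mulr_gt0 ?expR_gt0// divr_gt0// exprn_gt0.
have [z0 zE le] := swirl_depletion ns axi nu0 fe reg t00 t0t tT (@lt_le_trans _ _ _ 0%E _ X0 h).
move: h X0; rewrite -zE lee_fin lte_fin => h X0.
have : ln (A ^+ 2 / 8 * expR (A ^+ 2 / (8 * pi * Gs ^+ 2))) <= ln (Z2 u t).
  by rewrite ler_ln ?posrE//; exact: lt_le_trans h.
rewrite lnM ?posrE ?expR_gt0 ?divr_gt0 ?exprn_gt0// expRK.
rewrite ln_div ?posrE ?exprn_gt0// (lnXn 2 A0).
have -> : ln 8 = ln 2 *+ 3 :> R by rewrite -lnXn// -natrX.
have p0 : pi != 0 :> R by rewrite gt_eqF ?pi_gt0.
have g0 : Gs != 0 by rewrite gt_eqF.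
have -> : A ^+ 2 / (24 * pi * Gs ^+ 2) = 3^-1 * (A ^+ 2 / (8 * pi * Gs ^+ 2)).
  by move: p0; move: (A ^+ 2) (@pi R) => a P p0; field; rewrite g0 p0.
move: le; rewrite !mulr2n; clear.
move: (calA2 _ _ _) (ln (Z2 _ _)) (ln (Z2 _ _)) (ln A) (ln 2) (A ^+ 2 / _) => a b c d f g h1 h2.
lra.
Qed.

Lemma leq_homo (phi : nat -> nat) : {homo phi : m n / (m < n)%N} -> forall n, (n <= phi n)%N.
Proof. by move=> h; elim=> // n IH; apply: leq_ltn_trans IH _; exact: h. Qed.

End final.

Theorem theorem10p7 (R : realType) (nu T Gs t0 zs : R)
    (u : R3 R -> R -> R3 R) (p : R3 R -> R -> R)
    (Rj tj : nat -> R) :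
  0 < nu ->
  navier_stokes nu T u p ->
  axisymmetric T u ->
  finite_energy T u ->
  first_singular_time T u ->
  0 < Gs ->
  (forall t, 0 <= t < T ->
    ('N[@leb3 R]_+oo [EFin \o (circulation u ^~ t)] <= Gs%:E)%E) ->
  nontrivial_swirl T u ->
  0 < t0 < T ->
  let xs := vec 0 0 zs in
  let A j := A_ u xs (Rj j) (tj j) in
  (forall j, 0 < Rj j) -> {homo Rj : m n / (m <= n)%N >-> n <= m} ->
  Rj @ \oo --> 0 ->
  (forall j, 0 <= tj j < T) -> {homo tj : m n / (m <= n)%N >-> m <= n} ->
  tj @ \oo --> T ->
  A @ \oo --> +oo ->
  let meridional j :=
    (Rj j)^-1 * \int[@leb3 R]_(x in eball xs (Rj j)) sqnorm (u_mer u x (tj j))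
      > A j ^+ 2 / 4 in
  let depletion j :=
    calA2 u t0 (tj j) >=
      A j ^+ 2 / (24 * pi * Gs ^+ 2) + 2 / 3 * ln (A j)
        - 1 / 3 * ln (Z2 u t0) - ln 2 in
  (\forall j \near \oo, meridional j \/ depletion j) /\
  (forall phi : nat -> nat, {homo phi : m n / (m < n)%N} ->
    (forall k, ~ meridional (phi k)) ->
    calA2 u t0 (tj (phi k)) @[k --> \oo] --> +oo).
Proof.
move=> nu0 ns axi fe [reg _] Gs0 hN _ /andP[t00 t0T] xs A Rj0 _ _ tjT _ tjcvg Acvg
  meridional depletion.
have large K : \forall j \near \oo, K <= A j by move: K; exact/cvgryPge.
have dep : \forall j \near \oo, ~ meridional j -> depletion j.
  near=> j => mer.
  have A1 : 1 <= A j by near: j; exact: large.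
  (* Since A_j >= 1, the threshold on A_j passes to its square. *)
  have AK : 16 * pi * Gs ^+ 2 * ln 2 <= A j by near: j; exact: large.
  have A2 : A j <= A j ^+ 2 by rewrite expr2 ler_peMl// (le_trans ler01).
  have tj0 : t0 < tj j by near: j; exact: cvgr_gt tjcvg _ t0T.
  have /andP[_ tT] := tjT j.
  apply: (depletion_of_concentration nu0 ns axi fe reg Gs0 (hN _ (tjT j)) t00 tj0 tT (Rj0 j)).
  - exact: lt_le_trans A1.
  - exact: le_trans AK A2.
  - by rewrite leNgt; apply/negP.
split.
  by apply: filterS dep => j h; have [m|/h] := pselect (meridional j); [left|right].
move=> phi hphi mer; apply/cvgryPge => K.
have : \forall j \near \oo, (~ meridional j -> K <= calA2 u t0 (tj j)).
  near=> j => m.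
  have A1 : 1 <= A j by near: j; exact: large.
  have A2 : A j <= A j ^+ 2 by rewrite expr2 ler_peMl// (le_trans ler01).
  have d : depletion j by move: m; near: j.
  have D0 : 0 < 24 * pi * Gs ^+ 2 by rewrite !mulr_gt0 ?exprn_gt0 ?pi_gt0.
  (* This makes the quadratic term alone exceed K plus the constants of the lower bound; the
     remaining term in ln A_j is nonnegative because A_j >= 1. *)
  have AK : 24 * pi * Gs ^+ 2 * (K + 1 / 3 * ln (Z2 u t0) + ln 2) <= A j by near: j; exact: large.
  apply: le_trans d; rewrite -lerBlDr opprK -lerBlDr opprK.
  apply: (@le_trans _ _ (A j ^+ 2 / (24 * pi * Gs ^+ 2))).
    rewrite ler_pdivlMr// mulrC (le_trans _ A2)//; apply: le_trans AK.
    by rewrite addrAC.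
  by rewrite lerDl mulr_ge0 ?ln_ge0.
move=> [n0 _ h]; exists n0 => // k /= nk; apply: h (mer k).
exact: leq_trans nk (leq_homo hphi k).
Unshelve. all: end_near. Qed.
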